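(* There are absolute constants $0<c\le C<\infty$ such that the following holds. Let $G$ be a compact abelian group with dual group $\Gamma$, let $S$ be a set, and $\mathcal{H}=\ell^2(S)$. For every family $\lambda=(\lambda_{\gamma,s})_{\gamma\in\Gamma^{\oplus\mathbb{N}},\,s\in S}$ of nonnegative real numbers, the norm $M(\lambda)\in[0,\infty]$ of $\lambda$ as a Fourier multiplier from $H^1\left(G^{\mathbb{N}},\left[(\mathcal{F}_k)_{k=0}^\infty\right],\mathcal{H}\right)$ to $\ell^1(\Gamma^{\oplus\mathbb{N}}\times S)$ satisfies $c\,Q(\lambda)\le M(\lambda)\le C\,Q(\lambda)$, where $$Q(\lambda)=\sup_{k\ge0}\left(\sum_{\gamma'\in\Gamma^{[k+1,\infty)}\setminus\{0\}}\sum_{s\in S}\left(\sum_{\gamma\in\Gamma^k}\lambda_{\gamma\otimes\gamma',s}\right)^2\right)^{1/2}+\sup_{k\ge0}\left(\sum_{s\in S}\left(\sum_{\gamma\in\Gamma^k,\ \gamma_k\ne0}\lambda_{\gamma,s}\right)^2\right)^{1/2}.$$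
   Context: $\mathbb{N}=\{1,2,3,\dots\}$ indexes the coordinates of $G^{\mathbb{N}}$, which carries normalized Haar (product probability) measure. For $k\ge0$, $\mathcal{F}_k$ is the sigma-algebra on $G^{\mathbb{N}}$ generated by the coordinate projection $x\mapsto(x_j)_{j=1}^k$ ($\mathcal{F}_0$ is trivial), and $\mathbb{E}_k=\mathbb{E}(\cdot\mid\mathcal{F}_k)$. For $f\in L^1(G^{\mathbb{N}},\mathcal{H})$ put $\Delta_0f=\mathbb{E}f$ and $\Delta_kf=\mathbb{E}_kf-\mathbb{E}_{k-1}f$ for $k\ge1$. The space $H^1\left(G^{\mathbb{N}},\left[(\mathcal{F}_k)_{k=0}^\infty\right],\mathcal{H}\right)$ consists of those $f\in L^1(G^{\mathbb{N}},\mathcal{H})$ for which $$\|f\|_{H^1}=\mathbb{E}\left(\sum_{k=0}^\infty\|\Delta_kf\|_{\mathcal{H}}^2\right)^{1/2}<\infty.$$ The dual group of $G^{\mathbb{N}}$ is $\Gamma^{\oplus\mathbb{N}}$, the finitely supported sequences in $\Gamma$ (written additively, with $0$ the trivial character), and $\widehat f(\gamma)=\int f\,\overline{\gamma}\in\mathcal{H}$. With $(e_s)_{s\in S}$ the standard basis of $\ell^2(S)$, the multiplier norm $M(\lambda)$ is the least $M\in[0,\infty]$ such that $$\sum_{\gamma\in\Gamma^{\oplus\mathbb{N}},\,s\in S}\lambda_{\gamma,s}\left|\langle\widehat f(\gamma),e_s\rangle\right|\le M\|f\|_{H^1}\quad\text{for all } f\in H^1\left(G^{\mathbb{N}},\left[(\mathcal{F}_k)_{k=0}^\infty\right],\mathcal{H}\right).$$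 $\Gamma^{[k+1,\infty)}$ is the group of finitely supported sequences in $\Gamma$ indexed by $\{k+1,k+2,\dots\}$; for $\gamma\in\Gamma^k$ and $\gamma'\in\Gamma^{[k+1,\infty)}$, $\gamma\otimes\gamma'\in\Gamma^{\oplus\mathbb{N}}$ is their concatenation. An element $\gamma\in\Gamma^k$ is regarded as an element of $\Gamma^{\oplus\mathbb{N}}$ by appending zeros. $\Gamma^0$ is a one-point set, whose element corresponds to $0\in\Gamma^{\oplus\mathbb{N}}$; for $k=0$ the condition $\gamma_k\ne0$ is regarded as vacuous, so that the $k=0$ term of the second supremum is $\left(\sum_{s}\lambda_{0,s}^2\right)^{1/2}$. *)

(* Defs.v *)
From HB Require Import structures.
From mathcomp Require Import all_boot all_order all_algebra.
From mathcomp Require Import complex.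
From mathcomp Require Import all_classical all_reals all_analysis.

Set Implicit Arguments.
Unset Strict Implicit.
Unset Printing Implicit Defensive.

Import Order.TTheory GRing.Theory Num.Theory.
Import numFieldNormedType.Exports.

Local Open Scope classical_set_scope.
Local Open Scope ring_scope.

(** ** The dual group [Γ] of a topological abelian group [G]

    Characters are continuous homomorphisms into the unit circle. [Γ] is
    written additively: its addition is the pointwise product. *)

Section Dual.
Variables (R : realType) (G : topologicalZmodType).

Definition is_character : {pred G -> R[i]} := fun chi =>
  `[< [/\ continuous (chi : G -> R[i]^o),
          forall x y, chi (x + y) = chi x * chi y
        & forall x, `|chi x| = 1] >].

Record dual := Dual { chi :> G -> R[i]; chiP : chi \in is_character }.

HB.instance Definition _ := [isSub for chi].
HB.instance Definition _ := [Choice of dual by <:].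

Fact dual0_subproof : (fun=> 1) \in is_character.
Proof.
apply/asboolP; split=> [x|x y|x]; last by rewrite normr1.
- exact: (@cst_continuous G R[i]^o 1).
- by rewrite mulr1.
Qed.

Fact dualD_subproof (a b : dual) : (fun x => a x * b x) \in is_character.
Proof.
case: a b => [a /asboolP[ac aM a1]] [b /asboolP[bc bM b1]] /=.
apply/asboolP; split=> [x|x y|x].
- exact: (@continuousM R[i] G a b x (ac x) (bc x)).
- by rewrite aM bM mulrACA.
- by rewrite normrM a1 b1 mulr1.
Qed.

Fact dualN_subproof (a : dual) : (fun x => (a x)^-1) \in is_character.
Proof.
case: a => [a /asboolP[ac aM a1]] /=.
apply/asboolP; split=> [x|x y|x].
- apply: (@continuousV R[i] G a x) (ac x).
  by rewrite -normr_eq0 a1 oner_neq0.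
- by rewrite aM invfM.
- by rewrite normfV a1 invr1.
Qed.

Definition dual0 := Dual dual0_subproof.
Definition dualD a b := Dual (dualD_subproof a b).
Definition dualN a := Dual (dualN_subproof a).

Fact dualDA : associative dualD.
Proof. by move=> a b c; apply/val_inj/funext => x /=; rewrite mulrA. Qed.
Fact dualDC : commutative dualD.
Proof. by move=> a b; apply/val_inj/funext => x /=; rewrite mulrC. Qed.
Fact dual0D : left_id dual0 dualD.
Proof. by move=> a; apply/val_inj/funext => x /=; rewrite mul1r. Qed.
Fact dualND : left_inverse dual0 dualN dualD.
Proof.
move=> a; apply/val_inj/funext => x /=; rewrite mulVf//.
by have /asboolP[_ _ a1] := chiP a; rewrite -normr_eq0 a1 oner_neq0.
Qed.

HB.instance Definition _ :=
  GRing.isZmodule.Build dual dualDA dualDC dual0D dualND.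

(** ** [Γ^{⊕N}]: the finitely supported sequences in [Γ]

    Coordinates are numbered from [0]: the coordinate written [γ_j] for
    [j >= 1] is [g j.-1], both here and for points of [G^N]. *)

Definition is_finsupp : {pred nat -> dual} := fun g =>
  `[< finite_set [set j | g j != 0] >].

Fact is_finsupp_zmod : zmod_closed is_finsupp.
Proof.
split=> [|g h /asboolP gf /asboolP hf]; apply/asboolP.
  by rewrite (_ : mkset _ = set0) // -subset0 => j /=; rewrite eqxx.
apply: (@sub_finite_set _ _ ([set j | g j != 0] `|` [set j | h j != 0])).
  move=> j /= gh; have [g0|] := eqVneq (g j) 0; last by left.
  right; apply: contra_neq gh => h0.
  by rewrite -[_ j]/(g j - h j) g0 h0 subrr.
by rewrite finite_setU.
Qed.

HB.instance Definition _ :=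
  GRing.isZmodClosed.Build (nat -> dual) is_finsupp is_finsupp_zmod.

Record dualsum := DualSum {
  dseq :> nat -> dual; dseqP : dseq \in is_finsupp }.

HB.instance Definition _ := [isSub for dseq].
HB.instance Definition _ := [Choice of dualsum by <:].
HB.instance Definition _ := [SubChoice_isSubZmodule of dualsum by <:].

(* [fsbig] product: all but finitely many factors are 1 *)
Definition character_of (g : dualsum) (x : nat -> G) : R[i] :=
  \big[*%R/1]_(j \in [set: nat]) g j (x j).

(* [Γ^k] and [Γ^{[k+1,oo)}] are identified, through extension by zero, with the
   subgroups [dual_head k] and [dual_tail k] of [Γ^{⊕N}]. The concatenation of
   [g] in [dual_head k] and [g'] in [dual_tail k] is then [g + g']. *)
Definition dual_head (k : nat) : set dualsum :=
  [set g | forall j, (k <= j)%N -> g j = 0].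

Definition dual_tail (k : nat) : set dualsum :=
  [set g | forall j, (j < k)%N -> g j = 0].

(* elements of [Γ^k] with nonzero last coordinate, no condition if [k = 0] *)
Definition dual_head_top (k : nat) : set dualsum :=
  [set g | dual_head k g /\ ((0 < k)%N -> g k.-1 != 0)].

End Dual.

(** ** [ℓ^2(S)]-valued functions

    A vector of [ℓ^2(S)] is a function [S -> R[i]] of finite [l2norm]; its
    inner product with [e_s] is its value at [s]. *)

Section VectorValued.
Variables (R : realType) (S : choiceType).

Definition l2norm (v : S -> R[i]) : \bar R :=
  sqrte (\esum_(s in [set: S]) (ComplexField.Normc.normc (v s) ^+ 2)%:E)%E.

Definition ell2 : set (S -> R[i]) := [set v | (l2norm v < +oo)%E].

Section Measurability.
Variables (T : Type) (F : set (set T)).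

Definition simple_function (f : T -> S -> R[i]) :=
  [/\ forall x, ell2 (f x), finite_set (range f)
    & forall v, F (f @^-1` [set v])].

(* Pointwise everywhere, so that [f] is literally [F]-measurable; every class
   of functions modulo null sets has such a representative. *)
Definition strongly_measurable (f : T -> S -> R[i]) :=
  (forall x, ell2 (f x)) /\
  exists2 h : nat -> T -> S -> R[i], forall n, simple_function (h n)
    & forall x, (fun n => l2norm (f x - h n x)) @ \oo --> (0 : \bar R).

End Measurability.

Section Integration.
Context d (T : measurableType d) (P : probability T R).

Definition vL1 (F : set (set T)) (f : T -> S -> R[i]) :=
  strongly_measurable F f /\ (\int[P]_x l2norm (f x) < +oo)%E.

(* integral over [D] of an [ℓ^2(S)]-valued integrable function, by its coordinates *)
Definition vintegral (D : set T) (f : T -> S -> R[i]) : S -> R[i] := fun s =>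
  Complex (\int[P]_(x in D) complex.Re (f x s))
          (\int[P]_(x in D) complex.Im (f x s)).

Definition is_condexp (F : set (set T)) (f g : T -> S -> R[i]) :=
  vL1 F g /\ forall A, F A -> vintegral A g = vintegral A f.

(* A version of the conditional expectation, which is unique almost surely
   (zero when there is none). *)
Definition condexp (F : set (set T)) (f : T -> S -> R[i]) : T -> S -> R[i] :=
  xget (fun=> 0) [set g | is_condexp F f g].

Definition martingale_diff (F : nat -> set (set T)) (f : T -> S -> R[i])
    (k : nat) : T -> S -> R[i] :=
  if k is k'.+1 then fun x => condexp (F k) f x - condexp (F k') f x
  else fun=> vintegral [set: T] f.

Definition H1norm (F : nat -> set (set T)) (f : T -> S -> R[i]) : \bar R :=
  (\int[P]_x
    sqrte (\sum_(0 <= k <oo) l2norm (martingale_diff F f k x) ^+ 2))%E.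

Definition vH1 (F : nat -> set (set T)) (f : T -> S -> R[i]) :=
  vL1 measurable f /\ (H1norm F f < +oo)%E.

End Integration.
End VectorValued.

(** ** Haar measure on [G] and the product measure on [G^N] *)

Section Haar.
Variables (R : realType) (G : topologicalZmodType).

(* [G] with its Borel sigma-algebra *)
Definition pointed_carrier : Type := G.
HB.instance Definition _ := Choice.on pointed_carrier.
HB.instance Definition _ := isPointed.Build pointed_carrier (0 : G).

Definition borel := g_sigma_algebraType (@open G : set (set pointed_carrier)).

(* translation invariant regular Borel probability measure *)
Definition is_haar (mu : probability borel R) :=
  (forall (a : G) (A : set borel), measurable A ->
    mu ((fun x : G => a + x) @^-1` A) = mu A) /\
  (forall A : set borel, measurable A ->
    mu A = ereal_inf [set mu U | U in [set U : set G | open U /\ A `<=` U]]).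

Definition cylinders : set (set (nat -> borel)) :=
  \bigcup_(j in [set: nat])
    preimage_set_system setT (fun x : nat -> borel => x j) measurable.

(* [G^N] with its product sigma-algebra *)
Definition power_space := g_sigma_algebraType cylinders.

Definition is_power_measure (mu : probability borel R)
    (P : probability power_space R) :=
  forall (n : nat) (A : nat -> set borel), (forall j, measurable (A j)) ->
    P [set x : nat -> G | forall j, (j < n)%N -> A j (x j)] =
    (\prod_(j < n) mu (A j))%E.

(* sigma-algebra generated by the first [k] coordinates *)
Definition filtration (k : nat) : set (set power_space) :=
  g_sigma_preimage (fun (j : 'I_k) (x : nat -> borel) => x j).

End Haar.

(** ** The multiplier norm and the quantity [Q] *)

Section Multiplier.
Variables (R : realType) (G : topologicalZmodType) (S : choiceType).

Definition fourier (P : probability (power_space G) R)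
    (f : power_space G -> S -> R[i]) (g : dualsum R G) : S -> R[i] :=
  vintegral P setT (fun x s => f x s * (character_of g x)^*%C).

Local Open Scope ereal_scope.

(* The infimum is attained, hence it is the least such [M]; by the library's
   convention [+oo * 0 = 0]. *)
Definition multiplier_norm (P : probability (power_space G) R)
    (lambda : dualsum R G -> S -> R) : \bar R :=
  ereal_inf [set M : \bar R | 0 <= M /\
    forall f : power_space G -> S -> R[i], vH1 P (@filtration G) f ->
      \esum_(p in [set: dualsum R G * S])
        (lambda p.1 p.2 * ComplexField.Normc.normc (fourier P f p.1 p.2))%:E
      <= M * H1norm P (@filtration G) f].

Definition Qnorm (lambda : dualsum R G -> S -> R) : \bar R :=
  ereal_sup (range (fun k : nat =>
    sqrte (\esum_(g' in dual_tail k `\ (0 : dualsum R G)%R)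
      \esum_(s in [set: S])
      (\esum_(g in dual_head k) (lambda (g + g')%R s)%:E) ^+ 2))) +
  ereal_sup (range (fun k : nat =>
    sqrte (\esum_(s in [set: S])
      (\esum_(g in dual_head_top k) (lambda g s)%:E) ^+ 2))).

End Multiplier.

(* Main.v *)
(* Upper bound: this is the duality of H^1 and BMO. Testing f against the
   trigonometric polynomial with coefficients lambda times the conjugate phases
   of the Fourier coefficients of f, one must bound the sum over k of
   E <Delta_k f, v_k>, where v_k collects the characters whose last nonzero
   coordinate is the k-th. With S_k the partial square functions of f, Garsia's
   argument dominates it by Q E S + (2Q)^-1 sum_i E (S_{i+1} - S_i) sum_{k>=i} |v_k|^2.
   The weight S_{i+1} - S_i depends on finitely many coordinates only, so by
   translation invariance in the other ones characters in different cosets of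
   the corresponding Γ^i are orthogonal for it. This leaves the sums defining
   Q(lambda).

   Lower bound: let Phi >= 0 be the normalized indicator function of a small
   neighbourhood of 0 in the first k coordinates, so that the Fourier
   coefficients of Phi at finitely many given characters in Γ^k have real part
   at least 1/2. The two suprema are reached by testing the multiplier on
   Phi sum_t a_t t, with the t nonzero in Γ^[k+1,oo), and on
   (Phi - E_{k-1} Phi) v, with v in H, and using the self-duality of l^2. *)

Require Import Defs.
From HB Require Import structures.
From mathcomp Require Import all_boot all_order all_algebra.
From mathcomp Require Import complex.
From mathcomp Require Import finmap.
From mathcomp Require Import all_classical all_reals all_analysis.
From mathcomp Require Import measurable_realfun.
From mathcomp Require Import ring lra.
Set Implicit Arguments.
Unset Strict Implicit.
Unset Printing Implicit Defensive.
Import Order.TTheory GRing.Theory Num.Theory.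
Import numFieldNormedType.Exports.
Local Open Scope classical_set_scope.
Local Open Scope ring_scope.

(** The two suprema of [Qnorm] answer to one case distinction. For the weight of index [i], only
    pairs of characters of equal level, at least [i], and with the same tail modulo Γ^i survive: a
    nonzero tail belongs to the first supremum, a zero tail forces level exactly [i] and belongs to
    the second. The upper constant is 2 because the two terms of Garsia's bound give [Q] and
    [Q / 2]. The lower one is 1/6: a coefficient of Phi costs a factor 2, the L^1 norm of Phi -
    E_{k-1} Phi another one, so the suprema are at most [2 * M] and [4 * M]. Two obstacles shape the
    rest. Conditional expectations are determined up to null sets, yet must take values in ℓ^2(S)
    everywhere, with [S] possibly uncountable; hence an explicit version and countable supports.
    Addition on a large compact group need not be measurable for the product of the Borel
    sigma-algebras; hence no convolutions, and invariance is used only for translations by a fixed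
    element, one coordinate at a time. *)

Local Notation normc := ComplexField.Normc.normc.
Local Notation Re := complex.Re.
Local Notation Im := complex.Im.

(** * Points, cylinders and translations of [G^N] *)

Section PowerSpace.
Variables (R : realType) (G : topologicalZmodType).
Local Notation XX := (power_space G).
Implicit Types (x y : XX).

Definition box (n : nat) (B : nat -> set (borel G)) : set XX :=
  [set x | forall j, (j < n)%N -> B j ((x : nat -> borel G) j)].

Lemma measurable_coord (j : nat) (B : set (borel G)) : measurable B ->
  measurable ([set x : XX | B ((x : nat -> borel G) j)]).
Proof.
move=> mB; apply: sub_sigma_algebra; exists j => //; exists B => //.
by rewrite setTI.
Qed.

Lemma measurable_fun_power d (T : measurableType d) (phi : T -> XX) :
  (forall j (B : set (borel G)), measurable B ->
    measurable [set t | B ((phi t : nat -> borel G) j)]) ->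
  measurable_fun setT phi.
Proof.
move=> phiP.
apply: (@measurability _ _ _ _ setT phi (@cylinders G)) => //.
move=> _ [_ [j _ [B mB <-]] <-]; rewrite !setTI; exact: phiP.
Qed.

Lemma measurable_box n B : (forall j, measurable (B j)) -> measurable (box n B).
Proof.
move=> mB.
have -> : box n B = \bigcap_(j in `I_n) [set x | B j ((x : nat -> borel G) j)].
  by apply/seteqP; split=> x bx j; exact: bx.
apply: bigcap_measurableType => j _; exact: measurable_coord.
Qed.

Definition boxes : set (set XX) :=
  [set A | exists n B, (forall j, measurable (B j)) /\ A = box n B].

Lemma boxesI : setI_closed boxes.
Proof.
move=> _ _ [n [B [mB ->]]] [m [C [mC ->]]].
exists (maxn n m), (fun j => (if (j < n)%N then B j else setT) `&`
  (if (j < m)%N then C j else setT)); split.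
  by move=> j; apply: measurableI; case: ifP.
apply/seteqP; split=> x.
  move=> [bx cx] j; rewrite leq_max => /orP h; split.
    by case: ifPn => // /bx.
  by case: ifPn => // /cx.
move=> h; split=> j jn.
  by have [] := h j; rewrite ?leq_max ?jn//.
by have [] := h j; rewrite ?leq_max ?jn ?orbT//.
Qed.

Lemma measurable_boxesE : @measurable _ XX = <<s boxes >>.
Proof.
apply/seteqP; split.
- have cyl : @cylinders G `<=` <<s boxes >>.
    move=> _ [j _ [B mB <-]]; apply: (@sub_sigma_algebra _ setT boxes).
    exists j.+1, (fun i => if i == j then B else setT); split.
      by move=> i; case: ifP.
    rewrite setTI; apply/seteqP; split=> x.
      by move=> Bx i _; case: eqVneq => // ->.
    by move=> /(_ j (ltnSn j)); rewrite eqxx.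
  exact: smallest_sub (smallest_sigma_algebra setT boxes) cyl.
- have mboxes : boxes `<=` @measurable _ XX.
    by move=> _ [n [B [mB ->]]]; exact: measurable_box.
  exact: smallest_sub (smallest_sigma_algebra setT (@cylinders G)) mboxes.
Qed.

(** Boxes are stable under intersection and generate the sigma-algebra, so a measure is identified
    by its values on them. Invariance under translation and under splicing are both obtained this
    way. *)
Lemma power_measure_unique (mu : probability (borel G) R)
    (P : probability XX R) (Q : {measure set XX -> \bar R}) :
  is_power_measure mu P ->
  (forall n B, (forall j, measurable (B j)) ->
     Q (box n B) = (\prod_(j < n) mu (B j))%E) ->
  forall A, measurable A -> Q A = P A.
Proof.
move=> PP QP A mA; apply/esym.
apply: (measure_unique boxes (fun=> setT)) => //.
- exact: measurable_boxesE.
- exact: boxesI.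
(* [box 0] constrains nothing, so the whole space is itself a box. *)
- move=> _; exists 0, (fun=> setT); split=> //.
  by apply/seteqP; split.
- by rewrite bigcup_const.
- by move=> _ [n [B [mB ->]]]; rewrite QP// -PP.
- by move=> _; apply: (le_lt_trans (probability_le1 P measurableT)); rewrite ltry.
Qed.

(** Integrating [splice k x y] over [y] gives the conditional expectation for F_k. In the special
    case [trunc] the tail is [0], and [u (trunc k x) = u x] says that [u] depends on the first [k]
    coordinates only. *)
Definition splice (k : nat) x y : XX :=
  fun j => if (j < k)%N then x j else y j.

Definition trunc (k : nat) x : XX := splice k x (fun=> (0 : G)).

Lemma splice_trunc k x y : splice k (trunc k x) y = splice k x y.
Proof.
by apply: (@funext nat (borel G)) => j; rewrite /trunc /splice; case: (ltnP j k).
Qed.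

Lemma truncK k x : trunc k (trunc k x) = trunc k x.
Proof. exact: splice_trunc. Qed.

Lemma trunc_splice k x y : trunc k (splice k x y) = trunc k x.
Proof. by apply: (@funext nat (borel G)) => j; rewrite /trunc /splice; case: (ltnP j k). Qed.

Lemma trunc_trunc k l x : (k <= l)%N -> trunc k (trunc l x) = trunc k x.
Proof.
move=> kl; apply: (@funext nat (borel G)) => j; rewrite /trunc /splice; case: ifP => // jk.
by rewrite (leq_trans jk kl).
Qed.

Lemma measurable_splice k :
  measurable_fun setT (fun z : XX * XX => splice k z.1 z.2).
Proof.
apply: measurable_fun_power => j B mB; rewrite /splice.
have [jk|jk] := boolP (j < k)%N.
- rewrite -[X in measurable X]setTI.
  exact: (@measurable_fst _ _ XX XX) (measurable_coord j mB).
- rewrite -[X in measurable X]setTI.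
  exact: (@measurable_snd _ _ XX XX) (measurable_coord j mB).
Qed.

Lemma measurable_splicel k y : measurable_fun setT (fun x => splice k x y).
Proof.
have pxy : measurable_fun setT (fun x : XX => (x, y)).
  exact/measurable_fun_pair.
exact: (measurableT_comp (measurable_splice k) pxy).
Qed.

Lemma measurable_splicer k x : measurable_fun setT (splice k x).
Proof.
have pxy : measurable_fun setT (fun y : XX => (x, y)).
  exact/measurable_fun_pair.
exact: (measurableT_comp (measurable_splice k) pxy).
Qed.

Lemma measurable_trunc k : measurable_fun setT (trunc k).
Proof. exact: measurable_splicel. Qed.

(** Turns F_k-measurability into measurability plus an equation. The sets on the right form a
    sigma-algebra containing the generators; conversely [trunc k] pulls every measurable set back
    into F_k, because it does so for cylinders. *)
Lemma filtrationP k (A : set XX) :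
  filtration k A <-> measurable A /\ trunc k @^-1` A = A.
Proof.
have genE : \big[setU/set0]_(i < k) preimage_set_system setT
    (fun x : XX => (x : nat -> borel G) i) measurable =
  [set A | exists i (B : set (borel G)),
     [/\ (i < k)%N, measurable B & A = [set x | B ((x : nat -> borel G) i)]]].
  rewrite -(@bigcup_mkord _ k (fun i => preimage_set_system setT
    (fun x : XX => (x : nat -> borel G) i) measurable)).
  apply/seteqP; split=> [_ [i ik [B mB <-]]|_ [i [B [ik mB ->]]]].
    by exists i, B; split=> //; rewrite setTI.
  by exists i => //; exists B => //; rewrite setTI.
rewrite /filtration /g_sigma_preimage genE; split.
- apply: (@smallest_sub _ _ _ [set A | measurable A /\ trunc k @^-1` A = A]).
  + split => /=.
    * by split => //; exact: measurable0.
    * move=> B [mB BE]; split; first by rewrite setTD; exact: measurableC.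
      by rewrite setTD -preimage_setC BE.
    * move=> F FE; split.
        by apply: bigcupT_measurable => i; have [] := FE i.
      by rewrite preimage_bigcup; apply: eq_bigcupr => i _; have [] := FE i.
  + move=> _ [i [B [ik mB ->]]]; split; first exact: measurable_coord.
    by rewrite /trunc /splice /preimage/=; apply/seteqP; split=> x /=; rewrite ik.
- move=> [mA <-].
  have := mA; rewrite {1}/measurable/=.
  apply: (@smallest_sub _ _ _ [set A | <<s _ >> (trunc k @^-1` A)]).
  + split => /=.
    * by rewrite preimage_set0; exact: sigma_algebra0.
    * move=> B FB; rewrite setTD -preimage_setC.
      by rewrite -setTD; exact: sigma_algebraCD.
    * by move=> F FE; rewrite preimage_bigcup; exact: sigma_algebra_bigcup.
  + move=> _ [j _ [B mB <-]]; rewrite setTI /=.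
    have [jk|jk] := boolP (j < k)%N.
      apply: sub_sigma_algebra; exists j, B; split=> //.
      by apply/seteqP; split=> x; rewrite /trunc /splice /preimage/= jk.
    (* A coordinate from [k] on is constantly [0] after truncation, so the preimage is everything or
       nothing. *)
    have -> : trunc k @^-1` ((fun x : XX => (x : nat -> borel G) j) @^-1` B) =
        if `[< B (0 : G) >] then setT else set0.
      apply/seteqP; split=> x; rewrite /preimage/= /trunc /splice (negbTE jk);
        by case: asboolP.
    case: ifP => _; last exact: sigma_algebra0.
    match goal with |- smallest _ ?g _ =>
      by have := @sigma_algebraCD _ setT g _ (@sigma_algebra0 _ setT g); rewrite setD0 end.
Qed.

End PowerSpace.

(** * Change of variables along measure-preserving maps *)

Section MeasurePreserving.
Context d d' (T : measurableType d) (T' : measurableType d') (R : realType).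
Variables (m : {measure set T -> \bar R}) (m' : {measure set T' -> \bar R}).
Variables (phi : T -> T') (mphi : measurable_fun setT phi).
Hypothesis mpres : forall A, measurable A -> m (phi @^-1` A) = m' A.

Lemma mpres_ge0_integral (f : T' -> \bar R) : measurable_fun setT f ->
  (forall x, 0 <= f x)%E -> (\int[m']_x f x = \int[m]_x f (phi x))%E.
Proof.
move=> mf f0; have := @ge0_integral_pushforward _ _ _ _ R phi mphi m setT f.
rewrite preimage_setT => <- //; apply: eq_measure_integral => A mA _.
by rewrite /= /pushforward mpres.
Qed.

Lemma mpres_integrable (f : T' -> \bar R) : m'.-integrable setT f ->
  m.-integrable setT (f \o phi).
Proof.
move=> /integrableP[mf foo]; apply/integrableP; split.
  exact: measurableT_comp.
rewrite -(mpres_ge0_integral (f := fun x => `|f x|)%E)//.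
exact: measurableT_comp.
Qed.

Lemma mpres_integral (f : T' -> \bar R) : m'.-integrable setT f ->
  (\int[m']_x f x = \int[m]_x f (phi x))%E.
Proof.
move=> fi; have mf := measurable_int m' fi.
have := @integral_pushforward _ _ _ _ R phi mphi m setT f mf.
rewrite preimage_setT => /(_ (mpres_integrable fi) measurableT) <-.
by apply: eq_measure_integral => A mA _; rewrite /= /pushforward mpres.
Qed.

End MeasurePreserving.

(** * Invariance of the product measure under translation and splicing *)

Section PowerMeasure.
Variables (R : realType) (G : topologicalZmodType).
Local Notation XX := (power_space G).
Variables (mu : probability (borel G) R) (P : probability XX R).
Hypothesis haarmu : is_haar mu.
Hypothesis PP : is_power_measure mu P.
Implicit Types (x y : XX).

Lemma measurable_translate (a : G) (B : set (borel G)) : measurable B ->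
  measurable ((fun x : G => a + x) @^-1` B : set (borel G)).
Proof.
move=> mB; rewrite -[X in measurable X]setTI.
pose f : borel G -> borel G := fun x : G => a + x.
suff mf : measurable_fun setT f by exact: mf measurableT B mB.
apply: (@measurability _ _ _ _ setT f
  (@open G : set (set (pointed_carrier G)))) => //.
move=> _ [U oU <-]; rewrite setTI; apply: sub_sigma_algebra.
apply: (@open_comp G G) => // x _.
by apply: continuous2_cvg; [exact: (@tvs.add_continuous G (a, x))|exact: cvg_cst|exact: cvg_id].
Qed.

Definition shift (i : nat) (a : G) x : XX :=
  fun j => if j == i then (a + (x : nat -> G) j : G) else x j.

Lemma measurable_shift i a : measurable_fun setT (shift i a).
Proof.
apply: measurable_fun_power => j B mB; rewrite /shift.
case: eqVneq => _; last exact: measurable_coord.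
exact: (measurable_coord j (measurable_translate a mB)).
Qed.

Lemma shift_mpres i a A : measurable A -> P (shift i a @^-1` A) = P A.
Proof.
have mpush := measurable_shift i a.
apply: (@power_measure_unique _ _ mu P (pushforward P (shift i a)) PP).
move=> n B mB; rewrite /= /pushforward.
have -> : shift i a @^-1` box n B = box n (fun j =>
    if j == i then (fun x : G => a + x) @^-1` B j else B j).
  by apply/seteqP; split=> x bx j /bx; rewrite /shift; case: eqVneq.
rewrite PP; last by move=> j; case: ifP => // _; exact: measurable_translate.
by apply: eq_bigr => j _; case: eqVneq => // _; rewrite haarmu.1.
Qed.

(** Independence of the first [k] coordinates from the others: on a box each coordinate is tested in
    one factor only, and contributes the total mass 1 in the other. *)
Lemma splice_mpres k A : measurable A ->
  (P \x P)%E ((fun z : XX * XX => splice k z.1 z.2) @^-1` A) = P A.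
Proof.
have mpush := @measurable_splice G k.
apply: (@power_measure_unique _ _ mu P
  (pushforward (P \x P)%E (fun z : XX * XX => splice k z.1 z.2)) PP).
move=> n B mB; rewrite /= /pushforward.
pose B1 j := if (j < k)%N then B j else setT.
pose B2 j := if (j < k)%N then setT else B j.
have -> : (fun z : XX * XX => splice k z.1 z.2) @^-1` box n B =
    box n B1 `*` box n B2.
  apply/seteqP; split=> -[x y] /=.
    move=> bxy; split=> j /bxy; rewrite /splice /B1 /B2/=;
      by case: ifP.
  move=> [bx by_] j jn; move: (bx j jn) (by_ j jn); rewrite /splice /B1 /B2/=.
  by case: ifP.
have mB1 j : measurable (B1 j) by rewrite /B1; case: ifP.
have mB2 j : measurable (B2 j) by rewrite /B2; case: ifP.
transitivity (P (box n B1) * P (box n B2))%E.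
  by apply: product_measure1E; exact: measurable_box.
rewrite !PP// -big_split/=; apply: eq_bigr => j _.
rewrite /B1 /B2; case: ifP => _; rewrite probability_setT ?mule1 ?mul1e//.
Qed.

End PowerMeasure.

(** * Complex-valued integrals *)

Section ComplexNorm.
Variable R : realType.
Implicit Types (z w : R[i]).

Lemma sqr_normcE z : normc z ^+ 2 = Re z ^+ 2 + Im z ^+ 2.
Proof. by case: z => a b; rewrite /= sqr_sqrtr// addr_ge0// sqr_ge0. Qed.

Lemma normc_ge0 z : 0 <= normc z.
Proof. by case: z => a b; exact: sqrtr_ge0. Qed.

Lemma normr_Re_le z : `|Re z| <= normc z.
Proof.
by rewrite -ler_sqr ?nnegrE ?normr_ge0 ?normc_ge0// sqr_normcE real_normK
  ?num_real// lerDl sqr_ge0.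
Qed.

Lemma normr_Im_le z : `|Im z| <= normc z.
Proof.
by rewrite -ler_sqr ?nnegrE ?normr_ge0 ?normc_ge0// sqr_normcE real_normK
  ?num_real// lerDr sqr_ge0.
Qed.

Lemma Re_le_normc z : Re z <= normc z.
Proof. exact: le_trans (ler_norm _) (normr_Re_le z). Qed.

Lemma normc_le_ReIm z : normc z <= `|Re z| + `|Im z|.
Proof.
rewrite -ler_sqr ?nnegrE ?addr_ge0 ?normr_ge0 ?normc_ge0// sqr_normcE.
rewrite sqrrD !real_normK ?num_real// -addrA [_ *+ 2 + _]addrC addrA lerDl.
by rewrite mulrn_wge0// mulr_ge0.
Qed.

Lemma ReM z w : Re (z * w) = Re z * Re w - Im z * Im w.
Proof. by case: z; case: w. Qed.

Lemma ImM z w : Im (z * w) = Re z * Im w + Im z * Re w.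
Proof. by case: z => a b; case: w => c d /=; rewrite [b * c]mulrC. Qed.

Lemma ReD z w : Re (z + w) = Re z + Re w.
Proof. by case: z; case: w. Qed.

Lemma ImD z w : Im (z + w) = Im z + Im w.
Proof. by case: z; case: w. Qed.

Lemma Re_conj z : Re z^*%C = Re z. Proof. by case: z. Qed.

Lemma Im_conj z : Im z^*%C = - Im z. Proof. by case: z. Qed.

Lemma conjcM z w : (z * w)^*%C = z^*%C * w^*%C.
Proof. exact: (rmorphM (@conjc R)). Qed.

Lemma Re_real (a : R) : Re (a%:C)%C = a. Proof. by []. Qed.

Lemma Re_sum I (r : seq I) (p : pred I) (F : I -> R[i]) :
  Re (\sum_(i <- r | p i) F i) = \sum_(i <- r | p i) Re (F i).
Proof. exact: (big_morph (@complex.Re R) ReD). Qed.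

Lemma Im_sum I (r : seq I) (p : pred I) (F : I -> R[i]) :
  Im (\sum_(i <- r | p i) F i) = \sum_(i <- r | p i) Im (F i).
Proof. exact: (big_morph (@complex.Im R) ImD). Qed.

Lemma ReIm_eq z w : Re z = Re w -> Im z = Im w -> z = w.
Proof. by case: z => a b; case: w => c d /= -> ->. Qed.

Lemma normc_conj z : normc z^*%C = normc z.
Proof. by case: z => a b; rewrite /= sqrrN. Qed.

Lemma normc_real (a : R) : normc (a%:C)%C = `|a|.
Proof. by rewrite /= expr0n addr0 sqrtr_sqr. Qed.

Lemma normcM z w : normc (z * w) = normc z * normc w.
Proof. exact: ComplexField.Normc.normcM. Qed.

Lemma normc0 : normc (0 : R[i]) = 0.
Proof. exact: ComplexField.Normc.normc0. Qed.

Lemma normc1 : normc (1 : R[i]) = 1.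
Proof. exact: ComplexField.Normc.normc1. Qed.

Lemma normc_eq0 z : normc z = 0 -> z = 0.
Proof. exact: ComplexField.Normc.eq0_normc. Qed.

Lemma le_normcD z w : normc (z + w) <= normc z + normc w.
Proof. exact: complex.le_normcD. Qed.

Lemma le_normc_sum I (r : seq I) (p : pred I) (F : I -> R[i]) :
  normc (\sum_(i <- r | p i) F i) <= \sum_(i <- r | p i) normc (F i).
Proof.
elim/big_rec2: _ => [|i y x _ h]; first by rewrite normc0.
by apply: le_trans (le_normcD _ _) _; rewrite lerD2l.
Qed.

Lemma mulc_conj z : z * z^*%C = ((normc z ^+ 2)%:C)%C.
Proof.
rewrite sqr_normcE; case: z => a b; apply: ReIm_eq; rewrite ?ReM ?ImM/=; ring.
Qed.

(** The conjugate phase; at [0] the witness is [0], so only [normc w <= 1] is claimed. It makes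
    integrals and Fourier coefficients real and nonnegative. *)
Lemma phase_ex z : exists w, normc w <= 1 /\ w * z = ((normc z)%:C)%C.
Proof.
have [->|z0] := eqVneq z 0.
  by exists 0; rewrite normc0 mulr0 ler01.
have nz0 : normc z != 0 by apply: contra_neq z0 => /normc_eq0.
exists (((normc z)^-1)%:C%C * z^*%C); split.
  by rewrite normcM normc_real normc_conj ger0_norm ?invr_ge0 ?normc_ge0// mulVf.
rewrite -mulrA [_ * z]mulrC mulc_conj.
by rewrite -(rmorphM (real_complex R)) expr2 mulrA mulVf// mul1r.
Qed.

End ComplexNorm.

Lemma measurable_sqrt (R : realType) : measurable_fun setT (@Num.sqrt R).
Proof. by apply: continuous_measurable_fun; exact: sqrt_continuous. Qed.

Section ComplexIntegral.
Context d (T : measurableType d) (R : realType).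
Variable P : probability T R.
Implicit Types (u v : T -> R[i]) (f g : T -> R).

Definition rintegrable (f : T -> R) := P.-integrable setT (EFin \o f).

Definition cmeasurable u :=
  measurable_fun setT (fun x => Re (u x)) /\
  measurable_fun setT (fun x => Im (u x)).

Definition cintegrable u :=
  rintegrable (fun x => Re (u x)) /\ rintegrable (fun x => Im (u x)).

(** Convertible with a coordinate of [vintegral] over the whole space, so that Fourier coefficients
    and the difference of index 0 unfold to it. *)
Definition cint u : R[i] :=
  Complex (\int[P]_x Re (u x)) (\int[P]_x Im (u x)).

Lemma rintegrable_measurable f : rintegrable f -> measurable_fun setT f.
Proof. by move=> /(measurable_int P)/measurable_EFinP. Qed.

Lemma rintegrable_le f g : measurable_fun setT f -> rintegrable g ->
  (forall x, `|f x| <= g x) -> rintegrable f.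
Proof.
move=> mf ig fg; apply: (le_integrable measurableT _ _ ig).
  exact/measurable_EFinP.
move=> x _ /=; rewrite lee_fin; apply: le_trans (fg x) _; exact: ler_norm.
Qed.

Lemma rintegrable_cst (a : R) : rintegrable (fun=> a).
Proof.
by apply: finite_measure_integrable_cst.
Qed.

Lemma rintegrableD f g : rintegrable f -> rintegrable g ->
  rintegrable (fun x => f x + g x).
Proof. by move=> fi gi; have := integrableD measurableT fi gi. Qed.

Lemma rintegrableZ a f : rintegrable f -> rintegrable (fun x => a * f x).
Proof. by move=> fi; have := integrableZl measurableT a fi. Qed.

Lemma rintegrable_sum I (r : seq I) (p : pred I) (F : I -> T -> R) :
  (forall i, rintegrable (F i)) ->
  rintegrable (fun x => \sum_(i <- r | p i) F i x).
Proof.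
move=> Fi; have := @integrable_sum _ _ _ P setT measurableT I r p (fun i => EFin \o F i) (fun i _ => Fi i).
apply: eq_integrable => // x _; by rewrite /= sumEFin.
Qed.

Lemma Rint_sum I (r : seq I) (p : pred I) (F : I -> T -> R) :
  (forall i, rintegrable (F i)) ->
  \int[P]_x (\sum_(i <- r | p i) F i x) = \sum_(i <- r | p i) \int[P]_x F i x.
Proof.
move=> Fi; elim: r => [|i r IH].
  under eq_Rintegral do rewrite big_nil.
  by rewrite big_nil Rintegral_cst// mul0r.
rewrite big_cons; under eq_Rintegral do rewrite big_cons.
case: ifP => _ //; rewrite RintegralD// ?IH//; first exact: Fi.
exact: (rintegrable_sum r p Fi).
Qed.

Lemma cintegrable_cmeasurable u : cintegrable u -> cmeasurable u.
Proof. by move=> [a b]; split; apply: rintegrable_measurable. Qed.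

Lemma cmeasurable_cst (z : R[i]) : cmeasurable (fun=> z).
Proof. by split; exact: measurable_cst. Qed.

Lemma cmeasurableD u v : cmeasurable u -> cmeasurable v ->
  cmeasurable (fun x => u x + v x).
Proof.
move=> [a b] [c e]; split.
- by under eq_fun do rewrite ReD; exact: measurable_funD.
- by under eq_fun do rewrite ImD; exact: measurable_funD.
Qed.

Lemma cmeasurableM u v : cmeasurable u -> cmeasurable v ->
  cmeasurable (fun x => u x * v x).
Proof.
move=> [a b] [c e]; split.
- under eq_fun do rewrite ReM; apply: measurable_funB; exact: measurable_funM.
- under eq_fun do rewrite ImM; apply: measurable_funD; exact: measurable_funM.
Qed.

Lemma cmeasurable_conj u : cmeasurable u -> cmeasurable (fun x => (u x)^*%C).
Proof.
move=> [a b]; split; first by under eq_fun do rewrite Re_conj.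
by under eq_fun do rewrite Im_conj; exact: measurableT_comp.
Qed.

Lemma cmeasurable_real f : measurable_fun setT f ->
  cmeasurable (fun x => ((f x)%:C)%C).
Proof. by move=> mf; split => //=; exact: measurable_cst. Qed.

Lemma cmeasurable_sum I (r : seq I) (p : pred I) (F : I -> T -> R[i]) :
  (forall i, cmeasurable (F i)) ->
  cmeasurable (fun x => \sum_(i <- r | p i) F i x).
Proof.
move=> Fi; elim: r => [|i r IH].
  by under eq_fun do rewrite big_nil; exact: cmeasurable_cst.
under eq_fun do rewrite big_cons.
by case: (p i) => //; exact: cmeasurableD.
Qed.

Lemma measurable_sqr_normc u : cmeasurable u ->
  measurable_fun setT (fun x => normc (u x) ^+ 2).
Proof.
move=> [a b]; under eq_fun do rewrite sqr_normcE.
by apply: measurable_funD; exact: measurable_funX.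
Qed.

Lemma measurable_normc u : cmeasurable u ->
  measurable_fun setT (fun x => normc (u x)).
Proof.
move=> mu; rewrite (_ : (fun _ => _) = fun x => Num.sqrt (normc (u x) ^+ 2)).
  exact: measurableT_comp (@measurable_sqrt R) (measurable_sqr_normc mu).
by apply/funext => x; rewrite sqrtr_sqr ger0_norm// normc_ge0.
Qed.

Lemma cintegrable_le u g : cmeasurable u -> rintegrable g ->
  (forall x, normc (u x) <= g x) -> cintegrable u.
Proof.
move=> [mr mi] ig ug; split.
- apply: rintegrable_le ig _ => // x; apply: le_trans (normr_Re_le _) (ug x).
- apply: rintegrable_le ig _ => // x; apply: le_trans (normr_Im_le _) (ug x).
Qed.

Lemma cintegrable_norm u : cintegrable u -> rintegrable (fun x => normc (u x)).
Proof.
move=> iu; have [mr mi] := iu.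
apply: (rintegrable_le (g := fun x => `|Re (u x)| + `|Im (u x)|)).
- exact/measurable_normc/cintegrable_cmeasurable.
- by apply: rintegrableD; [have := integrable_norm mr|have := integrable_norm mi].
- by move=> x; rewrite ger0_norm ?normc_ge0// normc_le_ReIm.
Qed.

Lemma cintegrableMb u v (K : R) : cmeasurable u -> cintegrable v ->
  (forall x, normc (u x) <= K) -> cintegrable (fun x => u x * v x).
Proof.
move=> mu iv uK; apply: (@cintegrable_le _ (fun x => K * normc (v x))).
- exact: cmeasurableM mu (cintegrable_cmeasurable iv).
- exact/rintegrableZ/cintegrable_norm.
- by move=> x; rewrite normcM ler_wpM2r// normc_ge0.
Qed.

Lemma cintegrableD u v : cintegrable u -> cintegrable v ->
  cintegrable (fun x => u x + v x).
Proof.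
move=> [a b] [c e]; split.
- by under eq_fun do rewrite ReD; exact: rintegrableD.
- by under eq_fun do rewrite ImD; exact: rintegrableD.
Qed.

Lemma cintegrableZ z u : cintegrable u -> cintegrable (fun x => z * u x).
Proof.
move=> iu; exact: (@cintegrableMb (fun=> z) u (normc z)).
Qed.

Lemma cintegrable_sum I (r : seq I) (p : pred I) (F : I -> T -> R[i]) :
  (forall i, cintegrable (F i)) ->
  cintegrable (fun x => \sum_(i <- r | p i) F i x).
Proof.
move=> Fi; split.
- under eq_fun do rewrite Re_sum; apply: rintegrable_sum => i; by case: (Fi i).
- under eq_fun do rewrite Im_sum; apply: rintegrable_sum => i; by case: (Fi i).
Qed.

Lemma cintegrable_real f : rintegrable f ->
  cintegrable (fun x => ((f x)%:C)%C).
Proof. by move=> mf; split => //=; exact: rintegrable_cst. Qed.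

Lemma eq_cint u v : u =1 v -> cint u = cint v.
Proof. by move=> /funext ->. Qed.

Lemma cintD u v : cintegrable u -> cintegrable v ->
  cint (fun x => u x + v x) = cint u + cint v.
Proof.
move=> [a b] [c e]; apply: ReIm_eq; rewrite ?ReD ?ImD /=.
- by under eq_Rintegral do rewrite ReD; rewrite RintegralD.
- by under eq_Rintegral do rewrite ImD; rewrite RintegralD.
Qed.

Lemma cintZ z u : cintegrable u -> cint (fun x => z * u x) = z * cint u.
Proof.
move=> [a b]; apply: ReIm_eq; rewrite ?ReM ?ImM /=.
- under eq_Rintegral do rewrite ReM.
  by rewrite RintegralB ?RintegralZl//; exact: rintegrableZ.
- under eq_Rintegral do rewrite ImM.
  by rewrite RintegralD ?RintegralZl//; exact: rintegrableZ.
Qed.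

Lemma cint0 : cint (fun=> 0) = 0.
Proof. by rewrite /cint /= !Rintegral_cst//= !mul0r. Qed.

Lemma cint_sum I (r : seq I) (p : pred I) (F : I -> T -> R[i]) :
  (forall i, cintegrable (F i)) ->
  cint (fun x => \sum_(i <- r | p i) F i x) = \sum_(i <- r | p i) cint (F i).
Proof.
move=> Fi; apply: ReIm_eq; rewrite ?Re_sum ?Im_sum /=.
- under eq_Rintegral do rewrite Re_sum.
  by rewrite Rint_sum// => i; case: (Fi i).
- under eq_Rintegral do rewrite Im_sum.
  by rewrite Rint_sum// => i; case: (Fi i).
Qed.

(** After multiplication by a phase the integral equals its modulus, and the real part of the
    integrand is dominated pointwise. *)
Lemma normc_cint_le u : cintegrable u ->
  normc (cint u) <= \int[P]_x normc (u x).
Proof.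
move=> iu; have [w [w1 wE]] := phase_ex (cint u).
rewrite -[leLHS]Re_real -wE -cintZ//=.
have iwu := cintegrableZ w iu.
apply: le_Rintegral => //; [by case: iwu|exact: cintegrable_norm|].
move=> x _; apply: le_trans (Re_le_normc _) _.
by rewrite normcM ler_piMl// normc_ge0.
Qed.

Lemma cint_real f : cint (fun x => ((f x)%:C)%C) = ((\int[P]_x f x)%:C)%C.
Proof. by apply: ReIm_eq => //=; rewrite Rintegral_cst// mul0r. Qed.

(** An eigenfunction of a measure-preserving map with eigenvalue other than 1 has mean zero. All
    orthogonality of characters is drawn from this. *)
Lemma cint_shift0 u (phi : T -> T) (z : R[i]) : measurable_fun setT phi ->
  (forall A, measurable A -> P (phi @^-1` A) = P A) ->
  cintegrable u -> (forall x, u (phi x) = z * u x) -> z != 1 -> cint u = 0.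
Proof.
move=> mphi pphi iu uphi z1.
have E : cint u = z * cint u.
  rewrite -cintZ//; rewrite -(eq_cint uphi); have [ir ii] := iu.
  by apply: ReIm_eq; rewrite /= /Rintegral;
    [rewrite (mpres_integral mphi pphi ir)|rewrite (mpres_integral mphi pphi ii)].
apply/eqP; have /eqP : (1 - z) * cint u = 0.
  by rewrite mulrBl mul1r -E subrr.
by rewrite mulf_eq0 subr_eq0 eq_sym (negbTE z1).
Qed.

End ComplexIntegral.

(** * Conditional expectations by integration of the remaining coordinates *)

Section AlmostEverywhere.
Context d (T : measurableType d) (R : realType).
Variable P : probability T R.

Lemma ae_eq_Rintegral (f g : T -> R) :
  measurable_fun setT f -> measurable_fun setT g ->
  {ae P, forall x, f x = g x} -> \int[P]_x f x = \int[P]_x g x.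
Proof.
move=> mf mg fg; congr fine; apply: ae_eq_integral => //.
- exact/measurable_EFinP.
- exact/measurable_EFinP.
- by apply: filterS fg => x -> _.
Qed.

Lemma ae_eq_cint (u v : T -> R[i]) : cmeasurable u -> cmeasurable v ->
  {ae P, forall x, u x = v x} -> cint P u = cint P v.
Proof.
move=> [ur ui] [vr vi] uv; apply: ReIm_eq => /=; apply: ae_eq_Rintegral => //.
- by apply: filterS uv => x ->.
- by apply: filterS uv => x ->.
Qed.

End AlmostEverywhere.

Lemma cint_cst d (T : measurableType d) (R : realType) (P : probability T R)
  (z : R[i]) : cint P (fun=> z) = z.
Proof.
have Rcst (a : R) : \int[P]_x a = a.
  by rewrite Rintegral_cst// [X in fine X](@probability_setT _ _ _ P)/= mulr1.
by apply: ReIm_eq => /=; exact: Rcst.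
Qed.

Section CondExp.
Variables (R : realType) (G : topologicalZmodType).
Local Notation XX := (power_space G).
Variables (mu : probability (borel G) R) (P : probability XX R).
Hypothesis PP : is_power_measure mu P.
Variable k : nat.
Implicit Types (f : XX -> R) (u v w : XX -> R[i]).

Let spl (z : XX * XX) : XX := splice k z.1 z.2.

Let spl_int f : rintegrable P f ->
  (P \x P)%E.-integrable setT (EFin \o f \o spl).
Proof.
exact: (mpres_integrable (@measurable_splice G k) (splice_mpres PP k)).
Qed.

(** The extended inner integral, finite for almost every [x]; where it is infinite, [Rintegral]
    returns [0] instead. *)
Let F f (x : XX) : \bar R := (\int[P]_y (f (spl (x, y)))%:E)%E.

Let F_ae f : rintegrable P f -> {ae P, forall x, F f x \is a fin_num}.
Proof.
move=> fi; have := integrable_fubini_F (spl_int fi) => /integrable_ae.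
move=> /(_ measurableT); by apply: filterS => x /(_ I).
Qed.

Let slice_ae_real f : rintegrable P f ->
  {ae P, forall x, rintegrable P (fun y => f (splice k x y))}.
Proof. by move=> fi; exact: (ae_integrable1 (spl_int fi)). Qed.

Let E_measurable f : rintegrable P f ->
  measurable_fun setT (fun x => \int[P]_y f (splice k x y)).
Proof.
move=> fi; have mF := measurable_fubini_F (spl_int fi).
exact: (measurableT_comp (fine_measurable measurableT) mF).
Qed.

Let E_integrable f : rintegrable P f ->
  rintegrable P (fun x => \int[P]_y f (splice k x y)).
Proof.
move=> fi; apply: (le_integrable measurableT _ _ (integrable_fubini_F (spl_int fi))).
  by apply/measurable_EFinP; exact: E_measurable.
move=> x _ /=; rewrite /Rintegral /fubini_F/=.
by case: (X in fine X) => [r| |] //=; rewrite ?normr0 ?leey ?lexx.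
Qed.

Let E_integral f : rintegrable P f ->
  \int[P]_x (\int[P]_y f (splice k x y)) = \int[P]_x f x.
Proof.
move=> fi; rewrite /Rintegral; congr fine.
transitivity (\int[P]_x F f x)%E.
  apply: ae_eq_integral => //.
  - by apply/measurable_EFinP; exact: E_measurable.
  - exact: measurable_fubini_F (spl_int fi).
  - by apply: filterS (F_ae fi) => x xfin _; rewrite fineK.
rewrite (mpres_integral (@measurable_splice G k) (splice_mpres PP k) fi).
exact: (integral12_prod_meas1 (spl_int fi)).
Qed.

(* A version of [E(u | F_k)]: integrate out all the coordinates from [k] on. *)
Definition cexp u (x : XX) : R[i] := cint P (fun y => u (splice k x y)).

Lemma cexp_trunc u x : cexp u (trunc k x) = cexp u x.
Proof. by apply: eq_cint => y; rewrite splice_trunc. Qed.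

Lemma slice_ae u : cintegrable P u ->
  {ae P, forall x, cintegrable P (fun y => u (splice k x y))}.
Proof.
move=> [ur ui]; apply: filterS2 (slice_ae_real ur) (slice_ae_real ui).
by move=> x.
Qed.

Lemma cexp_cintegrable u : cintegrable P u -> cintegrable P (cexp u).
Proof. by move=> [ur ui]; split; [exact: (E_integrable ur)|exact: (E_integrable ui)]. Qed.

Lemma cint_cexp u : cintegrable P u -> cint P (cexp u) = cint P u.
Proof. by move=> [ur ui]; apply: ReIm_eq; [exact: (E_integral ur)|exact: (E_integral ui)]. Qed.

(** [w] is constant along the slice over [x], hence leaves the inner integral; this requires an
    integrable slice, which almost every [x] has. *)
Lemma cint_cexpM u w (K : R) : cintegrable P u -> cmeasurable w ->
  (forall x, normc (w x) <= K) -> (forall x, w (trunc k x) = w x) ->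
  cint P (fun x => w x * cexp u x) = cint P (fun x => w x * u x).
Proof.
move=> ui wm wK wt.
have wui : cintegrable P (fun x => w x * u x).
  exact: cintegrableMb wm ui wK.
rewrite -[RHS]cint_cexp//; apply: ae_eq_cint.
- by apply: cmeasurableM => //; apply: cintegrable_cmeasurable; exact: cexp_cintegrable.
- by apply: cintegrable_cmeasurable; exact: cexp_cintegrable.
- apply: filterS (slice_ae ui) => x uix; rewrite /cexp -cintZ//.
  apply: eq_cint => y; congr (_ * _).
  by rewrite -[LHS]wt -[RHS]wt trunc_splice.
Qed.

(** The set where [g < f] belongs to F_k, so [f - g] has integral zero over it although it is
    positive there. Exchanging [f] and [g] then gives equality. *)
Let rcondexp_unique (f g : XX -> R) : rintegrable P f -> rintegrable P g ->
  (forall x, f (trunc k x) = f x) -> (forall x, g (trunc k x) = g x) ->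
  (forall A, filtration k A -> \int[P]_(x in A) f x = \int[P]_(x in A) g x) ->
  {ae P, forall x, f x <= g x}.
Proof.
move=> fi gi ft gt fg.
pose A := [set x | g x < f x].
have mf := rintegrable_measurable fi; have mg := rintegrable_measurable gi.
have mA : measurable A.
  have := measurable_fun_ltr mg mf measurableT (Y := [set true]) I.
  by rewrite setTI.
have FA : filtration k A.
  by apply/filtrationP; split=> //; apply/seteqP; split=> x; rewrite /A/preimage/= ft gt.
have E : (\int[P]_(x in A) `|(f x - g x)%:E|)%E = 0.
  have fAi : P.-integrable A (EFin \o f) by exact: integrableS fi.
  have gAi : P.-integrable A (EFin \o g) by exact: integrableS gi.
  under eq_integral.
    move=> x; rewrite inE => Ax; rewrite gee0_abs ?lee_fin ?subr_ge0 ?(ltW Ax)//.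
    over.
  have := fg _ FA => /eqP; rewrite -subr_eq0 -RintegralB// => /eqP fg0.
  have fgi : P.-integrable A (EFin \o (fun x => f x - g x)).
    by have := integrableB mA fAi gAi.
  rewrite -[LHS]fineK; last exact: integrable_fin_num fgi.
  by move: fg0; rewrite /Rintegral => ->.
have mfg : measurable_fun A (fun x => (f x - g x)%:E).
  by apply/measurable_EFinP; apply: measurable_funS measurableT _ _ => //; exact: measurable_funB.
have /(ae_eq_integral_abs P mA mfg) := E.
apply: filterS => x h; rewrite leNgt; apply/negP => Ax.
by have /= [/eqP] := h Ax; rewrite subr_eq0 => /eqP fgx; move: Ax; rewrite fgx ltxx.
Qed.

Lemma condexp_unique u v : cintegrable P u -> cintegrable P v ->
  (forall x, u (trunc k x) = u x) -> (forall x, v (trunc k x) = v x) ->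
  (forall A, filtration k A ->
     \int[P]_(x in A) Re (u x) = \int[P]_(x in A) Re (v x) /\
     \int[P]_(x in A) Im (u x) = \int[P]_(x in A) Im (v x)) ->
  {ae P, forall x, u x = v x}.
Proof.
move=> [ur ui] [vr vi] ut vt uv.
have r1 := rcondexp_unique ur vr (fun x => congr1 _ (ut x)) (fun x => congr1 _ (vt x))
  (fun A FA => (uv A FA).1).
have r2 := rcondexp_unique vr ur (fun x => congr1 _ (vt x)) (fun x => congr1 _ (ut x))
  (fun A FA => esym (uv A FA).1).
have i1 := rcondexp_unique ui vi (fun x => congr1 _ (ut x)) (fun x => congr1 _ (vt x))
  (fun A FA => (uv A FA).2).
have i2 := rcondexp_unique vi ui (fun x => congr1 _ (vt x)) (fun x => congr1 _ (ut x))
  (fun A FA => esym (uv A FA).2).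
have r : {ae P, forall x, Re (u x) = Re (v x)}.
  by apply: filterS2 r1 r2 => x a b; apply/le_anti; rewrite a b.
have i : {ae P, forall x, Im (u x) = Im (v x)}.
  by apply: filterS2 i1 i2 => x a b; apply/le_anti; rewrite a b.
by apply: filterS2 r i => x; exact: ReIm_eq.
Qed.

End CondExp.

(** * Sums over sets, and [ℓ^2(S)]-valued functions *)

Section EsumSeq.
Context (R : realType) (T : choiceType).
Implicit Types (A : set T) (a : T -> \bar R) (J : seq T).
Local Open Scope ereal_scope.

Lemma le_sum_esum A a J : uniq J -> (forall x, x \in J -> A x) ->
  \sum_(x <- J) a x <= \esum_(x in A) a x.
Proof.
move=> uJ JA; apply: esum_ge; exists [set` J].
  by split; [exact: finite_seq|move=> x /=; exact: JA].
by rewrite fsbig_seq.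
Qed.

Lemma esum_le A a (K : \bar R) :
  (forall J, uniq J -> (forall x, x \in J -> A x) -> \sum_(x <- J) a x <= K) ->
  \esum_(x in A) a x <= K.
Proof.
move=> h; apply: ge_ereal_sup => _ [X [finX XA] <-].
rewrite fsbig_finite//; apply: h; first exact: fset_uniq.
by move=> x; rewrite in_fset_set// inE; exact: XA.
Qed.

(** Finite subsums over [X n] come within [1/(n+1)] of the total, so a point in no [X n] has a term
    at most every [1/(n+1)]. Countable supports let limits of sequences be used although [S] is
    arbitrary. *)
Lemma esum_countable_support a : (forall x, 0 <= a x) ->
  \esum_(x in [set: T]) a x < +oo -> countable [set x | a x != 0].
Proof.
move=> a0 foo; set t := \esum_(x in setT) a x in foo.
have tfin : t \is a fin_num by rewrite ge0_fin_numE// esum_ge0.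
have /choice[X XP] : forall n : nat, exists X : set T, finite_set X /\
    t - n.+1%:R^-1%:E < \sum_(x \in X) a x.
  move=> n; have n0 : (0 < n.+1%:R^-1 :> R)%R by rewrite invr_gt0.
  have [_ [Y [finY _] <-] h] := ub_ereal_sup_adherent n0 tfin.
  by exists Y.
apply: (@sub_countable _ _ _ (\bigcup_n X n)); last first.
  by apply: bigcup_countable => // n _; apply: finite_set_countable; have [] := XP n.
apply: subset_card_le => x /= ax0; apply: contrapT => nx.
have axn n : a x <= n.+1%:R^-1%:E.
  have [finX tX] := XP n.
  have le_t : a x + \sum_(y \in X n) a y <= t.
    have -> : a x + \sum_(y \in X n) a y = \sum_(y <- x :: fset_set (X n)) a y.
      by rewrite big_cons fsbig_finite.
    apply: le_sum_esum => //=; rewrite fset_uniq andbT in_fset_set// notin_setE => Xx; apply: nx; exists n => //.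
  have sfin : \sum_(y \in X n) a y \is a fin_num.
    rewrite ge0_fin_numE ?fsume_ge0//; apply: le_lt_trans foo.
    by apply: le_trans le_t; rewrite leeDr.
  rewrite -(leeD2rE _ _ sfin); apply: le_trans le_t _.
  by rewrite addeC -leeBlDr// ltW.
have : a x <= 0.
  apply/lee_addgt0Pr => e e0; rewrite add0e.
  have [n ne] := ltr_add_invr e0.
  by apply: le_trans (axn n) _; rewrite lee_fin ltW// -[X in (X < _)%R]add0r.
by move=> ale0; move/eqP: ax0; apply; apply/le_anti; rewrite ale0 a0.
Qed.

End EsumSeq.

Section Exhaustion.
Variable S : choiceType.

(** [J n] lists the elements of rank below [n] in an enumeration. The bound on its length makes the
    square sum of the rounding errors over [J n] tend to zero in [sm_intro]. *)
Lemma countable_exhaustion (N : set S) : countable N ->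
  exists J : nat -> seq S, [/\ forall n, uniq (J n), forall n, (size (J n) <= n)%N,
    forall m n s, (m <= n)%N -> s \in J m -> s \in J n
    & forall s, N s <-> exists n, s \in J n].
Proof.
move=> /countable_injP[r rinj].
have /choice[J JP] : forall n, exists J : seq S, [/\ uniq J, (size J <= n)%N &
    forall s, s \in J <-> N s /\ (r s < n)%N].
  elim=> [|n [J [uJ sJ JE]]].
    by exists [::]; split=> // s; split=> // -[].
  have [[s [Ns rs]]|no] := pselect (exists s, N s /\ r s = n).
    exists (s :: J); split=> /=.
    - rewrite uJ andbT; apply/negP => /JE[_]; by rewrite rs ltnn.
    - by [].
    - move=> t; rewrite inE; split.
        by move=> /orP[/eqP ->|/JE[Nt /ltnW]//]; rewrite rs ltnSn.
      move=> [Nt]; rewrite ltnS leq_eqVlt => /orP[/eqP rt|rt].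
        by rewrite (rinj t s) ?inE ?eqxx// rt rs.
      by apply/orP; right; apply/JE.
  exists J; split=> //; first exact: leq_trans sJ _.
  move=> t; split; first by move=> /JE[Nt /ltnW].
  move=> [Nt]; rewrite ltnS leq_eqVlt => /orP[/eqP rt|rt]; last by apply/JE.
  by exfalso; apply: no; exists t.
exists J; split.
- by move=> n; have [] := JP n.
- by move=> n; have [] := JP n.
- move=> m n s mn; have [_ _ Jm] := JP m; have [_ _ Jn] := JP n.
  by move=> /Jm[Ns rs]; apply/Jn; split=> //; exact: leq_trans rs mn.
- move=> s; split=> [Ns|[n]]; last by have [_ _ Jn] := JP n; move=> /Jn[].
  by exists (r s).+1; have [_ _ Jn] := JP (r s).+1; apply/Jn.
Qed.

Lemma esum_exhaustion_cvg (R : realType) (N : set S) (J : nat -> seq S) (a : S -> \bar R) :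
  (forall n, uniq (J n)) ->
  (forall m n s, (m <= n)%N -> s \in J m -> s \in J n) ->
  (forall s, N s <-> exists n, s \in J n) ->
  (forall s, (0 <= a s)%E) -> (forall s, ~ N s -> a s = 0%E) ->
  (fun n => \sum_(s <- J n) a s)%E @ \oo --> (\esum_(s in [set: S]) a s)%E.
Proof.
move=> uJ Jmon JN a0 aN.
have subsum (J1 J2 : seq S) : uniq J1 -> uniq J2 -> {subset J1 <= J2} ->
    (\sum_(s <- J1) a s <= \sum_(s <- J2) a s)%E.
  move=> u1 u2 sub.
  have J12 : perm_eq J1 [seq s <- J2 | s \in J1].
    apply: uniq_perm => //; first exact: filter_uniq.
    by move=> s; rewrite mem_filter; case: (boolP (s \in J1)) => //= /sub ->.
  rewrite (perm_big _ J12)/= big_filter big_mkcond/=; apply: lee_sum => s _; by case: ifP.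
have -> : (\esum_(s in [set: S]) a s)%E =
    ereal_sup (range (fun n => \sum_(s <- J n) a s)%E).
  apply/le_anti/andP; split; last first.
    by apply: ge_ereal_sup => _ [n _ <-]; exact: le_sum_esum.
  apply: esum_le => K uK _.
  have [n Kn] : exists n, forall s, s \in K -> N s -> s \in J n.
    elim: K {uK} => [|s K [n Kn]]; first by exists 0.
    have [Ns|nNs] := pselect (N s); last first.
      by exists n => t; rewrite inE => /orP[/eqP ->//|/Kn].
    have [m sm] := (JN s).1 Ns; exists (maxn m n) => t.
    rewrite inE => /orP[/eqP -> _|tK Nt].
      exact: Jmon (leq_maxl m n) sm.
    exact: Jmon (leq_maxr m n) (Kn t tK Nt).
  apply: (@le_trans _ _ (\sum_(s <- J n) a s)%E); last first.
    by apply: ereal_sup_ubound; exists n.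
  rewrite (bigID (fun s => s \in J n))/= [X in (_ + X)%E]big1_seq ?adde0.
    rewrite -big_filter; apply: subsum => //; first exact: filter_uniq.
    by move=> s; rewrite mem_filter => /andP[].
  move=> s /andP[sJ sK]; apply: aN => Ns; by rewrite Kn in sJ.
apply: ereal_nondecreasing_cvgn => m n mn; apply: subsum => // s.
exact: Jmon.
Qed.

End Exhaustion.

Section L2Norm.
Variables (R : realType) (S : choiceType).
Implicit Types (v w : S -> R[i]) (J : seq S).

Lemma l2norm_ge0 v : (0 <= l2norm v)%E. Proof. exact: sqrte_ge0. Qed.

Lemma l2norm_sqr v :
  (l2norm v ^+ 2 = \esum_(s in [set: S]) (normc (v s) ^+ 2)%:E)%E.
Proof. by rewrite sqr_sqrte// esum_ge0// => s _; rewrite lee_fin sqr_ge0. Qed.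

Lemma sum_le_l2norm v J : uniq J ->
  ((\sum_(s <- J) normc (v s) ^+ 2)%:E <= l2norm v ^+ 2)%E.
Proof. by move=> uJ; rewrite l2norm_sqr -sumEFin; exact: le_sum_esum. Qed.

Lemma normc_le_l2norm v s : ((normc (v s))%:E <= l2norm v)%E.
Proof.
have := @sum_le_l2norm v [:: s] erefl; rewrite big_seq1.
have := l2norm_ge0 v; case: (l2norm v) => [r| |]//; rewrite ?leey//.
rewrite lee_fin => r0; rewrite -EFin_expe !lee_fin => h.
by rewrite -ler_sqr ?nnegrE ?normc_ge0.
Qed.

Lemma l2norm_le v (K : R) : 0 <= K ->
  (forall J, uniq J -> \sum_(s <- J) normc (v s) ^+ 2 <= K ^+ 2) ->
  (l2norm v <= K%:E)%E.
Proof.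
move=> K0 h; have -> : K%:E = sqrte (K ^+ 2)%:E.
  by rewrite /= sqrtr_sqr ger0_norm.
rewrite lee_sqrt ?lee_fin ?sqr_ge0//.
by apply: esum_le => J uJ _; rewrite sumEFin lee_fin; exact: h.
Qed.

Lemma l2norm_fin v J : uniq J -> (forall s, s \notin J -> v s = 0) ->
  l2norm v = (Num.sqrt (\sum_(s <- J) normc (v s) ^+ 2))%:E.
Proof.
move=> uJ vJ; rewrite /l2norm.
rewrite (_ : (\esum_(s in setT) _)%E = (\sum_(s <- J) normc (v s) ^+ 2)%:E)//.
apply/le_anti/andP; split; last by rewrite -sumEFin; exact: le_sum_esum.
apply: esum_le => K uK _; rewrite sumEFin lee_fin.
rewrite (bigID (fun s => s \in J))/= [X in _ + X]big1 ?addr0; last first.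
  by move=> s sJ; rewrite vJ// normc0 expr0n.
have KJ : perm_eq [seq s <- K | s \in J] [seq s <- J | s \in K].
  apply: uniq_perm; rewrite ?filter_uniq// => s.
  by rewrite !mem_filter andbC.
rewrite -big_filter (perm_big _ KJ)/= big_filter big_mkcond/=.
by apply: ler_sum => s _; case: ifP => // _; rewrite sqr_ge0.
Qed.

Lemma ell2_fin v J : uniq J -> (forall s, s \notin J -> v s = 0) -> ell2 v.
Proof. by move=> uJ vJ; rewrite /ell2/= (l2norm_fin uJ vJ) ltry. Qed.

Lemma ell2_esum v : ell2 v ->
  (\esum_(s in [set: S]) (normc (v s) ^+ 2)%:E < +oo)%E.
Proof.
rewrite /ell2/= -l2norm_sqr; have := l2norm_ge0 v.
by case: (l2norm v) => [r| |]// _ _; rewrite -EFin_expe ltry.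
Qed.

Lemma ell2_countable v : ell2 v -> countable [set s | v s != 0].
Proof.
move=> /ell2_esum foo.
have := esum_countable_support _ foo.
move=> /(_ (fun s => _)) h; apply: sub_countable (h _); last first.
  by move=> s; rewrite lee_fin sqr_ge0.
apply: subset_card_le => s /=; apply: contra_neq => -[] /eqP.
by rewrite sqrf_eq0 => /eqP /normc_eq0.
Qed.

End L2Norm.

(** * Approximation of complex functions by finitely valued ones *)

Section Simple.
Context d (T : measurableType d).

(** For any target type, so that rounded scalars and the vectors built from them are handled
    alike. *)
Definition fsimple (V : Type) (h : T -> V) :=
  finite_set (range h) /\ forall v, measurable (h @^-1` [set v]).

Lemma fsimple_cst (V : Type) (v : V) : fsimple (fun=> v).
Proof.
split; first by apply: (sub_finite_set _ (finite_set1 v)) => _ [x _ <-].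
move=> w; have [->|vw] := pselect (v = w).
  by rewrite (_ : _ @^-1` _ = setT)//; apply/seteqP; split.
by rewrite (_ : _ @^-1` _ = set0)//; apply/seteqP; split.
Qed.

Lemma fsimple_op (V1 V2 V : Type) (op : V1 -> V2 -> V) h1 h2 :
  fsimple h1 -> fsimple h2 -> fsimple (fun x => op (h1 x) (h2 x)).
Proof.
move=> [f1 m1] [f2 m2]; split.
  apply: (sub_finite_set _ (finite_image2 op f1 f2)).
  by move=> _ [x _ <-]; exists (h1 x); [by exists x|exists (h2 x) => //; exists x].
move=> v.
rewrite (_ : _ @^-1` _ = \bigcup_(p in (range h1 `*` range h2) `&` [set p | op p.1 p.2 = v])
  (h1 @^-1` [set p.1] `&` h2 @^-1` [set p.2])).
  apply: fin_bigcup_measurable.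
    by apply: (sub_finite_set (B := range h1 `*` range h2)); [exact: subIsetl|exact: finite_setX].
  by move=> p _; exact: measurableI.
apply/seteqP; split => [x /= <-|x [p [_ <-]] [/= -> ->]//].
exists (h1 x, h2 x) => //; split => //; split; by exists x.
Qed.

Lemma fsimple_comp (V W : Type) (op : V -> W) h :
  fsimple h -> fsimple (fun x => op (h x)).
Proof. by move=> fh; exact: (fsimple_op (fun v _ => op v) fh fh). Qed.

Lemma fsimple_measurable (R : realType) (V : Type) (h : T -> V) (op : V -> R) :
  fsimple h -> measurable_fun setT (fun x => op (h x)).
Proof.
move=> [fh mh] _ Y mY; rewrite setTI.
rewrite (_ : _ @^-1` _ = \bigcup_(v in range h `&` [set v | Y (op v)]) (h @^-1` [set v])).
  apply: fin_bigcup_measurable; last by move=> v _.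
  exact: (sub_finite_set (B := range h)).
by apply/seteqP; split => [x /= Yx|x [v [_ Yv] /= -> //]]; exists (h x).
Qed.

Variable R : realType.

(** Rounds [a] down to a multiple of [del], clamped between [0] and [M * del]. As a sum of threshold
    functions it is finitely valued by induction on [M]. *)
Let stepf (del : R) M (a : R) : R :=
  \sum_(i < M) (if i.+1%:R * del <= a then del else 0).

Let stepf_prop (del : R) M (a : R) : 0 < del ->
  [/\ a < 0 -> stepf del M a = 0,
      0 <= a -> stepf del M a <= a,
      0 <= a -> a <= M%:R * del -> a <= stepf del M a + del
    & M%:R * del <= a -> stepf del M a = M%:R * del].
Proof.
move=> del0; rewrite /stepf; split.
- move=> a0; rewrite big1// => i _; case: (leP (i.+1%:R * del) a) => // h.
  by have := lt_le_trans a0 (mulr_ge0 (ler0n _ i.+1) (ltW del0)); rewrite ltNge h.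
- move=> a0; elim: M => [|M IH]; first by rewrite big_ord0.
  rewrite big_ord_recr/=; case: (leP (M.+1%:R * del) a) => h; last by rewrite addr0.
  apply: le_trans h; rewrite -natr1 mulrDl mul1r lerD2r.
  apply: (@le_trans _ _ (\sum_(i < M) del)).
    by apply: ler_sum => i _; case: ifP => // _; exact: ltW.
  by rewrite sumr_const card_ord mulr_natl.
- move=> a0; elim: M => [|M IH].
    by rewrite big_ord0 add0r mul0r => /le_trans; apply; exact: ltW.
  rewrite big_ord_recr/= => aM; case: (leP (M.+1%:R * del) a) => h.
    have E : forall N, N%:R * del <= a ->
        \sum_(i < N) (if i.+1%:R * del <= a then del else 0) = N%:R * del.
      move=> N hN; under eq_bigr.
        move=> i _; rewrite (_ : _ <= a); first over.
        by apply: le_trans hN; rewrite ler_pM2r// ler_nat.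
      by rewrite sumr_const card_ord mulr_natl.
    rewrite E; last by apply: le_trans h; rewrite ler_pM2r// ler_nat.
    by apply: le_trans aM _; rewrite -natr1 mulrDl mul1r lerDl ltW.
  rewrite addr0; have [aM'|aM'] := leP a (M%:R * del); first exact: IH.
  have E : \sum_(i < M) (if i.+1%:R * del <= a then del else 0) = M%:R * del.
    under eq_bigr.
      move=> i _; rewrite (_ : _ <= a); first over.
      by apply: le_trans (ltW aM'); rewrite ler_pM2r// ler_nat.
    by rewrite sumr_const card_ord mulr_natl.
  by rewrite E; apply: le_trans aM _; rewrite -natr1 mulrDl mul1r.
- move=> hN; under eq_bigr.
    move=> i _; rewrite (_ : _ <= a); first over.
    by apply: le_trans hN; rewrite ler_pM2r// ler_nat.
  by rewrite sumr_const card_ord mulr_natl.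
Qed.

(** [n * n.+1] steps of length [1/(n+1)] reach up to [n]; the second term treats negative
    arguments. *)
Let quant n (a : R) : R := stepf n.+1%:R^-1 (n * n.+1) a - stepf n.+1%:R^-1 (n * n.+1) (- a).

Let quant_err n (a : R) : `|a| <= n%:R -> `|a - quant n a| <= n.+1%:R^-1.
Proof.
move=> an; have d0 : 0 < n.+1%:R^-1 :> R by rewrite invr_gt0.
have Md : (n * n.+1)%:R * n.+1%:R^-1 = n%:R :> R by rewrite natrM mulfK// pnatr_eq0.
have [p1 p2 p3 _] := stepf_prop (n * n.+1) a d0.
have [q1 q2 q3 _] := stepf_prop (n * n.+1) (- a) d0.
rewrite Md in p3 q3; rewrite /quant ler_norml.
move: p1 p2 p3 q1 q2 q3; set s1 := stepf _ _ a; set s2 := stepf _ _ (- a).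
move: d0; move: (_^-1) => e d0; move: s1 s2 => s1 s2 p1 p2 p3 q1 q2 q3.
have [a0|a0|a0] := ltgtP a 0.
- rewrite p1//; have na0 : 0 <= - a by rewrite oppr_ge0 ltW.
  have := q2 na0; have := q3 na0; rewrite ltr0_norm// in an => /(_ an) *; apply/andP; split; lra.
- rewrite q1 ?oppr_lt0//; have := p2 (ltW a0); have := p3 (ltW a0).
  rewrite gtr0_norm// in an => /(_ an) *; apply/andP; split; lra.
- rewrite a0 oppr0 in p2 p3 q2 q3 *.
  have := p2 (lexx _); have := q2 (lexx _).
  have := p3 (lexx _) (ler0n _ _); have := q3 (lexx _) (ler0n _ _).
  by move=> *; apply/andP; split; lra.
Qed.

Let quant_fsimple n (u : T -> R) : measurable_fun setT u -> fsimple (fun x => quant n (u x)).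
Proof.
move=> mu; rewrite /quant.
suff H (del : R) M (w : T -> R) : measurable_fun setT w -> fsimple (fun x => stepf del M (w x)).
  by apply: (fsimple_op (fun a b => a - b)); apply: H => //; exact: measurableT_comp.
move=> mw; rewrite /stepf; elim: M => [|M IH].
  by under eq_fun do rewrite big_ord0; exact: fsimple_cst.
under eq_fun do rewrite big_ord_recr/=.
apply: (fsimple_op (fun a b => a + b)) => //.
apply: (fsimple_comp (fun b : bool => if b then del else 0)); split.
  exact: finite_finset.
move=> b; have := measurable_fun_ler (measurable_cst (M.+1%:R * del)) mw.
by move=> /(_ measurableT [set b] I); rewrite setTI.
Qed.

Let cquant n (z : R[i]) : R[i] := Complex (quant n (Re z)) (quant n (Im z)).

Let cquant_err n (z : R[i]) : normc z <= n%:R -> normc (z - cquant n z) <= 2 / n.+1%:R.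
Proof.
move=> zn; apply: le_trans (normc_le_ReIm _) _.
have -> : 2 / n.+1%:R = n.+1%:R^-1 + n.+1%:R^-1 :> R by rewrite mulrDl mul1r.
have -> : Re (z - cquant n z) = Re z - quant n (Re z) by case: (z).
have -> : Im (z - cquant n z) = Im z - quant n (Im z) by case: (z).
apply: lerD; apply: quant_err; apply: le_trans zn.
- exact: normr_Re_le.
- exact: normr_Im_le.
Qed.

Let cquant_fsimple n (u : T -> R[i]) : cmeasurable u -> fsimple (fun x => cquant n (u x)).
Proof.
move=> [mr mi]; exact: (fsimple_op (fun a b => Complex a b) (quant_fsimple n mr)
  (quant_fsimple n mi)).
Qed.

(** The quantizer [q n] does not depend on [u]: in [sm_intro] the same one rounds all coordinates.
    Real and imaginary part contribute one mesh each to the error. *)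
Lemma complex_simple_approx : exists q : nat -> R[i] -> R[i],
  (forall n z, normc z <= n%:R -> normc (z - q n z) <= 2 / n.+1%:R) /\
  (forall n u, cmeasurable u -> fsimple (fun x => q n (u x))).
Proof. by exists cquant. Qed.

End Simple.

(** * Strong measurability in terms of coordinates *)

Section StrongMeasurability.
Context d (T : measurableType d) (R : realType) (S : choiceType).
Implicit Types (f : T -> S -> R[i]).

Lemma l2norm_cvg0_coord (u : nat -> S -> R[i]) (s : S) :
  (fun n => l2norm (u n)) @ \oo --> (0 : \bar R) ->
  (fun n => normc (u n s)) @ \oo --> (0 : R).
Proof.
move=> /fine_cvgP[ufin u0]; apply: squeeze_cvgr (cvg_cst 0) u0.
near=> n; rewrite normc_ge0/= -lee_fin fineK ?normc_le_l2norm//.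
by near: n.
Unshelve. all: by end_near. Qed.

Lemma sm_coord f (s : S) : strongly_measurable measurable f ->
  cmeasurable (fun x => f x s).
Proof.
move=> [_ [h hs hf]].
have hcvg x : (fun n => normc (f x s - h n x s)) @ \oo --> (0 : R).
  exact: (l2norm_cvg0_coord (u := fun n => f x - h n x) s (hf x)).
have fh n : fsimple (h n) by have [_ a b] := hs n; split.
split.
- apply: (measurable_fun_cvg (h := fun n x => Re (h n x s))).
    by move=> n; exact: (fsimple_measurable (fun v => Re (v s)) (fh n)).
  move=> x _; apply/cvgrPdist_lt => e e0.
  have := hcvg x => /cvgr0_norm_lt/(_ _ e0); apply: filterS => n.
  rewrite ger0_norm ?normc_ge0//; apply: le_lt_trans.
  by rewrite (_ : _ - _ = Re (f x s - h n x s)) ?normr_Re_le// ReD; case: (h n x s).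
- apply: (measurable_fun_cvg (h := fun n x => Im (h n x s))).
    by move=> n; exact: (fsimple_measurable (fun v => Im (v s)) (fh n)).
  move=> x _; apply/cvgrPdist_lt => e e0.
  have := hcvg x => /cvgr0_norm_lt/(_ _ e0); apply: filterS => n.
  rewrite ger0_norm ?normc_ge0//; apply: le_lt_trans.
  by rewrite (_ : _ - _ = Im (f x s - h n x s)) ?normr_Im_le// ImD; case: (h n x s).
Qed.

(** Each approximant takes finitely many values, each of countable support; the union of these
    supports over all approximants carries the limit. *)
Lemma sm_support f (F : set (set T)) : strongly_measurable F f ->
  exists2 N : set S, countable N & forall x s, ~ N s -> f x s = 0.
Proof.
move=> [_ [h hs hf]].
exists (\bigcup_n \bigcup_(v in range (h n)) [set s | v s != 0]).
  apply: bigcup_countable => // n _; have [he hfin _] := hs n.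
  apply: bigcup_countable; first exact: finite_set_countable.
  by move=> _ [x _ <-]; exact: ell2_countable.
move=> x s nN; apply: normc_eq0.
have hn n : h n x s = 0.
  apply: contrapT => /eqP hnx; apply: nN; exists n => //; exists (h n x) => //.
have := l2norm_cvg0_coord (u := fun n => f x - h n x) s (hf x).
under eq_fun do rewrite /= -[(f x - h _ x) s]/(f x s - h _ x s) hn subr0.
by move=> /(cvg_unique (@Rhausdorff R) (cvg_cst _)).
Qed.

Lemma measurable_l2norm f (N : set S) : countable N ->
  (forall x s, ~ N s -> f x s = 0) -> (forall s, cmeasurable (fun x => f x s)) ->
  (forall x, ell2 (f x)) ->
  measurable_fun setT (fun x => l2norm (f x)).
Proof.
move=> cN fN fm fl2; have [J [uJ sJ Jmon JN]] := countable_exhaustion cN.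
have mE : measurable_fun setT (fun x => \esum_(s in [set: S]) (normc (f x s) ^+ 2)%:E)%E.
  apply: (emeasurable_fun_cvg
    (fun n x => \sum_(s <- J n) (normc (f x s) ^+ 2)%:E)%E).
    move=> n; apply: emeasurable_sum => s.
    by apply/measurable_EFinP; exact: measurable_sqr_normc.
  move=> x _; apply: (esum_exhaustion_cvg uJ Jmon JN) => s.
    by rewrite lee_fin sqr_ge0.
  by move=> nN; rewrite fN// normc0 expr0n.
have mF := measurableT_comp (fine_measurable measurableT) mE.
have mS := measurableT_comp (@measurable_sqrt R) mF.
suff -> : (fun x => l2norm (f x)) = EFin \o (@Num.sqrt R \o (fine \o
    (fun x => \esum_(s in [set: S]) (normc (f x s) ^+ 2)%:E)%E)).
  exact/measurable_EFinP.
apply/funext => x /=; rewrite /l2norm.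
have := ell2_esum (fl2 x).
have : (0 <= \esum_(s in [set: S]) (normc (f x s) ^+ 2)%:E)%E.
  by apply: esum_ge0 => s _; rewrite lee_fin sqr_ge0.
by case: (\esum_(s in _) _)%E.
Qed.

(** Converse of [sm_coord] and [sm_support]: the approximants round the coordinates in [J n] and
    drop the others. *)
Lemma sm_intro f (N : set S) : countable N ->
  (forall x s, ~ N s -> f x s = 0) -> (forall s, cmeasurable (fun x => f x s)) ->
  (forall x, ell2 (f x)) -> strongly_measurable measurable f.
Proof.
move=> cN fN fm fl2; split=> //.
have [J [uJ sJ Jmon JN]] := countable_exhaustion cN.
have [q [qerr qs]] := complex_simple_approx T R.
pose hK n (K : seq S) x : S -> R[i] := fun s => if s \in K then q n (f x s) else 0.
exists (fun n => hK n (J n)) => [n|x].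
  have hs K : fsimple (hK n K).
    elim: K => [|s K IH].
      rewrite (_ : hK n [::] = fun=> (fun=> 0)); first exact: fsimple_cst.
      by apply/funext => x; apply/funext => s.
    rewrite (_ : hK n (s :: K) = fun x => (fun t => if t == s then q n (f x s) else hK n K x t)).
      exact: (fsimple_op (fun (c : R[i]) (v : S -> R[i]) => (fun t => if t == s then c else v t))
        (qs n _ (fm s)) IH).
    apply/funext => x; apply/funext => t; rewrite /hK inE.
    by case: eqVneq => [->|].
  have [a b] := hs (J n); split=> // x.
  by apply: (ell2_fin (uJ n)) => s sJn; rewrite /hK (negbTE sJn).
pose a s := (normc (f x s) ^+ 2)%:E.
have a0 s : (0 <= a s)%E by rewrite lee_fin sqr_ge0.
have tfoo := ell2_esum (fl2 x).
set t := (\esum_(s in setT) a s)%E in tfoo.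
have tfin : t \is a fin_num by rewrite ge0_fin_numE// esum_ge0.
pose b n : R := \sum_(s <- J n) normc (f x s) ^+ 2.
have bcvg : b @ \oo --> fine t.
  have : (fun n => \sum_(s <- J n) a s)%E @ \oo --> t.
    apply: (esum_exhaustion_cvg uJ Jmon JN) => // s nN.
    by rewrite /a fN// normc0 expr0n.
  under eq_fun do rewrite sumEFin.
  by rewrite -{1}(fineK tfin) => /fine_cvgP[].
(* Bound for the squared error: at most [n] coordinates with squared error [4/(n+1)^2] each, plus
   the part of the total outside [J n]. *)
pose e n : R := 4 * n.+1%:R^-1 + (fine t - b n).
have ecvg : e @ \oo --> (0 : R).
  rewrite -[X in _ --> X](_ : 4 * 0 + (fine t - fine t) = 0); last by rewrite mulr0 subrr addr0.
  apply: cvgD; first by apply: cvgM; [exact: cvg_cst|exact: cvg_harmonic].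
  by apply: cvgB => //; exact: cvg_cst.
have secvg : (fun n => (Num.sqrt (e n))%:E) @ \oo --> (0 : \bar R).
  apply: cvg_EFin; first by near=> n.
  rewrite -[X in _ --> X](sqrtr0 R).
  apply: continuous_cvg ecvg; exact: sqrt_continuous.
apply: squeeze_cvge (cvg_cst (0 : \bar R)) secvg.
near=> n; rewrite l2norm_ge0/=; apply: l2norm_le; first exact: sqrtr_ge0.
have bt J' : uniq J' -> \sum_(s <- J') normc (f x s) ^+ 2 <= fine t.
  by move=> uJ'; rewrite -lee_fin fineK// -sumEFin; exact: le_sum_esum.
have en0 : 0 <= e n.
  by rewrite addr_ge0// ?mulr_ge0 ?invr_ge0// subr_ge0; exact: bt.
move=> K uK; rewrite sqr_sqrtr//.
(* Once [n] exceeds the norm of [f x], all coordinates lie in the range where the rounding is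
   accurate. *)
have nf : forall s, normc (f x s) <= n%:R.
  move=> s; rewrite -lee_fin; apply: le_trans (normc_le_l2norm _ _) _.
  have lfin : l2norm (f x) \is a fin_num by rewrite ge0_fin_numE ?l2norm_ge0//; exact: fl2.
  rewrite -[leLHS]fineK// lee_fin; near: n; exact: nbhs_infty_ger.
rewrite (bigID (fun s => s \in J n))/=; apply: lerD.
  rewrite -big_filter.
  apply: (@le_trans _ _ (\sum_(s <- [seq s <- K | s \in J n]) 4 * n.+1%:R^-1 ^+ 2)).
    rewrite big_seq [leRHS]big_seq; apply: ler_sum => s.
    rewrite mem_filter => /andP[sJn _].
    rewrite -[(f x - hK n (J n) x) s]/(f x s - hK n (J n) x s) /hK sJn.
    have -> : 4 * n.+1%:R^-1 ^+ 2 = (2 / n.+1%:R) ^+ 2 :> R by rewrite exprMn; congr (_ * _); rewrite expr2 -natrM.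
    rewrite ler_sqr ?nnegrE ?normc_ge0 ?divr_ge0//; exact: qerr.
  rewrite big_const_seq count_predT iter_addr addr0.
  have szle : (size [seq s <- K | s \in J n] <= n)%N.
    apply: leq_trans (sJ n); apply: uniq_leq_size; first exact: filter_uniq.
    by move=> s; rewrite mem_filter => /andP[].
  rewrite -[_ *+ size _]mulr_natr -mulrA ler_pM2l// expr2 -mulrA ler_piMr ?invr_ge0//.
  rewrite mulrC ler_pdivrMr ?ltr0n// mul1r ler_nat; exact: leqW.
rewrite lerBrDr.
(* The coordinates of [K] outside [J n] together with [J n] form one duplicate-free list, whose sum
   is at most the total. *)
apply: le_trans (bt ([seq s <- K | s \notin J n] ++ J n) _).
  rewrite big_cat/= lerD2r big_filter; apply: ler_sum => s sJn.
  by rewrite -[(f x - hK n (J n) x) s]/(f x s - hK n (J n) x s) /hK (negbTE sJn) subr0.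
rewrite cat_uniq filter_uniq// uJ andbT/=.
by apply/hasPn => s sJn; rewrite mem_filter sJn.
Unshelve. all: by end_near. Qed.

End StrongMeasurability.

(** Cauchy-Schwarz, from [a s * b s <= t / 2 * a s ^+ 2 + b s ^+ 2 / (2 * t)] at the optimal
    [t = L / q]. If [q] or [L] vanishes there is no positive optimum, and a large, respectively
    small, [t] brings the bound below any [e]. *)
Lemma sum_mul_le (R : realType) (S : Type) (J : seq S) (a b : S -> R) (q L : R) :
  0 <= q -> 0 <= L -> \sum_(s <- J) a s ^+ 2 <= q ^+ 2 ->
  \sum_(s <- J) b s ^+ 2 <= L ^+ 2 -> \sum_(s <- J) a s * b s <= q * L.
Proof.
move=> q0 L0 aq bL.
have key (t : R) : 0 < t ->
    \sum_(s <- J) a s * b s <= t / 2 * q ^+ 2 + L ^+ 2 / (2 * t).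
  move=> t0; apply: (@le_trans _ _ (t / 2 * \sum_(s <- J) a s ^+ 2 +
      (\sum_(s <- J) b s ^+ 2) / (2 * t))); last first.
    by apply: lerD; [rewrite ler_wpM2l// divr_ge0// ltW|
      rewrite ler_wpM2r// invr_ge0 mulr_ge0// ltW].
  rewrite mulr_sumr mulr_suml -big_split/=; apply: ler_sum => s _.
  rewrite -subr_ge0 (_ : _ - _ = (t * a s - b s) ^+ 2 / (2 * t)).
    by rewrite divr_ge0 ?sqr_ge0// mulr_ge0// ltW.
  by field; rewrite gt_eqF.
have [q00|q_neq0] := eqVneq q 0.
  apply/ler_addgt0Pr => e e0; rewrite q00 mul0r add0r.
  have L1 : 0 < L ^+ 2 + 1 by rewrite ltr_wpDl ?sqr_ge0.
  apply: le_trans (key ((L ^+ 2 + 1) / (2 * e)) _) _.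
    by rewrite divr_gt0// mulr_gt0.
  rewrite q00 expr0n mulr0 add0r.
  rewrite (_ : L ^+ 2 / _ = (L ^+ 2 / (L ^+ 2 + 1)) * e); last first.
    by field; rewrite !gt_eqF.
  apply: ler_piMl; first exact: ltW.
  by rewrite ler_pdivrMr// mul1r lerDl ler01.
have [L00|L_neq0] := eqVneq L 0.
  apply/ler_addgt0Pr => e e0; rewrite L00 mulr0 add0r.
  have q1 : 0 < q ^+ 2 by rewrite exprn_gt0// lt_neqAle eq_sym q_neq0.
  apply: le_trans (key (e / q ^+ 2) _) _; first by rewrite divr_gt0.
  rewrite L00 expr0n mul0r addr0.
  rewrite (_ : e / q ^+ 2 / 2 * q ^+ 2 = e / 2); last by field; rewrite q_neq0.
  by rewrite ler_pdivrMr// ler_peMr ?(ltW e0)// ler1n.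
have qp : 0 < q by rewrite lt_neqAle eq_sym q_neq0.
have Lp : 0 < L by rewrite lt_neqAle eq_sym L_neq0.
apply: le_trans (key (L / q) _) _; first by rewrite divr_gt0.
by rewrite le_eqVlt; apply/orP; left; apply/eqP; field; rewrite q_neq0 L_neq0.
Qed.

Section VectorCondExp.
Variables (R : realType) (G : topologicalZmodType) (S : choiceType).
Local Notation XX := (power_space G).
Variables (mu : probability (borel G) R) (P : probability XX R).
Hypothesis PP : is_power_measure mu P.
Implicit Types (f g : XX -> S -> R[i]).

(** Vector form of [filtrationP]: composed with [trunc k], the approximants become F_k-measurable.
    Measurability being literal, the equation holds at every point. *)
Lemma sm_filtration k f : strongly_measurable (filtration k) f <->
  strongly_measurable measurable f /\ forall x, f (trunc k x) = f x.
Proof.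
split.
- move=> [fl2 [h hs hf]]; split.
    split=> //; exists h => // n; have [a b c] := hs n; split=> // v.
    by have /filtrationP[] := c v.
  move=> x; apply/funext => s; apply/eqP; rewrite -subr_eq0; apply/eqP/normc_eq0.
  have ht n : h n (trunc k x) = h n x.
    have [_ _ c] := hs n; have /filtrationP[_ E] := c (h n x).
    have : (trunc k @^-1` (h n @^-1` [set h n x])) x by rewrite E.
    by [].
  have h1 := l2norm_cvg0_coord (u := fun n => f x - h n x) s (hf x).
  have h2 := l2norm_cvg0_coord (u := fun n => f (trunc k x) - h n (trunc k x)) s (hf (trunc k x)).
  have h12 : (fun n => normc (f x s - h n x s) +
      normc (f (trunc k x) s - h n (trunc k x) s)) @ \oo --> (0 : R).
    by rewrite -[X in _ --> X](addr0 0); exact: cvgD.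
  apply/le_anti/andP; split; last exact: normc_ge0.
  apply: (ler_cvg_to (cvg_cst _) h12); apply: nearW => n /=; rewrite ht.
  rewrite -[X in _ <= X + _]complex.normcN opprB [leRHS]addrC.
  by apply: le_trans (le_normcD _ _); rewrite subrKA.
- move=> [[fl2 [h hs hf]] ft]; split=> //.
  exists (fun n x => h n (trunc k x)) => [n|x].
    have [a b c] := hs n; split.
    + by move=> x; exact: a.
    + by apply: sub_finite_set b => _ [x _ <-]; exists (trunc k x).
    + move=> v; apply/filtrationP; split.
        rewrite -[X in measurable X]setTI.
        exact: (measurable_trunc k measurableT (c v)).
      by apply/seteqP; split=> x; rewrite /preimage/= truncK.
  by rewrite -{1}ft; exact: hf.
Qed.

Lemma vL1_filtration k f : vL1 P (filtration k) f <->
  vL1 P measurable f /\ forall x, f (trunc k x) = f x.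
Proof.
by split=> [[/sm_filtration[fm ft] fi]|[[fm fi] ft]]; split=> //; apply/sm_filtration.
Qed.

Lemma vL1_measurable_l2norm f : strongly_measurable measurable f ->
  measurable_fun setT (fun x => l2norm (f x)).
Proof.
move=> fm; have [N cN fN] := sm_support fm.
by apply: measurable_l2norm cN fN _ _ => [s|x]; [exact: sm_coord|exact: fm.1].
Qed.

Lemma ell2_fineK (v : S -> R[i]) : ell2 v -> (fine (l2norm v))%:E = l2norm v.
Proof. by move=> vl; rewrite fineK// ge0_fin_numE ?l2norm_ge0. Qed.

Lemma vL1_rintegrable f : vL1 P measurable f ->
  rintegrable P (fun x => fine (l2norm (f x))).
Proof.
move=> [fm foo].
have -> : rintegrable P (fun x => fine (l2norm (f x))) = P.-integrable setT (fun x => l2norm (f x)).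
  by congr (_.-integrable _ _); apply/funext => x /=; rewrite ell2_fineK//; exact: fm.1.
apply/integrableP; split; first exact: vL1_measurable_l2norm.
by under eq_integral do rewrite gee0_abs ?l2norm_ge0//.
Qed.

Lemma normc_le_fine_l2norm (v : S -> R[i]) s : ell2 v -> normc (v s) <= fine (l2norm v).
Proof. by move=> vl; rewrite -lee_fin ell2_fineK// normc_le_l2norm. Qed.

Lemma vL1_coord f s : vL1 P measurable f -> cintegrable P (fun x => f x s).
Proof.
move=> fL; apply: (cintegrable_le _ (vL1_rintegrable fL)).
  by have [fm _] := fL; exact: sm_coord.
by move=> x; apply: normc_le_fine_l2norm; have [[fl2 _] _] := fL.
Qed.

Lemma vintegralE (A : set XX) f s :
  vintegral P A f s = cint P (fun x => ((\1_A x : R)%:C)%C * f x s).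
Proof.
rewrite /vintegral /cint; congr Complex; rewrite Rintegral_mkcond;
  apply: eq_Rintegral => x _; rewrite /patch indicE; case: ifP => _ /=;
  by rewrite ?ReM ?ImM /= ?mul1r ?mul0r ?subr0 ?addr0.
Qed.

Lemma cmeasurable_indic (A : set XX) : measurable A ->
  cmeasurable (fun x => ((\1_A x : R)%:C)%C).
Proof. by move=> mA; apply: cmeasurable_real; exact: measurable_indic. Qed.

Lemma normc_indic_le1 (A : set XX) x : normc (((\1_A x : R)%:C)%C) <= 1.
Proof. by rewrite normc_real indicE; case: (_ \in _); rewrite ?normr1 ?normr0. Qed.

Lemma indic_trunc k (A : set XX) x : filtration k A -> \1_A (trunc k x) = \1_A x :> R.
Proof.
move=> /filtrationP[_ AE]; rewrite !indicE; congr (_%:R); congr nat_of_bool.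
by rewrite -[in RHS]AE; apply/idP/idP; rewrite !inE.
Qed.

End VectorCondExp.

(** * Conditional expectations of [ℓ^2(S)]-valued functions *)

Section VectorCondExp2.
Variables (R : realType) (G : topologicalZmodType) (S : choiceType).
Local Notation XX := (power_space G).
Variables (mu : probability (borel G) R) (P : probability XX R).
Hypothesis PP : is_power_measure mu P.
Implicit Types (f g : XX -> S -> R[i]).

Section Existence.
Variables (k : nat) (f : XX -> S -> R[i]).
Hypothesis fL : vL1 P measurable f.

(** A version of E_k of the norm of [f]: finite almost everywhere, it bounds the norm of E_k f where
    it is finite. *)
Let I x : \bar R := (\int[P]_y l2norm (f (splice k x y)))%E.

Let fm : measurable_fun setT (fun x => l2norm (f x)).
Proof. by apply: vL1_measurable_l2norm; case: fL. Qed.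

Let fsplm : measurable_fun setT
  (fun z : XX * XX => l2norm (f (splice k z.1 z.2))).
Proof. exact: (measurableT_comp fm (measurable_splice k)). Qed.

Let I_measurable : measurable_fun setT I.
Proof.
by apply: (measurable_fun_fubini_tonelli_F _ fsplm) => z; exact: l2norm_ge0.
Qed.

Let I_ge0 x : (0 <= I x)%E.
Proof. by apply: integral_ge0 => y _; exact: l2norm_ge0. Qed.

Let I_integral : (\int[P]_x I x = \int[P]_x l2norm (f x))%E.
Proof.
rewrite (mpres_ge0_integral (@measurable_splice G k) (splice_mpres PP k) fm) ?l2norm_ge0//.
  by rewrite (fubini_tonelli1 _ fsplm)// => z; exact: l2norm_ge0.
by move=> x; exact: l2norm_ge0.
Qed.

Let I_ae : {ae P, forall x, (I x < +oo)%E}.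
Proof.
have Ii : P.-integrable setT I.
  apply/integrableP; split=> //.
  under eq_integral do rewrite gee0_abs ?I_ge0//.
  by rewrite I_integral; case: fL.
have := integrable_ae measurableT Ii; apply: filterS => x /(_ Logic.I).
by rewrite ge0_fin_numE.
Qed.

Let B : set XX := [set x | (I x < +oo)%E].

Let mB : measurable B.
Proof.
rewrite -[B]setTI; exact: emeasurable_fun_infty_o.
Qed.

(** Cut off to [0] outside [B], where the coordinatewise expectations need not form a vector of
    ℓ^2(S), as [strongly_measurable] demands at every point. The complement of [B] is null, and [B]
    is invariant under [trunc k]. *)
Definition condexp_version x : S -> R[i] := fun s =>
  ((\1_B x : R)%:C)%C * cexp P k (fun y => f y s) x.

Let gE x s : B x -> condexp_version x s = cexp P k (fun y => f y s) x.
Proof. by move=> Bx; rewrite /condexp_version indicE mem_set// mul1r. Qed.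

Let g0 x s : ~ B x -> condexp_version x s = 0.
Proof. by move=> Bx; rewrite /condexp_version indicE memNset// mul0r. Qed.

(** The norm of an expectation is at most the expectation of the norm, by duality: if [q] is the
    norm of the vector on the coordinates in [J], pairing it with itself gives [q ^+ 2 <= q * K] by
    Cauchy-Schwarz under the integral. *)
Let condexp_version_l2norm x : B x -> (l2norm (condexp_version x) <= I x)%E.
Proof.
move=> Bx; have Ifin : I x \is a fin_num by rewrite ge0_fin_numE.
rewrite -[leRHS](fineK Ifin); set K := fine (I x).
have K0 : 0 <= K by rewrite fine_ge0.
have fl2 y : ell2 (f y) by have [[]] := fL.
have Li : rintegrable P (fun y => fine (l2norm (f (splice k x y)))).
  have -> : rintegrable P (fun y => fine (l2norm (f (splice k x y)))) =
      P.-integrable setT (fun y => l2norm (f (splice k x y))).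
    by congr (_.-integrable _ _); apply/funext => y /=; rewrite ell2_fineK.
  apply/integrableP; split.
    exact: (measurableT_comp fm (measurable_splicer k x)).
  by under eq_integral do rewrite gee0_abs ?l2norm_ge0//.
have KE : K = \int[P]_y fine (l2norm (f (splice k x y))).
  rewrite /K /Rintegral; congr fine; apply: eq_integral => y _.
  by rewrite ell2_fineK.
have fs s : cintegrable P (fun y => f (splice k x y) s).
  apply: (cintegrable_le _ Li) => [|y]; last exact: normc_le_fine_l2norm.
  have [[a b] _] := (sm_coord s fL.1, tt).
  by split; [exact: (measurableT_comp a (measurable_splicer k x))|
             exact: (measurableT_comp b (measurable_splicer k x))].
apply: l2norm_le => // J uJ.
pose q := Num.sqrt (\sum_(s <- J) normc (condexp_version x s) ^+ 2).
have qE : \sum_(s <- J) normc (condexp_version x s) ^+ 2 = q ^+ 2.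
  by rewrite sqr_sqrtr// sumr_ge0// => s _; rewrite sqr_ge0.
have q0 : 0 <= q by exact: sqrtr_ge0.
rewrite qE ler_sqr ?nnegrE//.
suff : q ^+ 2 <= q * K.
  have [->//|qn0] := eqVneq q 0.
  by rewrite expr2 ler_pM2l// lt_neqAle eq_sym qn0.
have E : ((q ^+ 2)%:C)%C =
    cint P (fun y => \sum_(s <- J) (condexp_version x s)^*%C * f (splice k x y) s).
  rewrite cint_sum; last by move=> s; exact: cintegrableZ.
  rewrite -qE rmorph_sum/=; apply: eq_bigr => s _.
  by rewrite cintZ// -[cint _ _]/(cexp P k (fun y => f y s) x) -gE// [RHS]mulrC mulc_conj.
have -> : q ^+ 2 = normc (((q ^+ 2)%:C)%C).
  by rewrite normc_real ger0_norm// sqr_ge0.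
rewrite E; apply: le_trans (normc_cint_le _) _.
  by apply: cintegrable_sum => s; exact: cintegrableZ.
rewrite KE -RintegralZl//; apply: le_Rintegral => //.
- apply: cintegrable_norm; apply: cintegrable_sum => s; exact: cintegrableZ.
- exact: rintegrableZ.
move=> y _; apply: le_trans (le_normc_sum _ _ _) _.
under eq_bigr do rewrite normcM normc_conj.
apply: sum_mul_le => //; first by rewrite fine_ge0// l2norm_ge0.
  by rewrite qE.
by rewrite -lee_fin EFin_expe ell2_fineK// sum_le_l2norm.
Qed.

Lemma condexp_version_ae s :
  {ae P, forall x, condexp_version x s = cexp P k (fun y => f y s) x}.
Proof. by apply: filterS I_ae => x Ix; rewrite gE. Qed.

Let version_ell2 x : ell2 (condexp_version x).
Proof.
have [Bx|nBx] := pselect (B x).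
  exact: le_lt_trans (condexp_version_l2norm Bx) Bx.
by apply: (@ell2_fin _ _ _ [::]) => // s _; exact: g0.
Qed.

Let version_cmeasurable s : cmeasurable (fun x => condexp_version x s).
Proof.
apply: cmeasurableM; first exact: cmeasurable_indic.
apply: cintegrable_cmeasurable; apply: (cexp_cintegrable PP).
exact: vL1_coord.
Qed.

Lemma condexp_versionP : is_condexp P (filtration k) f condexp_version.
Proof.
have [N cN fN] := sm_support fL.1.
have gN x s : ~ N s -> condexp_version x s = 0.
  move=> nNs; rewrite /condexp_version /cexp.
  under eq_cint do rewrite fN//.
  by rewrite cint0 mulr0.
have gtr x : condexp_version (trunc k x) = condexp_version x.
  apply/funext => s; rewrite /condexp_version cexp_trunc; congr (_ * _).
  rewrite !indicE; congr ((_%:R)%:C)%C; congr nat_of_bool.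
  have E : I (trunc k x) = I x.
    by rewrite /I; apply: eq_integral => y _; rewrite splice_trunc.
  by apply/idP/idP; rewrite !inE /B/= E.
have gsm : strongly_measurable measurable condexp_version.
  exact: (sm_intro cN gN version_cmeasurable version_ell2).
split.
  apply/vL1_filtration; split=> //; split=> //.
  apply: (@le_lt_trans _ _ (\int[P]_x I x)%E).
    apply: ge0_le_integral => //.
    - by move=> x _; exact: l2norm_ge0.
    - exact: vL1_measurable_l2norm.
    - move=> x _; have [Bx|/negP] := pselect (B x).
        exact: condexp_version_l2norm.
      by rewrite -leNgt leye_eq => /eqP ->; rewrite leey.
  by rewrite I_integral; case: fL.
move=> A FA; apply/funext => s; rewrite !vintegralE.
have mA : measurable A by have /filtrationP[] := FA.
rewrite -(cint_cexpM PP (vL1_coord s fL) (cmeasurable_indic R mA) (normc_indic_le1 R A)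
  (fun x => congr1 (real_complex R) (indic_trunc R x FA))).
apply: ae_eq_cint.
- exact: cmeasurableM (cmeasurable_indic R mA) (version_cmeasurable s).
- apply: cmeasurableM; first exact: cmeasurable_indic.
  apply: cintegrable_cmeasurable; apply: (cexp_cintegrable PP); exact: vL1_coord.
- by apply: filterS (condexp_version_ae s) => x ->.
Qed.

End Existence.

Lemma condexpP k f : vL1 P measurable f ->
  is_condexp P (filtration k) f (condexp P (filtration k) f).
Proof.
move=> fL; rewrite /condexp; case: xgetP => [g -> //|no].
by have := no _ (condexp_versionP k fL).
Qed.

Lemma is_condexp_coord_ae k f g g' s :
  is_condexp P (filtration k) f g -> is_condexp P (filtration k) f g' ->
  {ae P, forall x, g x s = g' x s}.
Proof.
move=> [/vL1_filtration[gL gt] gE] [/vL1_filtration[g'L g't] g'E].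
apply: (condexp_unique (k := k)) => //.
- exact: vL1_coord.
- exact: vL1_coord.
- by move=> x; rewrite gt.
- by move=> x; rewrite g't.
move=> A FA; have := congr1 (fun v => v s) (etrans (gE A FA) (esym (g'E A FA))).
by rewrite /vintegral => -[].
Qed.

(** Both versions vanish off a countable set of coordinates, so the exceptional null sets, one per
    coordinate, have a null union. *)
Lemma is_condexp_ae k f g g' :
  is_condexp P (filtration k) f g -> is_condexp P (filtration k) f g' ->
  {ae P, forall x, g x = g' x}.
Proof.
move=> gE g'E.
have [N cN gN] := sm_support gE.1.1; have [N' cN' g'N] := sm_support g'E.1.1.
have cU : countable (N `|` N').
  rewrite -bigcup2E; apply: bigcup_countable => // i _.
  by case: i => [|[|i]] //=.
have [J [_ _ _ JN]] := countable_exhaustion cU.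
have : {ae P, forall x, forall n, forall s, s \in J n -> g x s = g' x s}.
  apply/ae_foralln => n; elim: (J n) => [|s K IH].
    by apply: aeW => x s.
  apply: filterS2 IH (is_condexp_coord_ae s gE g'E) => x a b t.
  by rewrite inE => /orP[/eqP ->|/a].
apply: filterS => x h; apply/funext => s.
have [/JN[n sn]|nU] := pselect ((N `|` N') s); first exact: h sn.
by rewrite gN ?g'N// => Ns; apply: nU; [right|left].
Qed.

Lemma cint_condexpM k f s (w : XX -> R[i]) (K : R) : vL1 P measurable f ->
  cmeasurable w -> (forall x, normc (w x) <= K) ->
  (forall x, w (trunc k x) = w x) ->
  cint P (fun x => w x * condexp P (filtration k) f x s) =
  cint P (fun x => w x * f x s).
Proof.
move=> fL wm wK wt.
have gE := condexpP k fL; have [/vL1_filtration[gL _] _] := gE.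
rewrite -(cint_cexpM PP (vL1_coord s fL) wm wK wt); apply: ae_eq_cint.
- apply: cmeasurableM => //; apply: cintegrable_cmeasurable; exact: vL1_coord gL.
- apply: cmeasurableM => //; apply: cintegrable_cmeasurable.
  by apply: (cexp_cintegrable PP); exact: vL1_coord.
apply: filterS2 (is_condexp_coord_ae s gE (condexp_versionP k fL)) (condexp_version_ae k fL s).
by move=> x -> ->.
Qed.

End VectorCondExp2.

(** * Characters *)

Section Characters.
Variables (R : realType) (G : topologicalZmodType).
Local Notation XX := (power_space G).
Implicit Types (a b : dual R G) (g h : dualsum R G) (x : XX).

Lemma dual_continuous a : continuous (a : G -> R[i]^o).
Proof. by have /asboolP[] := chiP a. Qed.

Lemma dualM a (t u : G) : a (t + u) = a t * a u.
Proof. by have /asboolP[_ h _] := chiP a. Qed.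

Lemma normc_dual a (t : G) : normc (a t) = 1.
Proof.
have /asboolP[_ _ /(_ t)] := chiP a.
by rewrite normc_def => /complexI; case: (a t).
Qed.

Lemma dual_at0 a : a 0 = 1.
Proof.
have /eqP : a 0 * a 0 = a 0 * 1 by rewrite -dualM addr0 mulr1.
rewrite (inj_eq (mulfI _)) => [/eqP//|].
by apply: contra_eq_neq (normc_dual a 0) => ->; rewrite normc0 eq_sym oner_neq0.
Qed.

Lemma dual_neq0 a : a != 0 -> exists t, a t != 1.
Proof.
move=> a0; apply: contrapT => h; move/eqP: a0; apply.
apply/val_inj/funext => t /=; apply: contrapT => /eqP at1.
by apply: h; exists t.
Qed.

Lemma finite_nat_bound (A : set nat) : finite_set A ->
  exists N, forall j, A j -> (j < N)%N.
Proof.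
move=> fA; exists (\max_(j <- fset_set A) j).+1 => j Aj; rewrite ltnS.
by apply: (@leq_bigmax_seq _ _ xpredT (fun j => j)) => //; rewrite in_fset_set// inE.
Qed.

Lemma dual_head_ex g : exists k, `[< dual_head k g >].
Proof.
have /asboolP/finite_nat_bound[N gN] := dseqP g.
exists N; apply/asboolP => j Nj; apply: contrapT => /eqP /gN.
by rewrite ltnNge Nj.
Qed.

(** The level of a character: [0] for the trivial one, otherwise one more than the position of the
    last nonzero coordinate. As positions start at [0], it is the least [k] such that the character
    depends on the first [k] coordinates only. *)
Definition top g := ex_minn (dual_head_ex g).

Lemma dual_headP k g : dual_head k g <-> (top g <= k)%N.
Proof.
rewrite /top; case: ex_minnP => m /asboolP hm mmin; split.
  by move=> hk; apply: mmin; apply/asboolP.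
by move=> mk j kj; apply: hm; exact: leq_trans kj.
Qed.

Lemma top_head g : dual_head (top g) g. Proof. exact/dual_headP. Qed.

Lemma dual_head_topP k g : dual_head_top k g <-> top g = k.
Proof.
split=> [[/dual_headP gk kg]|<-].
  apply/eqP; rewrite eqn_leq gk; case: k kg gk => // k /(_ isT) gk0 gk.
  rewrite ltnNge; apply/negP => /dual_headP gk'; move/eqP: gk0; apply.
  exact: gk'.
split; first exact: top_head.
move=> t0; apply/eqP => gt.
have : dual_head (top g).-1 g.
  move=> j jt; have [->//|jne] := eqVneq j (top g).-1.
  by apply: top_head; rewrite -(prednK t0) ltn_neqAle eq_sym jne.
by move/dual_headP; rewrite leqNgt ltn_predL t0.
Qed.

Lemma character_ofE N g x : dual_head N g ->
  character_of g x = \prod_(j < N) g j (x j).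
Proof.
move=> gN; rewrite /character_of (@fsbigE _ _ _ _ _ (index_iota 0 N))//=.
- rewrite big_mkcond big_mkord; apply: eq_bigr => j _; by rewrite in_setT.
- exact: iota_uniq.
- move=> j _; rewrite mem_index_iota /= -leqNgt => Nj.
  by rewrite gN.
Qed.

Lemma normc_character g x : normc (character_of g x) = 1.
Proof.
rewrite (character_ofE x (@top_head g)).
elim/big_ind: _ => [|u v hu hv|j _]; first exact: normc1.
  by rewrite normcM hu hv mulr1.
exact: normc_dual.
Qed.

Lemma dual_head_mono k l g : (k <= l)%N -> dual_head k g -> dual_head l g.
Proof. by move=> kl gk j lj; apply: gk; exact: leq_trans lj. Qed.

Lemma characterD g h x : character_of (g + h) x = character_of g x * character_of h x.
Proof.
pose N := maxn (top g) (top h).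
have gN : dual_head N g by apply: dual_head_mono (@top_head g); exact: leq_maxl.
have hN : dual_head N h by apply: dual_head_mono (@top_head h); exact: leq_maxr.
have ghN : dual_head N (g + h).
  by move=> j Nj; rewrite -[_ j]/(g j + h j) gN// hN// addr0.
rewrite (character_ofE x gN) (character_ofE x hN) (character_ofE x ghN) -big_split/=.
by apply: eq_bigr.
Qed.

Lemma character0 x : character_of (0 : dualsum R G) x = 1.
Proof. by rewrite (@character_ofE 0)// big_ord0. Qed.

Lemma characterN g x : character_of (- g) x = (character_of g x)^*%C.
Proof.
have g0 : character_of g x != 0.
  by apply: contra_eq_neq (normc_character g x) => ->; rewrite normc0 eq_sym oner_neq0.
apply: (mulfI g0); rewrite -characterD subrr character0.
by rewrite mulc_conj normc_character expr1n.
Qed.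

Lemma characterB g h x :
  character_of (g - h) x = character_of g x * (character_of h x)^*%C.
Proof. by rewrite characterD characterN. Qed.

Lemma measurable_continuous_G (u : G -> R) : continuous u ->
  measurable_fun setT (u : borel G -> R).
Proof.
move=> cu; apply: (measurability _ (RGenOpens.measurableE R)).
move=> _ [_ [a [b ->]] <-]; rewrite setTI; apply: sub_sigma_algebra.
by apply: open_comp => // x _; exact: cu.
Qed.

Lemma continuous_normc_ReIm (u : G -> R[i]^o) : continuous u ->
  continuous (fun t => Re (u t)) /\ continuous (fun t => Im (u t)).
Proof.
move=> cu; split=> t; apply/cvgrPdist_lt => e e0.
- have ec0 : 0 < (e%:C)%C :> R[i] by rewrite ltcR.
  have /cvgrPdist_lt/(_ _ ec0) := cu t; apply: filterS => y.
  rewrite normc_def ltcR; apply: le_lt_trans.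
  have -> : Re (u t) - Re (u y) = Re (u t - u y) by case: (u t); case: (u y).
  by have := normr_Re_le (u t - u y); case: (u t - u y).
- have ec0 : 0 < (e%:C)%C :> R[i] by rewrite ltcR.
  have /cvgrPdist_lt/(_ _ ec0) := cu t; apply: filterS => y.
  rewrite normc_def ltcR; apply: le_lt_trans.
  have -> : Im (u t) - Im (u y) = Im (u t - u y) by case: (u t); case: (u y).
  by have := normr_Im_le (u t - u y); case: (u t - u y).
Qed.

Lemma cmeasurable_coord a j : cmeasurable (fun x : XX => a (x j)).
Proof.
have [cr ci] := continuous_normc_ReIm (@dual_continuous a).
have mj : measurable_fun setT (fun x : XX => (x : nat -> borel G) j).
  by move=> _ B mB; rewrite setTI; exact: measurable_coord.
by split; [exact: (measurableT_comp (measurable_continuous_G cr) mj)|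
           exact: (measurableT_comp (measurable_continuous_G ci) mj)].
Qed.

Lemma cmeasurable_character g : cmeasurable (fun x : XX => character_of g x).
Proof.
have key N : cmeasurable (fun x : XX => \prod_(j < N) g j (x j)).
  elim: N => [|n IH].
    have := @cmeasurable_cst _ XX R 1.
    by congr cmeasurable; apply/funext => x; rewrite big_ord0.
  have := cmeasurableM IH (cmeasurable_coord (g n) n).
  by congr cmeasurable; apply/funext => x; rewrite big_ord_recr.
have := key (top g); congr cmeasurable; apply/funext => x; apply/esym.
exact: character_ofE (@top_head g).
Qed.

Lemma character_trunc k g x : dual_head k g ->
  character_of g (trunc k x) = character_of g x.
Proof.
move=> gk; rewrite !(character_ofE _ gk); apply: eq_bigr => j _.
by rewrite /trunc /splice ltn_ord.
Qed.

Lemma character_shift i (t : G) g x :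
  character_of g (shift i t x) = g i t * character_of g x.
Proof.
pose N := maxn (top g) i.+1.
have gN : dual_head N g by apply: dual_head_mono (@top_head g); exact: leq_maxl.
have iN : (i < N)%N by exact: leq_maxr.
rewrite !(character_ofE _ gN) (bigD1 (Ordinal iN))//= [in RHS](bigD1 (Ordinal iN))//=.
rewrite /shift eqxx dualM -mulrA; congr (_ * (_ * _)).
apply: eq_bigr => j ji; case: eqVneq => // jE.
by exfalso; move/eqP: ji; apply; apply/val_inj.
Qed.

Lemma trunc_shift k i (t : G) x : (k <= i)%N -> trunc k (shift i t x) = trunc k x.
Proof.
move=> ki; apply: (@funext nat (borel G)) => j; rewrite /trunc /splice /shift.
by case: ltnP => // jk; case: eqVneq => // ji; move: jk; rewrite ji ltnNge ki.
Qed.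

Variables (mu : probability (borel G) R) (P : probability XX R).
Hypothesis haarmu : is_haar mu.
Hypothesis PP : is_power_measure mu P.

Lemma cintegrableM_character g (u : XX -> R[i]) : cintegrable P u ->
  cintegrable P (fun x => u x * character_of g x).
Proof.
move=> ui; have g1 (x : XX) : normc (character_of g x) <= 1.
  by rewrite normc_character.
have := cintegrableMb (cmeasurable_character g) ui g1.
by congr cintegrable; apply/funext => x; rewrite mulrC.
Qed.

(** Some coordinate [i >= k] of [g] is a nontrivial character of [G]; translating that coordinate
    fixes [u] and multiplies the integrand by a value [g i t] other than 1. *)
Lemma cint_character_orth k g (u : XX -> R[i]) : cintegrable P u ->
  (forall x, u (trunc k x) = u x) -> ~ dual_head k g ->
  cint P (fun x => u x * character_of g x) = 0.
Proof.
move=> ui ut gk.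
have [i [ki gi]] : exists i, (k <= i)%N /\ g i != 0.
  apply: contrapT => h; apply: gk => j kj; apply: contrapT => /eqP gj.
  by apply: h; exists j.
have [t gt] := dual_neq0 gi.
apply: (cint_shift0 (z := g i t) (@measurable_shift G i t)
  (fun A => shift_mpres haarmu PP i t (A := A))) => //.
- exact: cintegrableM_character.
- by move=> x; rewrite character_shift -[u (shift _ _ _)]ut trunc_shift// ut mulrCA.
Qed.

Lemma normc_cint_character_le g (u : XX -> R) : rintegrable P u ->
  (forall x, 0 <= u x) ->
  normc (cint P (fun x => ((u x)%:C)%C * character_of g x)) <= \int[P]_x u x.
Proof.
move=> ui u0; apply: le_trans (normc_cint_le _) _.
  by apply: cintegrableM_character; exact: cintegrable_real.
under eq_Rintegral do rewrite normcM normc_character mulr1 normc_real.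
by under eq_Rintegral do rewrite ger0_norm//.
Qed.

End Characters.

(** * Representatives of the cosets of Γ^k *)

Section TailProjection.
Variables (R : realType) (G : topologicalZmodType).
Implicit Types (g h : dualsum R G).

Fact tail_subproof k g : (fun j => if (j < k)%N then 0 else g j) \in @is_finsupp R G.
Proof.
apply/asboolP; have /asboolP := dseqP g.
by apply: sub_finite_set => j /=; case: ifP => //; rewrite eqxx.
Qed.

(** The representative of the coset of [g] modulo Γ^k with vanishing first [k] coordinates. It turns
    membership in one coset into an equation, by which finite sums can be grouped. *)
Definition tail_proj k g : dualsum R G := DualSum (tail_subproof k g).

Lemma tail_proj_tail k g : dual_tail k (tail_proj k g).
Proof. by move=> j jk /=; rewrite jk. Qed.

Lemma tail_proj_head k g : dual_head k (g - tail_proj k g).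
Proof.
by move=> j kj; rewrite -[_ j]/(g j - tail_proj k g j) /= ltnNge kj subrr.
Qed.

Lemma tail_proj_eq k g h : tail_proj k g = tail_proj k h <-> dual_head k (g - h).
Proof.
split.
- move=> E j kj; rewrite -[_ j]/(g j - h j).
  by have := congr1 (fun d : dualsum R G => d j) E; rewrite /= ltnNge kj/= => ->; rewrite subrr.
- move=> gh; apply/val_inj/funext => j /=; case: ltnP => // kj.
  by apply/eqP; rewrite -subr_eq0; apply/eqP; exact: gh.
Qed.

Lemma tail_proj_eq0 k g : tail_proj k g = 0 <-> dual_head k g.
Proof.
split=> [E j kj|gk].
  by have := congr1 (fun d : dualsum R G => d j) E; rewrite /= ltnNge kj.
apply/val_inj/funext => j /=; case: ltnP => // kj; exact: gk.
Qed.

End TailProjection.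

(** * The upper bound *)

Section FiniteSums.
Context (R : realType).

Lemma ler_sum_uniq_subset (T : eqType) (J1 J2 : seq T) (a : T -> R) :
  uniq J1 -> uniq J2 -> {subset J1 <= J2} -> (forall x, 0 <= a x) ->
  \sum_(x <- J1) a x <= \sum_(x <- J2) a x.
Proof.
move=> u1 u2 sub a0.
have J12 : perm_eq J1 [seq x <- J2 | x \in J1].
  apply: uniq_perm => //; first exact: filter_uniq.
  by move=> x; rewrite mem_filter; case: (boolP (x \in J1)) => //= /sub ->.
rewrite (perm_big _ J12)/= big_filter big_mkcond/=.
by apply: ler_sum => x _; case: ifP.
Qed.

Lemma sum_fiber (T U : eqType) (Y : seq T) (h : T -> U) (p : pred U) (F : T -> R) :
  \sum_(y <- Y | p (h y)) F y =
  \sum_(u <- undup [seq h y | y <- Y & p (h y)]) \sum_(y <- Y | h y == u) F y.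
Proof.
set V := undup _.
transitivity (\sum_(y <- Y | p (h y)) \sum_(u <- V | h y == u) F y).
  rewrite big_seq_cond [RHS]big_seq_cond; apply: eq_bigr => y /andP[yY py].
  have hyV : h y \in V.
    by rewrite mem_undup; apply: map_f; rewrite mem_filter py.
  rewrite (eq_bigl (fun u => u == h y)); last by move=> u; rewrite eq_sym.
  by rewrite -big_filter filter_pred1_uniq ?undup_uniq// big_seq1.
rewrite (exchange_big_dep xpredT)//= [LHS]big_seq [RHS]big_seq; apply: eq_bigr => u uV.
apply: eq_bigl => y; case: eqVneq => [hyu|]; last by rewrite andbF.
move: uV; rewrite /V mem_undup => /mapP[z]; rewrite mem_filter => /andP[pz _] uz.
by rewrite hyu uz pz.
Qed.

Lemma sqr_EFin_le (x : R) (y : \bar R) : 0 <= x -> (x%:E <= y)%E ->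
  ((x ^+ 2)%:E <= y ^+ 2)%E.
Proof.
move=> x0; case: y => [y| |]//.
  rewrite lee_fin => xy; rewrite -EFin_expe lee_fin.
  by rewrite ler_sqr ?nnegrE// (le_trans x0).
by move=> _; rewrite expe2 mulyy leey.
Qed.

End FiniteSums.

(** * Pairs of characters and the two suprema of Q *)

Section Combinatorics.
Variables (R : realType) (G : topologicalZmodType) (S : choiceType).
Variable lambda : dualsum R G -> S -> R.
Hypothesis lambda0 : forall g s, 0 <= lambda g s.
Implicit Types (g h : dualsum R G) (Y : seq (dualsum R G)).

(** [QA k] and [QB k] are the squares of the terms of index [k] in the two suprema of [Qnorm]. *)
Definition QA k : \bar R := (\esum_(g' in dual_tail k `\ (0 : dualsum R G)%R)
      \esum_(s in [set: S])
      (\esum_(g in dual_head k) (lambda (g + g')%R s)%:E) ^+ 2)%E.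

Definition QB k : \bar R := (\esum_(s in [set: S])
      (\esum_(g in dual_head_top k) (lambda g s)%:E) ^+ 2)%E.

Lemma sum_top_le_QB k Y (S0 : seq S) : uniq Y -> uniq S0 ->
  ((\sum_(s <- S0) (\sum_(g <- Y | top g == k) lambda g s) ^+ 2)%:E <= QB k)%E.
Proof.
move=> uY uS; apply: le_trans (le_sum_esum _ uS (fun _ _ => Logic.I)).
rewrite -sumEFin; apply: lee_sum => s _; apply: sqr_EFin_le; first exact: sumr_ge0.
rewrite -sumEFin -big_filter; apply: le_sum_esum; first exact: filter_uniq.
by move=> g; rewrite mem_filter => /andP[/eqP gk _]; apply/dual_head_topP.
Qed.

Lemma sum_tail_le_QA k Y (S0 : seq S) : uniq Y -> uniq S0 ->
  ((\sum_(s <- S0) \sum_(t <- undup [seq tail_proj k g | g <- Y & tail_proj k g != 0])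
     (\sum_(g <- Y | tail_proj k g == t) lambda g s) ^+ 2)%:E <= QA k)%E.
Proof.
move=> uY uS; set V := undup _.
rewrite exchange_big/=.
have VA t : t \in V -> (dual_tail k `\ (0 : dualsum R G)) t.
  rewrite /V mem_undup => /mapP[g]; rewrite mem_filter => /andP[/eqP g0 _] ->.
  by split; [exact: tail_proj_tail|].
apply: le_trans (le_sum_esum _ (undup_uniq _) VA).
rewrite -sumEFin; apply: lee_sum => t _.
apply: le_trans (le_sum_esum _ uS (fun _ _ => Logic.I)).
rewrite -sumEFin; apply: lee_sum => s _; apply: sqr_EFin_le; first exact: sumr_ge0.
rewrite -big_filter -sumEFin.
(* Subtracting the representative [t] carries its coset into Γ^k, the index set of the inner sum of
   [QA]. *)
have -> : (\sum_(g <- [seq g <- Y | tail_proj k g == t]) (lambda g s)%:E =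
   \sum_(g <- [seq (g - t)%R | g <- [seq g <- Y | tail_proj k g == t]]) (lambda (g + t)%R s)%:E)%E.
  by rewrite big_map; apply: eq_bigr => g _; rewrite subrK.
apply: le_sum_esum; first by rewrite map_inj_uniq ?filter_uniq//; exact: addIr.
move=> g /mapP[h]; rewrite mem_filter => /andP[/eqP <- _] ->.
exact: tail_proj_head.
Qed.

(** A nonzero common tail puts the pair into a square counted by [QA k]. A zero tail means
    [top g <= k], which with [k <= top g] makes both levels equal to [k], and the pair is counted by
    [QB k]. *)
Lemma pair_sum_le k Y (S0 : seq S) : uniq Y -> uniq S0 ->
  ((\sum_(s <- S0) \sum_(g <- Y) \sum_(h <- Y |
      [&& (k <= top g)%N, top g == top h & tail_proj k g == tail_proj k h])
      lambda g s * lambda h s)%:E <= QA k + QB k)%E.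
Proof.
move=> uY uS.
apply: le_trans (leeD (sum_tail_le_QA k uY uS) (sum_top_le_QB k uY uS)).
rewrite -EFinD lee_fin -big_split/=; apply: ler_sum => s _.
have -> : \sum_(t <- undup [seq tail_proj k g | g <- Y & tail_proj k g != 0])
     (\sum_(g <- Y | tail_proj k g == t) lambda g s) ^+ 2 =
   \sum_(g <- Y | tail_proj k g != 0)
     \sum_(h <- Y | tail_proj k h == tail_proj k g) lambda g s * lambda h s.
  rewrite [RHS](sum_fiber Y (tail_proj k) (fun t => t != 0)); apply: eq_bigr => t _.
  rewrite expr2 mulr_suml; apply: eq_bigr => g /eqP ->.
  by rewrite mulr_sumr.
have -> : (\sum_(g <- Y | top g == k) lambda g s) ^+ 2 =
   \sum_(g <- Y | top g == k) \sum_(h <- Y | top h == k) lambda g s * lambda h s.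
  by rewrite expr2 mulr_suml; apply: eq_bigr => g _; rewrite mulr_sumr.
rewrite [X in _ <= X + _]big_mkcond [X in _ <= _ + X]big_mkcond -big_split/=.
apply: ler_sum => g _.
have sum0 (p : pred (dualsum R G)) : 0 <= \sum_(h <- Y | p h) lambda g s * lambda h s.
  by apply: sumr_ge0 => h _; exact: mulr_ge0.
have mono (p q : pred (dualsum R G)) : (forall h, p h -> q h) ->
    \sum_(h <- Y | p h) lambda g s * lambda h s <= \sum_(h <- Y | q h) lambda g s * lambda h s.
  move=> pq; rewrite big_mkcond [leRHS]big_mkcond; apply: ler_sum => h _.
  by case: (boolP (p h)) => [/pq ->//|_]; case: ifP => // _; exact: mulr_ge0.
have [gk|gk] := eqVneq (top g) k.
  have -> : tail_proj k g = 0 by apply/tail_proj_eq0/dual_headP; rewrite gk.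
  rewrite eqxx add0r; by apply: mono => h /and3P[_ /eqP <- _]; rewrite gk eqxx.
rewrite addr0; case: ifP => [_|/negbFE/eqP/tail_proj_eq0/dual_headP gk'].
  by apply: mono => h /and3P[_ _ /eqP ->].
rewrite big1// => h /andP[kg _].
by move: gk; rewrite eqn_leq gk' kg.
Qed.

End Combinatorics.

Section Garsia.
Variable R : realType.

(* Garsia's inequality: by AM-GM, [q k <= t * p k / (2 Sq k.+1) + Sq k.+1 * b k / (2 t)],
   where [p k / (2 Sq k.+1) <= Sq k.+1 - Sq k]; then sum by parts. *)
Lemma garsia_pointwise (n : nat) (p b q Sq : nat -> R) (t : R) : 0 < t ->
  (forall k, 0 <= p k) -> (forall k, 0 <= b k) ->
  (forall k, q k <= Num.sqrt (p k) * Num.sqrt (b k)) ->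
  (forall k, Sq k = Num.sqrt (\sum_(j < k) p j)) ->
  \sum_(k < n) q k <=
  \sum_(i < n) (Sq i.+1 - Sq i) * (t + (2 * t)^-1 * \sum_(i <= k < n) b k).
Proof.
move=> t0 p0 b0 qpb SqD.
have sum0 k : 0 <= \sum_(j < k) p j by exact: sumr_ge0.
have Sq0 k : 0 <= Sq k by rewrite SqD sqrtr_ge0.
have SqE k : Sq k ^+ 2 = \sum_(j < k) p j by rewrite SqD sqr_sqrtr.
have SqS k : Sq k.+1 ^+ 2 = Sq k ^+ 2 + p k by rewrite !SqE big_ord_recr.
have Sqmono k : Sq k <= Sq k.+1.
  by rewrite -ler_sqr ?nnegrE// SqS lerDl.
have step k : q k <= t * (Sq k.+1 - Sq k) + (2 * t)^-1 * (Sq k.+1 * b k).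
  apply: le_trans (qpb k) _.
  have [u0 uE] : 0 <= Num.sqrt (p k) /\ Num.sqrt (p k) ^+ 2 = p k.
    by rewrite sqrtr_ge0 sqr_sqrtr.
  have [v0 vE] : 0 <= Num.sqrt (b k) /\ Num.sqrt (b k) ^+ 2 = b k.
    by rewrite sqrtr_ge0 sqr_sqrtr.
  move: (Num.sqrt (p k)) (Num.sqrt (b k)) u0 uE v0 vE => u v u0 uE v0 vE.
  have := SqS k; have := Sqmono k; have := Sq0 k; have := Sq0 k.+1.
  move: (Sq k) (Sq k.+1) => s s' s'0 s0 ss'; rewrite -uE -vE => E.
  have [s'00|s'n0] := eqVneq s' 0.
    have u00 : u = 0.
      by apply/eqP; rewrite -sqrf_eq0; apply/eqP; move: E; rewrite s'00; nra.
    have -> : s = 0 by apply/le_anti; rewrite s0 -s'00 ss'.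
    by rewrite u00 s'00 !(mul0r, mulr0, subr0, addr0).
  have s'p : 0 < s' by rewrite lt_neqAle eq_sym s'n0.
  rewrite -(ler_pM2l (mulr_gt0 (mulr_gt0 (ltr0Sn R 1) t0) s'p)).
  rewrite (_ : 2 * t * s' * (t * (s' - s) + (2 * t)^-1 * (s' * v ^+ 2)) =
     2 * t ^+ 2 * s' * (s' - s) + (s' * v) ^+ 2); last by field; rewrite gt_eqF.
  have h1 : u ^+ 2 <= 2 * s' * (s' - s) by nra.
  have h2 : t ^+ 2 * u ^+ 2 <= t ^+ 2 * (2 * s' * (s' - s)) by rewrite ler_wpM2l// sqr_ge0.
  have h3 : 0 <= (t * u - s' * v) ^+ 2 by exact: sqr_ge0.
  nra.
apply: le_trans (ler_sum _ (fun k _ => step (nat_of_ord k))) _.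
have E : \sum_(k < n) Sq k.+1 * b k =
    \sum_(i < n) (Sq i.+1 - Sq i) * \sum_(i <= k < n) b k.
  rewrite [RHS](eq_bigr (fun i : 'I_n => \sum_(i <= k < n) (Sq i.+1 - Sq i) * b k)); last first.
    by move=> i _; rewrite mulr_sumr.
  rewrite -(big_mkord xpredT (fun i => \sum_(i <= k < n) (Sq i.+1 - Sq i) * b k)).
  rewrite -(big_mkord xpredT (fun k => Sq k.+1 * b k)).
  rewrite [RHS](eq_bigr (fun i =>
      \sum_(0 <= k < n | (i <= k)%N) (Sq i.+1 - Sq i) * b k)); last first.
    by move=> i _; rewrite (big_nat_widenl i 0)//.
  rewrite [RHS](exchange_big_dep_nat xpredT)//=.
  rewrite big_nat [RHS]big_nat; apply: eq_bigr => k /andP[_ kn].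
  rewrite -mulr_suml; congr (_ * _).
  rewrite (_ : \sum_(0 <= i < n | _) _ = \sum_(0 <= i < k.+1) (Sq i.+1 - Sq i)).
    by rewrite telescope_sumr// [Sq 0%N]SqD big_ord0 sqrtr0 subr0.
  rewrite (big_cat_nat (n := k.+1))//= [X in _ + X]big1_seq ?addr0.
    rewrite big_nat_cond [RHS]big_nat_cond; apply: eq_bigl => i.
    by rewrite andbT; case: (boolP (0 <= i < k.+1)%N) => //= /andP[_]; rewrite ltnS => ->; rewrite kn.
  move=> i /andP[ik]; rewrite mem_index_iota => /andP[ki _].
  by move: ki; rewrite ltnNge ik.
rewrite big_split/= -(mulr_sumr (index_enum 'I_n) _ (fun k : 'I_n => Sq k.+1 * b k)) E.
rewrite mulr_sumr -big_split/=; apply: ler_sum => i _.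
by rewrite [leRHS]mulrDr [X in _ <= X + _]mulrC lerD2l mulrCA.
Qed.

End Garsia.

(** * Martingale differences and Fourier coefficients *)

Section MartingaleDifferences.
Variables (R : realType) (G : topologicalZmodType) (S : choiceType).
Local Notation XX := (power_space G).
Variables (mu : probability (borel G) R) (P : probability XX R).
Hypothesis haarmu : is_haar mu.
Hypothesis PP : is_power_measure mu P.
Variable f : XX -> S -> R[i].
Hypothesis fL : vL1 P measurable f.
Local Notation D := (martingale_diff P (@filtration G) f).

Let E_coord k s : cintegrable P (fun x => condexp P (filtration k) f x s).
Proof. by have [/vL1_filtration[h _] _] := condexpP PP k fL; exact: vL1_coord. Qed.

Let E_trunc k x : condexp P (filtration k) f (trunc k x) = condexp P (filtration k) f x.
Proof. by have [/vL1_filtration[_ h] _] := condexpP PP k fL; exact: h. Qed.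

Lemma mdiff_cintegrable k s : cintegrable P (fun x => D k x s).
Proof.
case: k => [|k] /=.
  by split; exact: rintegrable_cst.
have := cintegrableD (E_coord k.+1 s) (cintegrableZ (-1) (E_coord k s)).
by congr cintegrable; apply/funext => x; rewrite mulN1r.
Qed.

(** True at every point, because the chosen conditional expectations are literally measurable for
    their sigma-algebras; [weighted_orth] asks this of its weight. *)
Lemma mdiff_trunc k l x : (k <= l)%N -> D k (trunc l x) = D k x.
Proof.
case: k => [//|k] kl /=; have kl' := ltnW kl.
rewrite -E_trunc trunc_trunc// E_trunc; congr (_ - _).
by rewrite -E_trunc trunc_trunc// E_trunc.
Qed.

(** Against a character of level [k.+1], E_{k+1} f has the same coefficient as [f], and that of E_k
    f is zero by orthogonality. At level [0] the difference is the mean of [f]. *)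
Lemma fourier_mdiff g s :
  fourier P f g s = cint P (fun x => D (top g) x s * (character_of g x)^*%C).
Proof.
rewrite -[LHS]/(cint P (fun x => f x s * (character_of g x)^*%C)).
have wm : cmeasurable (fun x : XX => (character_of g x)^*%C).
  exact/cmeasurable_conj/cmeasurable_character.
have w1 (x : XX) : normc (character_of g x)^*%C <= 1.
  by rewrite normc_conj normc_character.
have wt (k : nat) (x : XX) : dual_head k g ->
    (character_of g (trunc k x))^*%C = (character_of g x)^*%C.
  by move=> gk; rewrite character_trunc.
have intw u : cintegrable P u -> cintegrable P (fun x => u x * (character_of g x)^*%C).
  move=> ui; have := cintegrableMb wm ui w1; congr cintegrable.
  by apply/funext => x; rewrite mulrC.
have gtop := @top_head _ _ g.
case gk : (top g) gtop => [|k] gtop /=.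
  have ch1 (x : XX) : (character_of g x)^*%C = 1.
    by rewrite (character_ofE x gtop) big_ord0 conjc1.
  transitivity (cint P (fun x => f x s)).
    by apply: eq_cint => x; rewrite ch1 mulr1.
  rewrite -[RHS](@eq_cint _ _ _ _ (fun=> vintegral P setT f s)); last first.
    by move=> x; rewrite ch1 mulr1.
  by rewrite cint_cst.
transitivity (cint P (fun x => (character_of g x)^*%C * condexp P (filtration k.+1) f x s)).
  rewrite (cint_condexpM PP s fL wm w1 (fun x => wt _ x gtop)).
  by apply: eq_cint => x; rewrite mulrC.
have E0 : cint P (fun x => condexp P (filtration k) f x s * (character_of g x)^*%C) = 0.
  under eq_cint do rewrite -characterN.
  apply: (cint_character_orth haarmu PP (k := k)) => //.
    by move=> x; rewrite E_trunc.
  move=> gk'; have : dual_head k g.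
    by move=> j /gk' /eqP; rewrite -[(- g) j]/(- (g j)) oppr_eq0 => /eqP.
  by move=> /dual_headP; rewrite gk ltnn.
rewrite -[LHS]addr0 -[X in _ + X](mulr0 (-1)) -E0 -cintZ; last exact: intw.
rewrite -cintD.
- apply: eq_cint => x; rewrite mulN1r -mulNr [_ * condexp _ _ _ _ _]mulrC -mulrDl.
  by [].
- have := intw _ (E_coord k.+1 s); congr cintegrable; apply/funext => x.
  by rewrite mulrC.
- by apply: cintegrableZ; exact: intw.
Qed.

End MartingaleDifferences.

Section WeightedOrthogonality.
Variables (R : realType) (G : topologicalZmodType).
Local Notation XX := (power_space G).
Variables (mu : probability (borel G) R) (P : probability XX R).
Hypothesis haarmu : is_haar mu.
Hypothesis PP : is_power_measure mu P.

Lemma rintegrable_sqr_normc (th : XX -> R) (v : XX -> R[i]) (K : R) :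
  rintegrable P th -> cmeasurable v -> (forall x, normc (v x) <= K) ->
  rintegrable P (fun x => th x * normc (v x) ^+ 2).
Proof.
move=> thi vm vK; apply: (rintegrable_le (g := fun x => K ^+ 2 * `|th x|)).
- apply: measurable_funM; first exact: rintegrable_measurable thi.
  exact: measurable_sqr_normc.
- by apply: rintegrableZ; have := integrable_norm thi.
- move=> x; rewrite normrM mulrC ler_wpM2r// ger0_norm ?sqr_ge0//.
  have K0 : 0 <= K by apply: le_trans (vK x); exact: normc_ge0.
  by rewrite ler_sqr ?nnegrE ?normc_ge0.
Qed.

Lemma normc_charsum_le (I : Type) (Z : seq I) (p : pred I) (a : I -> R[i])
    (g : I -> dualsum R G) x :
  normc (\sum_(i <- Z | p i) a i * character_of (g i) x) <= \sum_(i <- Z | p i) normc (a i).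
Proof.
apply: le_trans (le_normc_sum _ _ _) _; apply: ler_sum => i _.
by rewrite normcM normc_character mulr1.
Qed.

Lemma cmeasurable_charsum (I : Type) (Z : seq I) (p : pred I) (a : I -> R[i])
    (g : I -> dualsum R G) :
  cmeasurable (fun x : XX => \sum_(i <- Z | p i) a i * character_of (g i) x).
Proof.
apply: cmeasurable_sum => i; apply: cmeasurableM; first exact: cmeasurable_cst.
exact: cmeasurable_character.
Qed.

(* Characters in distinct cosets of [Γ^k] are orthogonal for a weight depending
   on the first [k] coordinates only. *)
Lemma weighted_orth k (th : XX -> R) (Z : seq (dualsum R G)) (p : pred (dualsum R G))
    (a : dualsum R G -> R[i]) (l : dualsum R G -> R) :
  rintegrable P th -> (forall x, 0 <= th x) -> (forall x, th (trunc k x) = th x) ->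
  (forall g, normc (a g) <= l g) ->
  \int[P]_x (th x * normc (\sum_(g <- Z | p g) a g * character_of g x) ^+ 2) <=
  (\sum_(g <- Z | p g) \sum_(h <- Z | p h && (tail_proj k g == tail_proj k h)) l g * l h) *
  \int[P]_x th x.
Proof.
move=> thi th0 tht al.
have l0 g : 0 <= l g by apply: le_trans (al g); exact: normc_ge0.
pose I0 := \int[P]_x th x.
have thC := cintegrable_real thi.
have thch g : cintegrable P (fun x => ((th x)%:C)%C * character_of g x).
  exact: cintegrableM_character.
have E x : ((th x * normc (\sum_(g <- Z | p g) a g * character_of g x) ^+ 2)%:C)%C =
   \sum_(g <- Z | p g) \sum_(h <- Z | p h) (a g * (a h)^*%C) *
     (((th x)%:C)%C * character_of (g - h) x).
  rewrite rmorphM/= -mulc_conj (rmorph_sum (@conjc R)) mulr_suml mulr_sumr.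
  apply: eq_bigr => g _; rewrite mulr_sumr mulr_sumr; apply: eq_bigr => h _.
  by rewrite characterB rmorphM/=; ring.
rewrite -[leLHS]Re_real -cint_real; under eq_cint do rewrite E.
rewrite cint_sum; last first.
  by move=> g; apply: cintegrable_sum => h; exact: cintegrableZ.
rewrite Re_sum mulr_suml; apply: ler_sum => g _.
rewrite cint_sum; last by move=> h; exact: cintegrableZ.
rewrite Re_sum mulr_suml [leRHS]big_mkcondr/=; apply: ler_sum => h _.
apply: (@le_trans _ _ (Re ((a g * (a h)^*%C) *
    cint P (fun x => ((th x)%:C)%C * character_of (g - h) x)))).
  by rewrite -cintZ.
apply: le_trans (Re_le_normc _) _; rewrite normcM.
case: eqVneq => [gh|gh].
  apply: ler_pM; rewrite ?normc_ge0//; last exact: normc_cint_character_le.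
  by rewrite normcM normc_conj; apply: ler_pM; rewrite ?normc_ge0.
rewrite (cint_character_orth haarmu PP (k := k))// ?normc0 ?mulr0//.
  by move=> x; rewrite tht.
by move=> /tail_proj_eq/eqP; rewrite (negbTE gh).
Qed.

End WeightedOrthogonality.

Lemma conjc_sum (R : realType) I (r : seq I) (p : pred I) (F : I -> R[i]) :
  (\sum_(i <- r | p i) F i)^*%C = \sum_(i <- r | p i) (F i)^*%C.
Proof. exact: (rmorph_sum (@conjc R)). Qed.

Lemma sqrt_sum_sqr_le (R : realType) (I : Type) (r : seq I) (a : I -> R) :
  (forall i, 0 <= a i) -> Num.sqrt (\sum_(i <- r) a i ^+ 2) <= \sum_(i <- r) a i.
Proof.
move=> a0; have s0 : 0 <= \sum_(i <- r) a i by exact: sumr_ge0.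
rewrite -(ger0_norm s0) -sqrtr_sqr ler_sqrt ?sqr_ge0//.
elim: r {s0} => [|i r IH]; first by rewrite !big_nil expr0n.
rewrite !big_cons sqrrD -addrA lerD2l; apply: le_trans IH _.
by rewrite lerDr mulrn_wge0// mulr_ge0// sumr_ge0.
Qed.

(** The integral of a nonnegative function is a supremum over simple functions below it, hence
    monotone for arbitrary functions; this serves the integrand of [H1norm], whose measurability is
    nowhere established. *)
Lemma ge0_integral_mono d (T : measurableType d) (R : realType)
    (P : {measure set T -> \bar R}) (f g : T -> \bar R) :
  (forall x, 0 <= f x)%E -> (forall x, f x <= g x)%E ->
  (\int[P]_x f x <= \int[P]_x g x)%E.
Proof.
move=> f0 fg; have g0 x : (0 <= g x)%E by apply: le_trans (fg x).
rewrite !ge0_integralTE//; apply: le_ereal_sup => _ [h hf <-].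
by exists h => // x; apply: le_trans (hf x) (fg x).
Qed.

(** * The bound for finitely many coefficients *)

Section UpperBound.
Variables (R : realType) (G : topologicalZmodType) (S : choiceType).
Local Notation XX := (power_space G).
Variables (mu : probability (borel G) R) (P : probability XX R).
Hypothesis haarmu : is_haar mu.
Hypothesis PP : is_power_measure mu P.
Variable lambda : dualsum R G -> S -> R.
Hypothesis lambda0 : forall g s, 0 <= lambda g s.
Variable Q : R.
Hypothesis Q0 : 0 < Q.
Hypothesis QAB : forall k, (QA lambda k + QB lambda k <= (Q ^+ 2)%:E)%E.
Variable f : XX -> S -> R[i].
Hypothesis fL : vL1 P measurable f.
Local Notation D := (martingale_diff P (@filtration G) f).

Variables (Y : seq (dualsum R G)) (J : seq S).
Hypotheses (uY : uniq Y) (uJ : uniq J).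

Let n := (\max_(g <- Y) top g).+1.

Let top_lt g : g \in Y -> (top g < n)%N.
Proof. by move=> gY; rewrite ltnS; apply: leq_bigmax_seq. Qed.

Let c g s : R[i] := projT1 (cid (phase_ex (fourier P f g s))).

Let c_le1 g s : normc (c g s) <= 1.
Proof. by rewrite /c; case: cid => w []. Qed.

Let cE g s : c g s * fourier P f g s = ((normc (fourier P f g s))%:C)%C.
Proof. by rewrite /c; case: cid => w []. Qed.

(** The test polynomial is paired with [f] through its conjugate, which restores [c g s]; the
    product with the Fourier coefficient is then [lambda g s] times a modulus. *)
Let a g s : R[i] := ((lambda g s)%:C)%C * (c g s)^*%C.

Let a_le g s : normc (a g s) <= lambda g s.
Proof.
by rewrite normcM normc_real ger0_norm// normc_conj ler_piMr.
Qed.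

Let v k s (x : XX) : R[i] := \sum_(g <- Y | top g == k) a g s * character_of g x.

Let v_cmeasurable k s : cmeasurable (v k s).
Proof. exact: cmeasurable_charsum. Qed.

Let vK k s x : normc (v k s x) <= \sum_(g <- Y | top g == k) normc (a g s).
Proof. exact: normc_charsum_le. Qed.

Let Dv_cintegrable k s : cintegrable P (fun x => D k x s * (v k s x)^*%C).
Proof.
have vcK x : normc (v k s x)^*%C <= \sum_(g <- Y | top g == k) normc (a g s).
  by rewrite normc_conj.
have := cintegrableMb (cmeasurable_conj (v_cmeasurable k s)) (mdiff_cintegrable PP fL k s) vcK.
by congr cintegrable; apply/funext => x; rewrite mulrC.
Qed.

Let cint_Dv k s : cint P (fun x => D k x s * (v k s x)^*%C) =
  ((\sum_(g <- Y | top g == k) lambda g s * normc (fourier P f g s))%:C)%C.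
Proof.
have Dch g : cintegrable P (fun x => D k x s * (character_of g x)^*%C).
  have := cintegrableM_character (- g) (mdiff_cintegrable PP fL k s).
  by congr cintegrable; apply/funext => x; rewrite characterN.
transitivity (cint P (fun x => \sum_(g <- Y | top g == k)
    (((lambda g s)%:C)%C * c g s) * (D k x s * (character_of g x)^*%C))).
  apply: eq_cint => x; rewrite /v conjc_sum mulr_sumr.
  apply: eq_bigr => g _; rewrite /a !conjcM conjc_real conjcK; ring.
rewrite cint_sum; last by move=> g; exact: cintegrableZ.
rewrite rmorph_sum; apply: eq_bigr => g /eqP gk.
transitivity ((((lambda g s)%:C)%C * c g s) * fourier P f g s).
  by rewrite (fourier_mdiff haarmu PP fL) gk -cintZ.
by rewrite -mulrA cE rmorphM.
Qed.

Let q k x : R := \sum_(s <- J) Re (D k x s * (v k s x)^*%C).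
Let p k x : R := \sum_(s <- J) normc (D k x s) ^+ 2.
Let b k x : R := \sum_(s <- J) normc (v k s x) ^+ 2.
Let Sq k x : R := Num.sqrt (\sum_(j < k) p j x).
Let th i x : R := Sq i.+1 x - Sq i x.

Let q_rintegrable k : rintegrable P (q k).
Proof. by apply: rintegrable_sum => s; case: (Dv_cintegrable k s). Qed.

Let q_integral : \int[P]_x (\sum_(k < n) q k x) =
  \sum_(s <- J) \sum_(g <- Y) lambda g s * normc (fourier P f g s).
Proof.
rewrite Rint_sum; last by move=> k; exact: q_rintegrable.
transitivity (\sum_(k < n) \sum_(s <- J) \sum_(g <- Y | top g == k)
    lambda g s * normc (fourier P f g s)).
  apply: eq_bigr => k _; rewrite Rint_sum; last first.
    by move=> s; case: (Dv_cintegrable k s).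
  apply: eq_bigr => s _.
  by rewrite -[LHS]/(Re (cint P (fun x => D k x s * (v k s x)^*%C))) cint_Dv.
rewrite exchange_big/=; apply: eq_bigr => s _.
rewrite (exchange_big_dep xpredT)//= big_seq [RHS]big_seq; apply: eq_bigr => g gY.
by rewrite (big_pred1 (Ordinal (top_lt gY))).
Qed.

Let p0 k x : 0 <= p k x.
Proof. by apply: sumr_ge0 => s _; exact: sqr_ge0. Qed.

Let b0 k x : 0 <= b k x.
Proof. by apply: sumr_ge0 => s _; exact: sqr_ge0. Qed.

Let qpb k x : q k x <= Num.sqrt (p k x) * Num.sqrt (b k x).
Proof.
apply: (@le_trans _ _ (\sum_(s <- J) normc (D k x s) * normc (v k s x))).
  apply: ler_sum => s _; apply: le_trans (Re_le_normc _) _.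
  by rewrite normcM normc_conj.
by apply: sum_mul_le; rewrite ?sqrtr_ge0 ?sqr_sqrtr.
Qed.

Let Sq_mono k x : Sq k x <= Sq k.+1 x.
Proof.
rewrite ler_sqrt; last by apply: sumr_ge0.
by rewrite big_ord_recr/= lerDl.
Qed.

Let th0 i x : 0 <= th i x. Proof. by rewrite subr_ge0. Qed.

Let Sq_rintegrable k : rintegrable P (Sq k).
Proof.
apply: (rintegrable_le (g := fun x => \sum_(j < k) \sum_(s <- J) normc (D j x s))).
- apply: (measurableT_comp (@measurable_sqrt R)).
  apply: measurable_sum => j; apply: measurable_sum => s.
  apply: measurable_sqr_normc; apply: cintegrable_cmeasurable.
  exact: (mdiff_cintegrable PP fL j s).
- apply: rintegrable_sum => j; apply: rintegrable_sum => s.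
  apply: cintegrable_norm; exact: (mdiff_cintegrable PP fL j s).
- move=> x; rewrite ger0_norm ?sqrtr_ge0// /Sq /p.
  rewrite (eq_bigr (fun j : 'I_k => Num.sqrt (p j x) ^+ 2)); last first.
    by move=> j _; rewrite sqr_sqrtr.
  apply: le_trans (sqrt_sum_sqr_le _ _) _; first by move=> j; exact: sqrtr_ge0.
  apply: ler_sum => j _; apply: sqrt_sum_sqr_le => s; exact: normc_ge0.
Qed.

Let th_rintegrable i : rintegrable P (th i).
Proof.
have := rintegrableD (Sq_rintegrable i.+1) (rintegrableZ (-1) (Sq_rintegrable i)).
by congr rintegrable; apply/funext => x; rewrite mulN1r.
Qed.

(** [th i] involves the differences of index at most [i], hence only the first [i] coordinates; so
    characters in distinct cosets of Γ^i are orthogonal for it. *)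
Let th_trunc i x : th i (trunc i x) = th i x.
Proof.
have SqT k : (k <= i.+1)%N -> Sq k (trunc i x) = Sq k x.
  move=> ki; congr Num.sqrt; apply: eq_bigr => j _; apply: eq_bigr => s _.
  rewrite (mdiff_trunc PP fL)//; have := ltn_ord j => jk.
  by rewrite -ltnS; exact: leq_trans jk ki.
by rewrite /th !SqT.
Qed.

Let thb_rintegrable i k : rintegrable P (fun x => th i x * b k x).
Proof.
have := rintegrable_sum J xpredT (fun s => rintegrable_sqr_normc (th_rintegrable i)
  (v_cmeasurable k s) (vK k s)).
by congr rintegrable; apply/funext => x; rewrite /b mulr_sumr.
Qed.

(** Orthogonality is applied level by level. A pair of characters of one coset and of equal level
    occurs for that level only, so the sum over [k >= i] collects the pairs of [pair_sum_le]. *)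
Let thb_integral i : \sum_(i <= k < n) \int[P]_x (th i x * b k x) <=
  Q ^+ 2 * \int[P]_x th i x.
Proof.
pose I0 := \int[P]_x th i x.
have I00 : 0 <= I0 by apply: Rintegral_ge0.
apply: (@le_trans _ _ (\sum_(i <= k < n) (\sum_(s <- J)
  \sum_(g <- Y | top g == k) \sum_(h <- Y | (top h == k) && (tail_proj i g == tail_proj i h))
    lambda g s * lambda h s) * I0)).
  apply: ler_sum => k _.
  have -> : \int[P]_x (th i x * b k x) =
      \sum_(s <- J) \int[P]_x (th i x * normc (v k s x) ^+ 2).
    rewrite -Rint_sum; last first.
      by move=> s; exact: rintegrable_sqr_normc (th_rintegrable i) (v_cmeasurable k s) (vK k s).
    by apply: eq_Rintegral => x _; rewrite /b mulr_sumr.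
  rewrite mulr_suml; apply: ler_sum => s _.
  exact: (weighted_orth haarmu PP Y (fun g => top g == k) (th_rintegrable i) (th0 i) (th_trunc i) (fun g => a_le g s)).
rewrite -mulr_suml ler_wpM2r// exchange_big/=.
rewrite -lee_fin; apply: le_trans (QAB i); apply: le_trans (pair_sum_le lambda0 i uY uJ).
rewrite lee_fin; apply: ler_sum => s _.
rewrite (exchange_big_dep xpredT)//=; rewrite big_seq [leRHS]big_seq.
apply: ler_sum => g gY.
rewrite (exchange_big_dep (fun h => (top g == top h) && (tail_proj i g == tail_proj i h)))/=; last first.
  by move=> k h /eqP <- /andP[/eqP -> ->]; rewrite eqxx.
have l0 h : 0 <= lambda g s * lambda h s by exact: mulr_ge0.
rewrite big_mkcond [leRHS]big_mkcond/=; apply: ler_sum => h _.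
have [igk|igk] := leqP i (top g); last first.
  case: ifP => // /andP[/eqP gh ->]; rewrite big_nat_cond big1 ?if_same//.
  by move=> k /andP[/andP[ik _] /andP[/eqP gk _]]; move: igk; rewrite gk ltnNge ik.
case: ifP => // /andP[/eqP gh tgh].
rewrite (eq_bigl (fun k => k == top g)); last first.
  by move=> k; rewrite -gh tgh andbT andbb eq_sym.
rewrite -big_filter filter_pred1_uniq ?iota_uniq ?mem_index_iota ?igk ?top_lt//.
by rewrite big_seq1.
Qed.

Lemma partial_upper_bound :
  ((\sum_(s <- J) \sum_(g <- Y) lambda g s * normc (fourier P f g s))%:E <=
   (2 * Q)%:E * H1norm P (@filtration G) f)%E.
Proof.
(* Dropping the coordinates outside [J] and the levels from [n] on can only decrease the square
   function. *)
have SqH : ((\int[P]_x Sq n x)%:E <= H1norm P (@filtration G) f)%E.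
  rewrite /Rintegral fineK; last exact: integrable_fin_num (Sq_rintegrable n).
  apply: ge0_integral_mono => x; first by rewrite lee_fin sqrtr_ge0.
  have -> : (Sq n x)%:E = sqrte (\sum_(j < n) p j x)%:E by [].
  rewrite lee_sqrt; last by apply: nneseries_ge0 => k _ _; rewrite expe2 mule_ge0// l2norm_ge0.
  rewrite -sumEFin -(big_mkord xpredT (fun j => (p j x)%:E)).
  apply: (@le_trans _ _ (\sum_(0 <= k < n) l2norm (D k x) ^+ 2)%E).
    by apply: lee_sum => k _; exact: sum_le_l2norm.
  apply: nneseries_lim_ge => k _ _; by rewrite expe2 mule_ge0// l2norm_ge0.
rewrite -q_integral.
have Spos : 0 <= \int[P]_x Sq n x by apply: Rintegral_ge0 => x _; exact: sqrtr_ge0.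
apply: (@le_trans _ _ ((2 * Q) * \int[P]_x Sq n x)%:E); last first.
  by rewrite EFinM lee_wpmul2l// lee_fin mulr_ge0// ltW.
rewrite lee_fin.
(* Garsia's bound with [t = Q], multiplied out: as the sum over [k] costs [Q ^+ 2], both terms
   become multiples of [Q]. *)
pose rhs (i : 'I_n) x := Q * th i x + (2 * Q)^-1 * \sum_(i <= k < n) th i x * b k x.
have rhs_int i : rintegrable P (rhs i).
  apply: rintegrableD; first exact: rintegrableZ.
  by apply: rintegrableZ; apply: rintegrable_sum => k; exact: thb_rintegrable.
apply: (@le_trans _ _ (\int[P]_x \sum_(i < n) rhs i x)).
  apply: le_Rintegral => //.
  - by apply: rintegrable_sum => k; exact: q_rintegrable.
  - by apply: rintegrable_sum.
  move=> x _.
  apply: le_trans (garsia_pointwise n Q0 (fun k => p0 k x) (fun k => b0 k x)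
    (fun k => qpb k x) (fun k => erefl)) _.
  rewrite le_eqVlt; apply/orP; left; apply/eqP; apply: eq_bigr => i _.
  by rewrite /rhs mulrDr [_ * Q]mulrC -mulr_sumr mulrCA.
rewrite Rint_sum//.
have -> : \int[P]_x Sq n x = \sum_(i < n) \int[P]_x th i x.
  rewrite -Rint_sum//; apply: eq_Rintegral => x _.
  rewrite -(big_mkord xpredT (fun i => th i x)) telescope_sumr//.
  by rewrite /Sq big_ord0 sqrtr0 subr0.
rewrite mulr_sumr; apply: ler_sum => i _.
have thi : rintegrable P (th i) by exact: th_rintegrable.
rewrite RintegralD//; last 2 first.
- exact: rintegrableZ.
- by apply: rintegrableZ; apply: rintegrable_sum => k; exact: thb_rintegrable.
rewrite !RintegralZl//; last first.
  by apply: rintegrable_sum => k; exact: thb_rintegrable.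
rewrite Rint_sum; last by move=> k; exact: thb_rintegrable.
have I00 : 0 <= \int[P]_x th i x by apply: Rintegral_ge0.
(* The second term is [Q / 2] times the integral of [th i]; the total factor [3 * Q / 2] is rounded
   up to [2 * Q]. *)
apply: (@le_trans _ _ (Q * (\int[P]_x th i x) + (2 * Q)^-1 * (Q ^+ 2 * \int[P]_x th i x))).
  by rewrite lerD2l ler_wpM2l// invr_ge0 mulr_ge0// ltW.
have -> : (2 * Q)^-1 * (Q ^+ 2 * \int[P]_x th i x) = Q / 2 * \int[P]_x th i x.
  by field; rewrite gt_eqF.
by rewrite -mulrDl ler_wpM2r// mulr_natl mulr2n lerD2l ler_pdivrMr// ler_peMr ?(ltW Q0)// lerDl ler01.
Qed.

End UpperBound.

(** * From finite sums to the multiplier norm *)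

Section UpperAssembly.
Variables (R : realType) (G : topologicalZmodType) (S : choiceType).
Local Notation XX := (power_space G).
Variables (mu : probability (borel G) R) (P : probability XX R).
Hypothesis haarmu : is_haar mu.
Hypothesis PP : is_power_measure mu P.
Variable lambda : dualsum R G -> S -> R.
Hypothesis lambda0 : forall g s, 0 <= lambda g s.

Lemma QA_ge0 k : (0 <= QA lambda k)%E.
Proof.
by apply: esum_ge0 => g _; apply: esum_ge0 => s _; rewrite expe2 mule_ge0 // esum_ge0// => h _;
  rewrite lee_fin.
Qed.

Lemma QB_ge0 k : (0 <= QB lambda k)%E.
Proof.
by apply: esum_ge0 => s _; rewrite expe2 mule_ge0 // esum_ge0// => h _; rewrite lee_fin.
Qed.

Lemma Qnorm_sqr_bound (Q : R) k : (Qnorm lambda <= Q%:E)%E ->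
  (QA lambda k + QB lambda k <= (Q ^+ 2)%:E)%E.
Proof.
move=> QnQ; have h : (sqrte (QA lambda k) + sqrte (QB lambda k) <= Q%:E)%E.
  by apply: le_trans QnQ; apply: leeD; apply: ereal_sup_ubound; exists k.
rewrite -(sqr_sqrte (QA_ge0 k)) -(sqr_sqrte (QB_ge0 k)).
move: h; have := sqrte_ge0 (QA lambda k); have := sqrte_ge0 (QB lambda k).
case: (sqrte (QA lambda k)) => [x| |]//; case: (sqrte (QB lambda k)) => [y| |]//.
rewrite -!EFin_expe -!EFinD !lee_fin => y0 x0 xy.
apply: (@le_trans _ _ ((x + y) ^+ 2)).
  by rewrite sqrrD lerD2r lerDl mulrn_wge0// mulr_ge0.
by rewrite ler_sqr ?nnegrE// ?addr_ge0// (le_trans _ xy)// addr_ge0.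
Qed.

Lemma multiplier_norm_le (Q : R) : 0 < Q -> (Qnorm lambda <= Q%:E)%E ->
  (multiplier_norm P lambda <= (2 * Q)%:E)%E.
Proof.
move=> Q0 QnQ; apply: ereal_inf_lbound; split.
  by rewrite lee_fin mulr_ge0// ltW.
move=> f [fL _]; apply: esum_le => X uX _.
(* The finite set of pairs is enlarged to a product of finite sets; the terms are nonnegative. *)
pose Y := undup (map fst X); pose J := undup (map snd X).
pose F (p : dualsum R G * S) := lambda p.1 p.2 * normc (fourier P f p.1 p.2).
rewrite sumEFin.
have uY : uniq Y by exact: undup_uniq.
have uJ : uniq J by exact: undup_uniq.
apply: le_trans (partial_upper_bound haarmu PP lambda0 Q0
  (fun k => Qnorm_sqr_bound k QnQ) fL uY uJ).
rewrite lee_fin exchange_big/=.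
have -> : \sum_(g <- Y) \sum_(s <- J) lambda g s * normc (fourier P f g s) =
    \sum_(p <- [seq (g, s) | g <- Y, s <- J]) F p by rewrite big_allpairs.
apply: (@ler_sum_uniq_subset _ _ X _ F) => //.
- by apply: allpairs_uniq => // -[? ?] [? ?].
- move=> [g s] gsX; apply/allpairsP; exists (g, s); split=> //=;
    rewrite mem_undup; apply/mapP; by exists (g, s).
- by move=> p; rewrite mulr_ge0// normc_ge0.
Qed.

Lemma multiplier_norm_le_Qnorm : (multiplier_norm P lambda <= (2%R : R)%:E * Qnorm lambda)%E.
Proof.
have Qn0 : (0 <= Qnorm lambda)%E.
  apply: adde_ge0.
    by apply: (le_trans (sqrte_ge0 (QA lambda 0))); apply: ereal_sup_ubound; exists 0.
  by apply: (le_trans (sqrte_ge0 (QB lambda 0))); apply: ereal_sup_ubound; exists 0.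
case QE : (Qnorm lambda) Qn0 => [q| |]// q0; last by rewrite gt0_muley ?lte_fin// leey.
(* [Qnorm] may vanish while Garsia's argument divides by [Q]: a margin [e / 2] is added, which the
   factor 2 turns into [e]. *)
apply/lee_addgt0Pr => e e0.
have q1 : 0 < q + e / 2 by rewrite ltr_wpDl// divr_gt0.
apply: le_trans (multiplier_norm_le q1 _) _.
  by rewrite QE lee_fin lerDl divr_ge0// ltW.
by rewrite -EFinM -EFinD lee_fin mulrDr [2 * (e / 2)]mulrC divfK.
Qed.

End UpperAssembly.

(** * The lower bound *)

(** Raising [g] to infinity on the exceptional null set makes the inequality hold everywhere without
    changing the integral of [g]. In the applications [f] is the integrand of [H1norm], where
    martingale differences are identified almost everywhere only. *)
Lemma ae_le_integral d (T : measurableType d) (R : realType)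
    (P : {measure set T -> \bar R}) (f g : T -> \bar R) :
  (forall x, 0 <= f x)%E -> (forall x, 0 <= g x)%E -> measurable_fun setT g ->
  {ae P, forall x, (f x <= g x)%E} ->
  (\int[P]_x f x <= \int[P]_x g x)%E.
Proof.
move=> f0 g0 mg [N [mN N0 fgN]].
pose g' x := if x \in N then +oo%E else g x.
have g'0 x : (0 <= g' x)%E by rewrite /g'; case: ifP.
have mg' : measurable_fun setT g'.
  rewrite (_ : g' = fun x => if \1_N x == 1 :> R then +oo%E else g x); last first.
    apply/funext => x; rewrite /g' indicE; case: (x \in N) => /=; rewrite ?eqxx//.
    by rewrite eq_sym oner_eq0.
  apply: measurable_fun_ifT => //.
  apply: (measurable_fun_bool true) => //.
  rewrite setTI (_ : _ @^-1` _ = N)//; apply/seteqP; split=> x /=; rewrite indicE.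
    by case: (boolP (x \in N)) => [/set_mem//|]; rewrite eq_sym oner_eq0.
  by move=> Nx; rewrite mem_set// eqxx.
apply: (@le_trans _ _ (\int[P]_x g' x)%E).
  apply: ge0_integral_mono => // x; rewrite /g'; case: ifP => xN; first exact: leey.
  apply: contrapT => fg; have : N x by apply: fgN.
  by move/mem_set; rewrite xN.
rewrite le_eqVlt; apply/orP; left; apply/eqP; apply: ge0_ae_eq_integral => //.
exists N; split=> // x /= h; apply: contrapT => Nx; apply: h => _.
by rewrite /g' memNset.
Qed.

(** Self-duality of the Euclidean norm, for inner sums over [H] that could a priori be infinite.
    Unit vectors as [al] show that they are finite; then [al] is the vector of inner sums itself,
    with [sg] its norm. *)
Lemma esum_duality (R : realType) (I T : choiceType) (H : set T) (l : T -> I -> R)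
    (X : seq I) (K : R) : uniq X -> 0 <= K -> (forall g i, 0 <= l g i) ->
  (forall (al : I -> R) (sg : R) (Y : seq T), (forall i, 0 <= al i) -> 0 < sg ->
     \sum_(i <- X) al i ^+ 2 <= sg ^+ 2 -> uniq Y -> (forall g, g \in Y -> H g) ->
     \sum_(i <- X) al i * \sum_(g <- Y) l g i <= K * sg) ->
  (\sum_(i <- X) (\esum_(g in H) (l g i)%:E) ^+ 2 <= (K ^+ 2)%:E)%E.
Proof.
move=> uX K0 l0 dual; pose L i := (\esum_(g in H) (l g i)%:E)%E.
have L0 i : (0 <= L i)%E by apply: esum_ge0 => g _; rewrite lee_fin.
have Lfin i : i \in X -> L i \is a fin_num.
  move=> iX; rewrite ge0_fin_numE//; apply: (@le_lt_trans _ _ K%:E); last exact: ltry.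
  apply: esum_le => Y uY YH; rewrite sumEFin lee_fin -[leRHS]mulr1.
  pose al (j : I) : R := (j == i)%:R.
  have E : \sum_(j <- X) al j * \sum_(g <- Y) l g j = \sum_(g <- Y) l g i.
    rewrite (bigD1_seq i)//= /al eqxx mul1r [X in _ + X]big1 ?addr0// => j ji.
    by rewrite (negbTE ji) mul0r.
  rewrite -E; apply: dual => //.
  rewrite (bigD1_seq i)//= /al eqxx [X in _ + X]big1 ?addr0// => j ji.
  by rewrite (negbTE ji) expr0n.
pose al i : R := fine (L i).
have al0 i : 0 <= al i by rewrite fine_ge0.
have LE i : i \in X -> L i = (al i)%:E by move=> /Lfin h; rewrite /al fineK.
have -> : (\sum_(i <- X) L i ^+ 2)%E = (\sum_(i <- X) al i ^+ 2)%:E.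
  rewrite -sumEFin big_seq [RHS]big_seq; apply: eq_bigr => i iX.
  by rewrite LE// -EFin_expe.
have s0 : 0 <= \sum_(i <- X) al i ^+ 2 by apply: sumr_ge0 => i _; exact: sqr_ge0.
pose sg := Num.sqrt (\sum_(i <- X) al i ^+ 2).
have sgE : sg ^+ 2 = \sum_(i <- X) al i ^+ 2 by rewrite sqr_sqrtr.
have sg_ge0 : 0 <= sg by exact: sqrtr_ge0.
rewrite lee_fin -sgE ler_sqr ?nnegrE//.
have [->//|sgn0] := eqVneq sg 0.
have sg0 : 0 < sg by rewrite lt_neqAle eq_sym sgn0.
rewrite -(ler_pM2r sg0) -expr2 sgE -lee_fin -sumEFin.
(* One factor [al i] stays as a weight, the other is written again as a sum over [H], so that one
   finite [Y] serves all [i] at once. *)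
have -> : (\sum_(i <- X) (al i ^+ 2)%:E = \esum_(g in H) \sum_(i <- X) (al i * l g i)%:E)%E.
  rewrite esum_sum; last by move=> g i _ _; rewrite lee_fin mulr_ge0.
  rewrite big_seq [RHS]big_seq; apply: eq_bigr => i iX.
  rewrite expr2 EFinM -{2}[(al i)%:E]LE//.
  apply/le_anti/andP; split.
    rewrite LE//.
    have [ali0|ali] := eqVneq (al i) 0.
      by rewrite ali0 mul0e esum_ge0// => g _; rewrite lee_fin mul0r.
    have alip : 0 < al i by rewrite lt_neqAle eq_sym ali al0.
    rewrite -lee_pdivlMr// -LE// /L; apply: esum_le => Y uY YH.
    rewrite lee_pdivlMr// muleC sumEFin -EFinM mulr_sumr -sumEFin.
    exact: le_sum_esum.
  apply: esum_le => Y uY YH; rewrite sumEFin -mulr_sumr EFinM.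
  by apply: lee_wpmul2l; [rewrite lee_fin|rewrite -sumEFin; exact: le_sum_esum].
apply: esum_le => Y uY YH.
under eq_bigr do rewrite sumEFin.
rewrite sumEFin lee_fin exchange_big/=.
under eq_bigr do rewrite -mulr_sumr.
by apply: dual => //; rewrite sgE.
Qed.

(* [G] pointed at [0]: the library states the finite subcover form of compactness
   for pointed spaces only *)
Definition pointed_group (G : topologicalZmodType) : Type := G.
HB.instance Definition _ (G : topologicalZmodType) := Topological.on (pointed_group G).
HB.instance Definition _ (G : topologicalZmodType) :=
  isPointed.Build (pointed_group G) (0 : G).

(** * Approximate units on the first k coordinates *)

Section ApproximateUnit.
Variables (R : realType) (G : topologicalZmodType).
Local Notation XX := (power_space G).
Variables (mu : probability (borel G) R) (P : probability XX R).
Hypothesis haarmu : is_haar mu.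
Hypothesis PP : is_power_measure mu P.
Hypothesis cG : compact [set: G].

Lemma measurable_open (U : set G) : open U -> measurable (U : set (borel G)).
Proof. by move=> oU; exact: sub_sigma_algebra. Qed.

Lemma translate_continuous (a : G) : continuous (fun x : G => a + x).
Proof.
move=> x; apply: continuous2_cvg; [exact: (@tvs.add_continuous G (a, x))|
  exact: cvg_cst|exact: cvg_id].
Qed.

(** By compactness finitely many translates of [U] cover [G]; if [U] were null, so would be all of
    them. *)
Lemma haar_open_gt0 (U : set G) : open U -> U 0 -> (0 < mu U)%E.
Proof.
move=> oU U0; rewrite lt_neqAle measure_ge0 andbT; apply/negP => /eqP mU0.
pose V (a : G) : set G := (fun x : G => - a + x) @^-1` U.
have oV a : open (V a) by apply: open_comp => // x _; exact: translate_continuous.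
have mV a : mu (V a) = 0%E.
  by rewrite /V haarmu.1 ?mU0//; exact: measurable_open.
have : @compact (pointed_group G) setT by exact: cG.
rewrite compact_cover => /(_ G setT V (fun a _ => oV a)) [].
  by move=> x _; exists x => //; rewrite /V/preimage/= addNr.
move=> D _ cover.
have key (s : seq G) : mu (\big[setU/set0]_(a <- s) V a) = 0%E /\
    measurable (\big[setU/set0]_(a <- s) V a : set (borel G)).
  elim: s => [|a s [IH mIH]]; first by rewrite big_nil measure0.
  rewrite big_cons; split; last by apply: measurableU => //; exact: measurable_open (oV a).
  by rewrite measureU0 //; [exact: mV|exact: measurable_open (oV a)].
have : mu setT = 0%E.
  have [m0 mV0] := key (enum_fset D).
  have h : (mu setT <= mu (\big[setU/set0]_(a <- enum_fset D) V a))%E.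
    apply: (le_measure mu); rewrite ?inE//.
    move=> x _; have [a aD Vax] := cover x Logic.I.
    by rewrite -bigcup_seq; exists a.
  by apply/eqP; rewrite -measure_le0; apply: le_trans h _; rewrite m0.
by rewrite probability_setT => /eqP; rewrite onee_eq0.
Qed.

Lemma near_seq (T : eqType) (s : seq T) (Q : T -> G -> Prop) :
  (forall i, i \in s -> \forall t \near (0 : G), Q i t) ->
  \forall t \near (0 : G), forall i, i \in s -> Q i t.
Proof.
elim: s => [_|i s IH h]; first by near=> t.
have h1 := h i (mem_head _ _).
have h2 := IH (fun j js => h j (mem_behead (s := i :: s) js)).
near=> t; move=> j; rewrite inE => /orP[/eqP ->|js].
  by near: t.
by move: j js; near: t.
Unshelve. all: by end_near. Qed.

Lemma normc_prod_sub1 k (z : 'I_k -> R[i]) : (forall j, normc (z j) = 1) ->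
  normc (\prod_(j < k) z j - 1) <= \sum_(j < k) normc (z j - 1).
Proof.
elim: k z => [|k IH] z z1; first by rewrite !big_ord0 subrr normc0.
rewrite !big_ord_recr/=.
have -> : \prod_(j < k) z (widen_ord (leqnSn k) j) * z ord_max - 1 =
    z ord_max * (\prod_(j < k) z (widen_ord (leqnSn k) j) - 1) + (z ord_max - 1).
  by ring.
apply: le_trans (le_normcD _ _) _; rewrite lerD2r normcM z1 mul1r.
exact: IH.
Qed.

(** [Phi] is the normalized indicator of the set [W] on which all characters in [Y] have real part
    at least 1/2, which makes the last bound immediate. The box over a neighbourhood [U] of [0]
    shows that [W] has positive measure. *)
Lemma approx_unit k (Y : seq (dualsum R G)) : (forall g, g \in Y -> dual_head k g) ->
  exists (Phi : XX -> R) (K : R), [/\ measurable_fun setT Phi,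
    forall x, 0 <= Phi x <= K, forall x, Phi (trunc k x) = Phi x,
    \int[P]_x Phi x = 1
    & forall g, g \in Y ->
      2^-1 <= Re (cint P (fun x => ((Phi x)%:C)%C * (character_of g x)^*%C))].
Proof.
(* Real and imaginary part of each factor move by less than [del], so a product of [k] factors moves
   by at most [2 * k * del], which is below 1/2. *)
move=> Yk; pose del : R := (4 * k.+1%:R)^-1.
have del0 : 0 < del by rewrite invr_gt0 mulr_gt0.
have : \forall t \near (0 : G), forall g, g \in Y -> forall j, j \in iota 0 k ->
    normc (g j t - 1) <= 2 * del.
  apply: near_seq => g _; apply: near_seq => j _.
  have [cr ci] := continuous_normc_ReIm (@dual_continuous _ _ (g j)).
  have r0 : \forall t \near (0 : G), `|1 - Re (g j t)| < del.
    have /cvgrPdist_lt/(_ _ del0) := cr 0.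
    by rewrite (_ : Re (g j 0) = 1)// dual_at0.
  have i0 : \forall t \near (0 : G), `|0 - Im (g j t)| < del.
    have /cvgrPdist_lt/(_ _ del0) := ci 0.
    by rewrite (_ : Im (g j 0) = 0)// dual_at0.
  apply: filterS2 r0 i0 => t rt it; apply: le_trans (normc_le_ReIm _) _.
  rewrite ReD ImD /= oppr0 addr0 mulr_natl mulr2n; apply: lerD; apply: ltW.
    by rewrite distrC.
  by rewrite -normrN -sub0r.
rewrite /prop_near1 nbhsE => -[U [oU U0] Uh].
pose W : set XX := \bigcap_(g in [set` Y]) [set x | 2^-1 <= Re (character_of g x)].
have mW : measurable W.
  rewrite /W bigcap_seq; apply: bigsetI_measurable => g _.
  have [mr _] := cmeasurable_character (G := G) g.
  have := measurable_fun_ler (measurable_cst (2^-1 : R)) mr measurableT (Y := [set true]) Logic.I.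
  by rewrite setTI.
have UW : box k (fun=> U) `<=` W.
  move=> x xU g gY /=; have gk := Yk _ gY.
  have h : normc (character_of g x - 1) <= 2^-1.
    rewrite (character_ofE x gk); apply: le_trans (normc_prod_sub1 _) _.
      by move=> j; exact: normc_dual.
    apply: (@le_trans _ _ (\sum_(j < k) 2 * del)).
      apply: ler_sum => j _; apply: (Uh _ (xU _ (ltn_ord j)) g gY).
      by rewrite mem_iota/=.
    rewrite sumr_const card_ord -[_ *+ k]mulr_natl.
    have dE : k.+1%:R * (2 * del) = 2^-1.
      by rewrite /del; field; rewrite addrC natr1 pnatr_eq0.
    by rewrite -dE ler_wpM2r ?ler_nat// mulr_ge0// ltW.
  have := Re_le_normc (1 - character_of g x).
  rewrite -opprB complex.normcN => /le_trans/(_ h).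
  by case: (character_of g x) => u v /=; lra.
have PW : (0 < P W)%E.
  apply: (@lt_le_trans _ _ (P (box k (fun=> U)))).
    rewrite (PP k (fun _ => measurable_open oU)).
    elim: (k) => [|m IH]; first by rewrite big_ord0 lte01.
    by rewrite big_ord_recr/= mule_gt0// haar_open_gt0.
  apply: le_measure => //; rewrite inE//.
  by apply: measurable_box => _; exact: measurable_open.
have PWfin : P W \is a fin_num by exact: fin_num_measure.
pose w := fine (P W).
have w0 : 0 < w by rewrite -lte_fin fineK.
exists (fun x => w^-1 * \1_W x), w^-1.
have Wt x : \1_W (trunc k x) = \1_W x :> R.
  rewrite !indicE; congr (_%:R); congr nat_of_bool.
  by apply/idP/idP; rewrite !inE => h g gY; have := h g gY;
    rewrite /= character_trunc//; exact: Yk.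
have iW : rintegrable P (\1_W : XX -> R).
  exact: integrable_indic.
have I1 : \int[P]_x (w^-1 * \1_W x) = 1.
  rewrite RintegralZl// /Rintegral integral_indic// setIT -/w mulVf// gt_eqF//.
have iPhi : rintegrable P (fun x => w^-1 * \1_W x) by exact: rintegrableZ.
split=> //.
- by apply: measurable_funM => //; exact: measurable_indic.
- move=> x; rewrite indicE; case: (_ \in _); rewrite ?mulr1 ?mulr0 ?lexx invr_ge0 ltW//.
- by move=> x; rewrite Wt.
move=> g gY; have -> : 2^-1 = \int[P]_x (2^-1 * (w^-1 * \1_W x)).
  by rewrite RintegralZl// I1 mulr1.
apply: le_Rintegral => //.
- exact: rintegrableZ.
- have [] := cintegrableM_character (- g) (cintegrable_real iPhi).
  move=> h _; apply: eq_integrable h => // x _.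
  by rewrite /= characterN.
move=> x _; rewrite ReM Re_conj /= mul0r subr0 mulrC.
rewrite indicE; case: (boolP (x \in W)) => [/set_mem/(_ g gY) /= h|_]; last by rewrite mulr0 !mul0r.
by rewrite mulr1 ler_pM2l// invr_gt0.
Unshelve. all: by end_near. Qed.

End ApproximateUnit.

Section FiniteTestFunctions.
Variables (R : realType) (G : topologicalZmodType) (S : choiceType).
Local Notation XX := (power_space G).
Variable P : probability XX R.

Lemma vL1_finite (f : XX -> S -> R[i]) (J : seq S) (K : R) : uniq J ->
  (forall x s, s \notin J -> f x s = 0) -> (forall s, cmeasurable (fun x => f x s)) ->
  (forall x s, s \in J -> normc (f x s) <= K) -> vL1 P measurable f.
Proof.
move=> uJ fJ fm fK; split.
  apply: (sm_intro (N := [set` J])) => //.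
  - exact/finite_set_countable/finite_seq.
  - by move=> x s /= /negP; exact: fJ.
  - by move=> x; apply: (ell2_fin uJ) => s; exact: fJ.
apply: (@le_lt_trans _ _ (\int[P]_x (Num.sqrt (\sum_(s <- J) K ^+ 2))%:E)%E).
  apply: ge0_integral_mono => x; first exact: l2norm_ge0.
  rewrite (l2norm_fin uJ) => [|s]; last exact: fJ.
  rewrite lee_fin ler_sqrt; last by apply: sumr_ge0 => s _; exact: sqr_ge0.
  rewrite big_seq [leRHS]big_seq; apply: ler_sum => s sJ.
  have K0 : 0 <= K by apply: le_trans (fK x s sJ); exact: normc_ge0.
  by rewrite ler_sqr ?nnegrE ?normc_ge0//; exact: fK.
rewrite integral_cst//; apply: lte_mul_pinfty; rewrite ?lee_fin ?sqrtr_ge0//.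
exact: (le_lt_trans (probability_le1 P measurableT) (ltry _)).
Qed.

End FiniteTestFunctions.

(** * Test functions for the first supremum *)

Section TailTest.
Variables (R : realType) (G : topologicalZmodType) (S : choiceType).
Local Notation XX := (power_space G).
Variables (mu : probability (borel G) R) (P : probability XX R).
Hypothesis haarmu : is_haar mu.
Hypothesis PP : is_power_measure mu P.
Variables (k : nat) (X : seq (dualsum R G)) (J : seq S).
Hypotheses (uX : uniq X) (uJ : uniq J).
Hypothesis Xtail : forall t, t \in X -> dual_tail k t /\ t <> 0.
Variables (al : dualsum R G -> S -> R) (Phi : XX -> R) (K : R).
Hypothesis al0 : forall t s, 0 <= al t s.
Hypothesis Phim : measurable_fun setT Phi.
Hypothesis PhiK : forall x, 0 <= Phi x <= K.
Hypothesis Phit : forall x, Phi (trunc k x) = Phi x.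
Hypothesis Phi1 : \int[P]_x Phi x = 1.

Let Phi0 x : 0 <= Phi x. Proof. by case/andP: (PhiK x). Qed.

Let K0 : 0 <= K. Proof. by case/andP: (PhiK (fun=> (0 : G))) => a b; exact: le_trans b. Qed.

Let Phii : rintegrable P Phi.
Proof.
apply: (rintegrable_le Phim (rintegrable_cst P K)) => x.
by rewrite ger0_norm//; case/andP: (PhiK x).
Qed.

(** [F predT] is the test function. Keeping the characters of level at most [j], or equal to [j],
    gives its conditional expectation and its martingale difference of index [j], up to null
    sets. *)
Let F (pr : pred (dualsum R G)) (x : XX) (s : S) : R[i] :=
  if s \in J then
    \sum_(t <- X | pr t) ((al t s)%:C)%C * (((Phi x)%:C)%C * character_of t x)
  else 0.

Let Phich_int t : cintegrable P (fun x => ((Phi x)%:C)%C * character_of t x).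
Proof. by apply: cintegrableM_character; exact: cintegrable_real. Qed.

Let F_cmeasurable pr s : cmeasurable (fun x => F pr x s).
Proof.
rewrite /F; case: (s \in J); last exact: cmeasurable_cst.
apply: cmeasurable_sum => t; apply: cmeasurableM; first exact: cmeasurable_cst.
exact: cintegrable_cmeasurable (Phich_int t).
Qed.

Let F_bound pr x s : s \in J -> normc (F pr x s) <= \sum_(s <- J) \sum_(t <- X) al t s * K.
Proof.
move=> sJ; rewrite /F sJ; apply: le_trans (le_normc_sum _ _ _) _.
apply: (@le_trans _ _ (\sum_(t <- X) al t s * K)).
  rewrite big_mkcond; apply: ler_sum => t _; case: ifP => _; last exact: mulr_ge0.
  rewrite !normcM !normc_real normc_character mulr1 !ger0_norm//.
  by apply: ler_wpM2l => //; case/andP: (PhiK x).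
rewrite (bigD1_seq s)//= lerDl; apply: sumr_ge0 => r _; apply: sumr_ge0 => t _.
exact: mulr_ge0.
Qed.

Let F_vL1 pr : vL1 P measurable (F pr).
Proof.
apply: (vL1_finite P uJ _ (F_cmeasurable pr) (F_bound pr)) => x s sJ.
by rewrite /F (negbTE sJ).
Qed.

Let k_lt_top t : t \in X -> (k < top t)%N.
Proof.
move=> tX; have [tk t0] := Xtail tX; rewrite ltnNge; apply/negP => /dual_headP hk.
apply: t0; apply/val_inj/funext => j /=.
by have [kj|jk] := leqP k j; [exact: hk|exact: tk].
Qed.

(** The characters start above level [k]. So the factor [Phi], which need not be F_j-measurable for
    [j < k], does not appear in the differences up to [k]. *)
Let F_low j x : (j <= k)%N -> F (fun t => (top t <= j)%N) x = 0.
Proof.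
move=> jk; apply/funext => s; rewrite /F; case: ifP => // _.
rewrite big1_seq// => t /andP[tj tX].
by have := leq_ltn_trans (leq_trans tj jk) (k_lt_top tX); rewrite ltnn.
Qed.

Let F_trunc j x : F (fun t => (top t <= j)%N) (trunc j x) = F (fun t => (top t <= j)%N) x.
Proof.
have [jk|kj] := leqP j k; first by rewrite !F_low.
apply/funext => s; rewrite /F; case: ifP => // _; apply: eq_bigr => t /dual_headP tj.
by rewrite character_trunc// -[Phi (trunc j x)]Phit trunc_trunc ?(ltnW kj)// Phit.
Qed.

Let cint_F pr (w : XX -> R[i]) s : s \in J -> cmeasurable w ->
  (forall x, normc (w x) <= 1) ->
  cint P (fun x => w x * F pr x s) =
  \sum_(t <- X | pr t) ((al t s)%:C)%C *
    cint P (fun x => (w x * ((Phi x)%:C)%C) * character_of t x).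
Proof.
move=> sJ wm w1.
have wi t : cintegrable P (fun x => (w x * ((Phi x)%:C)%C) * character_of t x).
  apply: cintegrableM_character; apply: (cintegrableMb wm _ w1).
  exact: cintegrable_real.
transitivity (cint P (fun x => \sum_(t <- X | pr t) ((al t s)%:C)%C *
    ((w x * ((Phi x)%:C)%C) * character_of t x))).
  apply: eq_cint => x; rewrite /F sJ mulr_sumr; apply: eq_bigr => t _; ring.
rewrite cint_sum; last by move=> t; exact: cintegrableZ.
by apply: eq_bigr => t _; rewrite -cintZ.
Qed.

Let orth m (w : XX -> R[i]) g : cmeasurable w -> (forall x, normc (w x) <= 1) ->
  (forall x, w (trunc m x) = w x) -> (k <= m)%N -> ~ dual_head m g ->
  cint P (fun x => (w x * ((Phi x)%:C)%C) * character_of g x) = 0.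
Proof.
move=> wm w1 wt km gm; apply: (cint_character_orth haarmu PP _ _ gm).
  by apply: (cintegrableMb wm _ w1); exact: cintegrable_real.
by move=> x; rewrite wt -[Phi (trunc m x)]Phit trunc_trunc// Phit.
Qed.

Let F_condexp j : is_condexp P (filtration j) (F predT) (F (fun t => (top t <= j)%N)).
Proof.
split; first by apply/vL1_filtration; split; [exact: F_vL1|exact: F_trunc].
move=> A FA; apply/funext => s; rewrite !vintegralE.
have [sJ|sJ] := boolP (s \in J); last first.
  by apply: eq_cint => x; rewrite /F (negbTE sJ).
have mA : measurable A by have /filtrationP[] := FA.
rewrite !cint_F//; [|exact: cmeasurable_indic|exact: normc_indic_le1|
  exact: cmeasurable_indic|exact: normc_indic_le1].
rewrite [LHS]big_mkcond/= [LHS]big_seq [RHS]big_seq; apply: eq_bigr => t tX.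
case: ifP => // /negbT tj.
(* [A] depends on [j] coordinates and [Phi] on [k]; a character of level above both is orthogonal to
   their product. *)
rewrite (orth (m := maxn j k)) ?mulr0//.
- exact: cmeasurable_indic.
- exact: normc_indic_le1.
- move=> x; rewrite -(indic_trunc R (trunc (maxn j k) x) FA) trunc_trunc ?leq_maxl//.
  by rewrite (indic_trunc R x FA).
- exact: leq_maxr.
- move/dual_headP; rewrite leq_max [X in _ || X]leqNgt (k_lt_top tX) orbF.
  by rewrite (negbTE tj).
Qed.

Let D_F : {ae P, forall x, forall j,
  martingale_diff P (@filtration G) (F predT) j x = F (fun t => top t == j) x}.
Proof.
have ae1 j := is_condexp_ae (condexpP PP j (F_vL1 predT)) (F_condexp j).
apply/ae_foralln => -[|j].
  apply: aeW => x; apply/funext => s.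
  rewrite -[LHS]/(cint P (fun x => F predT x s)) /F.
  case: ifPn => [sJ|_]; last by rewrite cint0.
  rewrite [RHS]big1_seq; last first.
    by move=> t /andP[/eqP t0 /k_lt_top]; rewrite t0.
  transitivity (cint P (fun x => 1 * F predT x s)).
    by apply: eq_cint => y; rewrite mul1r /F sJ.
  have m1 : cmeasurable (fun _ : XX => 1 : R[i]) by exact: cmeasurable_cst.
  have n1 : forall _ : XX, normc (1 : R[i]) <= 1 by move=> _; rewrite normc1.
  rewrite cint_F// big1_seq// => t /andP[_ tX].
  rewrite (orth (m := k) m1 n1) ?mulr0//.
  by move/dual_headP; rewrite leqNgt k_lt_top.
apply: filterS2 (ae1 j.+1) (ae1 j) => x /= -> ->.
apply/funext => s; rewrite -[LHS]/(F _ x s - F _ x s) /F; case: ifP => _; last by rewrite subrr.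
apply/eqP; rewrite subr_eq; apply/eqP.
rewrite [LHS]big_mkcond [X in _ = X + _]big_mkcond [X in _ = _ + X]big_mkcond -big_split/=.
apply: eq_bigr => t _; rewrite leq_eqVlt ltnS.
case: eqVneq => [->|_]; first by rewrite ltnn addr0.
by rewrite add0r.
Qed.

Let n := (\max_(t <- X) top t).+1.

Let top_lt t : t \in X -> (top t < n)%N.
Proof. by move=> tX; rewrite ltnS; apply: leq_bigmax_seq. Qed.

Let V j s (x : XX) : R[i] :=
  \sum_(t <- X | top t == j) ((al t s)%:C)%C * character_of t x.

(** [Phi * Num.sqrt Z] is almost everywhere the square function of [F predT], all levels from [n] on
    being empty. *)
Let Z x : R := \sum_(j < n) \sum_(s <- J) normc (V j s x) ^+ 2.

Let l2norm_F j x : l2norm (F (fun t => top t == j) x) =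
  (Phi x * Num.sqrt (\sum_(s <- J) normc (V j s x) ^+ 2))%:E.
Proof.
rewrite (l2norm_fin uJ); last by move=> s sJ; rewrite /F (negbTE sJ).
congr EFin; rewrite -[X in _ = X * _]ger0_norm// -sqrtr_sqr -sqrtrM ?sqr_ge0//.
congr Num.sqrt; rewrite mulr_sumr big_seq [RHS]big_seq; apply: eq_bigr => s sJ.
rewrite /F sJ -exprMn; congr (_ ^+ 2).
have -> : \sum_(t <- X | top t == j) ((al t s)%:C)%C * (((Phi x)%:C)%C * character_of t x) =
    ((Phi x)%:C)%C * V j s x.
  by rewrite mulr_sumr; apply: eq_bigr => t _; rewrite mulrCA.
by rewrite normcM normc_real ger0_norm.
Qed.

Let series_F x :
  (\sum_(0 <= j <oo) l2norm (F (fun t => top t == j) x) ^+ 2 = (Phi x ^+ 2 * Z x)%:E)%E.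
Proof.
rewrite (nneseries_split 0 n); last first.
  by move=> j _; rewrite expe2 mule_ge0// l2norm_ge0.
rewrite add0n [X in (_ + X)%E]eseries0 ?adde0; last first.
  move=> j nj _; rewrite l2norm_F /V big1 ?sqrtr0 ?mulr0 ?expe2 ?mule0// => s _.
  rewrite big1_seq ?normc0 ?expr0n// => t /andP[/eqP tj /top_lt].
  by rewrite tj ltnNge nj.
rewrite big_mkord /Z mulr_sumr -sumEFin; apply: eq_bigr => j _.
rewrite l2norm_F -EFin_expe exprMn sqr_sqrtr//.
by apply: sumr_ge0 => s _; exact: sqr_ge0.
Qed.

Let VK j s x : normc (V j s x) <= \sum_(t <- X | top t == j) normc (((al t s)%:C)%C).
Proof. exact: normc_charsum_le. Qed.

Let Vm j s : cmeasurable (V j s). Proof. exact: cmeasurable_charsum. Qed.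

Let PhiV_int j s : rintegrable P (fun x => Phi x * normc (V j s x) ^+ 2).
Proof. exact: rintegrable_sqr_normc Phii (Vm j s) (VK j s). Qed.

Let PhiZ_int : rintegrable P (fun x => Phi x * Z x).
Proof.
have := rintegrable_sum (index_enum 'I_n) xpredT (fun j : 'I_n =>
  rintegrable_sum J xpredT (fun s => PhiV_int j s)).
congr rintegrable; apply/funext => x; rewrite /Z mulr_sumr.
by apply: eq_bigr => j _; rewrite mulr_sumr.
Qed.

(** Elements of [X] are their own tails, so distinct ones lie in distinct cosets of Γ^k, and
    orthogonality for the weight [Phi] leaves the diagonal. *)
Let PhiZ_le : \int[P]_x (Phi x * Z x) <= \sum_(s <- J) \sum_(t <- X) al t s ^+ 2.
Proof.
have -> : \int[P]_x (Phi x * Z x) =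
    \sum_(j < n) \sum_(s <- J) \int[P]_x (Phi x * normc (V j s x) ^+ 2).
  transitivity (\int[P]_x \sum_(j < n) \sum_(s <- J) (Phi x * normc (V j s x) ^+ 2)).
    apply: eq_Rintegral => x _; rewrite /Z mulr_sumr.
    by apply: eq_bigr => j _; rewrite mulr_sumr.
  rewrite Rint_sum; last by move=> j; exact: rintegrable_sum.
  by apply: eq_bigr => j _; rewrite Rint_sum.
rewrite exchange_big/=; apply: ler_sum => s _.
apply: (@le_trans _ _ (\sum_(j < n) \sum_(t <- X | top t == j) al t s ^+ 2)).
  apply: ler_sum => j _.
  have al_le t : normc (((al t s)%:C)%C : R[i]) <= al t s by rewrite normc_real ger0_norm.
  apply: le_trans (weighted_orth haarmu PP X (fun t => top t == j) Phii Phi0 Phit al_le) _.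
  rewrite Phi1 mulr1 big_seq_cond [leRHS]big_seq_cond; apply: ler_sum => t /andP[tX tj].
  rewrite big_seq_cond (eq_bigl (fun t' => (t' \in X) && (t' == t))); last first.
    move=> t'; case: (boolP (t' \in X)) => //= t'X.
    have tl (r : dualsum R G) : r \in X -> tail_proj k r = r.
      move=> rX; apply/val_inj/funext => i /=; case: ltnP => // ik.
      by have [/(_ _ ik) ->] := Xtail rX.
    rewrite !tl// [t == t']eq_sym; case: (eqVneq t' t) => [->|_]; last by rewrite andbF.
    by rewrite tj.
  rewrite -big_seq_cond -big_filter filter_pred1_uniq// big_seq1 expr2//.
rewrite (exchange_big_dep xpredT)//= big_seq [leRHS]big_seq; apply: ler_sum => t tX.
by rewrite (big_pred1 (Ordinal (top_lt tX))).
Qed.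

Let H1_le (sg : R) : 0 < sg -> \sum_(s <- J) \sum_(t <- X) al t s ^+ 2 <= sg ^+ 2 ->
  (H1norm P (@filtration G) (F predT) <= sg%:E)%E.
Proof.
move=> sg0 alsg.
(* AM-GM: [Phi * sqrt Z <= Phi * Z / (2 sg) + sg * Phi / 2] *)
pose r x := (2 * sg)^-1 * (Phi x * Z x) + sg / 2 * Phi x.
have Z0 x : 0 <= Z x.
  by apply: sumr_ge0 => j _; apply: sumr_ge0 => s _; exact: sqr_ge0.
have r0 x : 0 <= r x.
  by apply: addr_ge0; rewrite !mulr_ge0// ?invr_ge0 ?mulr_ge0// ltW.
have ri : rintegrable P r by apply: rintegrableD; exact: rintegrableZ.
apply: (@le_trans _ _ (\int[P]_x (r x)%:E)%E).
  apply: ae_le_integral => //.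
  - by move=> x; exact: sqrte_ge0.
  - exact: measurable_int ri.
  apply: filterS D_F => x Dx.
  under eq_eseriesr do rewrite Dx.
  rewrite series_F /= lee_fin sqrtrM ?sqr_ge0// sqrtr_sqr ger0_norm//.
  have u0 := sqrtr_ge0 (Z x); have uE := sqr_sqrtr (Z0 x).
  rewrite /r -{2}uE; move: (Num.sqrt (Z x)) u0 (Phi x) (Phi0 x) => u u0 p p0.
  rewrite -subr_ge0 (_ : _ - _ = p * ((u - sg) ^+ 2) / (2 * sg)); last first.
    by field; rewrite gt_eqF.
  by apply: divr_ge0; [rewrite mulr_ge0 ?sqr_ge0|rewrite mulr_ge0// ltW].
rewrite -(fineK (integrable_fin_num measurableT ri)) lee_fin -/(Rintegral P setT r).
rewrite RintegralD// ?RintegralZl//; [|exact: rintegrableZ..].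
rewrite Phi1 mulr1.
apply: (@le_trans _ _ ((2 * sg)^-1 * sg ^+ 2 + sg / 2)).
  rewrite lerD2r; apply: ler_wpM2l; first by rewrite invr_ge0 mulr_ge0// ltW.
  exact: le_trans PhiZ_le alsg.
rewrite le_eqVlt; apply/orP; left; apply/eqP; field; by rewrite gt_eqF.
Qed.

(** Another [t'] of [X] differs from [t] by an element outside Γ^k, so its term integrates to zero
    against [Phi] times a character of Γ^k. What remains is a coefficient of [Phi], the same for all
    [t]. *)
Let fourier_F g t s : dual_head k g -> t \in X -> s \in J ->
  fourier P (F predT) (g + t) s =
  ((al t s)%:C)%C * cint P (fun x => ((Phi x)%:C)%C * (character_of g x)^*%C).
Proof.
move=> gk tX sJ.
have gm h : cmeasurable (fun x : XX => (character_of h x)^*%C).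
  exact/cmeasurable_conj/cmeasurable_character.
have g1 h (x : XX) : normc (character_of h x)^*%C <= 1.
  by rewrite normc_conj normc_character.
transitivity (cint P (fun x => (character_of (g + t) x)^*%C * F predT x s)).
  by apply: eq_cint => x; rewrite mulrC.
rewrite cint_F// (bigD1_seq t)//= big1_seq ?addr0.
  congr (_ * _); apply: eq_cint => x.
  have h : character_of t x * (character_of t x)^*%C = 1.
    by rewrite mulc_conj normc_character expr1n.
  rewrite characterD conjcM -[RHS]mulr1 -h; ring.
move=> t' /andP[t't t'X].
have -> : cint P (fun x => (character_of (g + t) x)^*%C * (Phi x)%:C%C * character_of t' x) =
    cint P (fun x => ((character_of g x)^*%C * (Phi x)%:C%C) * character_of (t' - t) x).
  by apply: eq_cint => x; rewrite characterB characterD conjcM; ring.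
rewrite (orth (m := k)) ?mulr0//.
  by move=> x; rewrite character_trunc.
move=> hk; move/eqP: t't; apply; apply/val_inj/funext => j /=.
have [kj|jk] := leqP k j.
  by apply/eqP; rewrite -subr_eq0; apply/eqP; exact: hk.
by have [-> // _] := Xtail t'X; have [-> // _] := Xtail tX.
Qed.

Variable lambda : dualsum R G -> S -> R.
Hypothesis lambda0 : forall g s, 0 <= lambda g s.
Variable M : R.
Hypothesis M0 : 0 <= M.
Hypothesis multM : forall f : XX -> S -> R[i], vH1 P (@filtration G) f ->
  (\esum_(p in [set: dualsum R G * S])
    (lambda p.1 p.2 * normc (fourier P f p.1 p.2))%:E <= M%:E * H1norm P (@filtration G) f)%E.

Lemma tail_test_bound (Y : seq (dualsum R G)) (sg : R) : uniq Y ->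
  (forall g, g \in Y -> dual_head k g) ->
  (forall g, g \in Y ->
      2^-1 <= Re (cint P (fun x => ((Phi x)%:C)%C * (character_of g x)^*%C))) ->
  0 < sg -> \sum_(s <- J) \sum_(t <- X) al t s ^+ 2 <= sg ^+ 2 ->
  \sum_(s <- J) \sum_(t <- X) al t s * \sum_(g <- Y) lambda (g + t) s <= 2 * M * sg.
Proof.
move=> uY Yk YPhi sg0 alsg.
have H1 := H1_le sg0 alsg.
have FH : vH1 P (@filtration G) (F predT).
  by split; [exact: F_vL1|exact: le_lt_trans H1 (ltry _)].
have := multM FH; set E := (\esum_(p in _) _)%E => EM.
(* The triples index terms of the multiplier sum without repetition, since [g + t] determines its
   head [g] and its tail [t]. *)
pose T3 := [seq (s, tg) | s <- J, tg <- [seq (t, g) | t <- X, g <- Y]].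
have T3P q : q \in T3 -> [/\ q.1 \in J, q.2.1 \in X & q.2.2 \in Y].
  by move=> /allpairsP[[s tg] /= [sJ /allpairsP[[t g] /= [tX gY ->]] ->]].
have uT3 : uniq T3.
  apply: allpairs_uniq => //; last by move=> [? ?] [? ?].
  by apply: allpairs_uniq => // -[? ?] [? ?].
pose L := [seq (q.2.2 + q.2.1, q.1) | q <- T3].
have uL : uniq L.
  rewrite map_inj_in_uniq// => -[s [t g]] [s' [t' g']] /T3P/=[_ tX gY] /T3P/=[_ t'X g'Y] E0.
  have gt : g + t = g' + t' := congr1 fst E0; have <- : s = s' := congr1 snd E0.
  have tt : t = t'.
    apply/val_inj/funext => j /=; have [kj|jk] := leqP k j.
      have := congr1 (fun d : dualsum R G => d j) gt.
      rewrite -[(g + t) j]/(g j + t j) -[(g' + t') j]/(g' j + t' j).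
      by rewrite (Yk _ gY)// (Yk _ g'Y)// !add0r.
    by have [-> // _] := Xtail tX; have [-> // _] := Xtail t'X.
  by move: gt; rewrite tt => /addIr ->.
have LE : ((\sum_(p <- L) lambda p.1 p.2 * normc (fourier P (F predT) p.1 p.2))%:E <= E)%E.
  by rewrite -sumEFin; exact: le_sum_esum.
have := le_trans LE (le_trans EM (lee_wpmul2l _ H1)).
rewrite -EFinM !lee_fin => /(_ M0) h.
(* The factor 2 pays for the lower bound 1/2 on the coefficients of [Phi]. *)
rewrite -mulrA -ler_pdivrMl//; apply: le_trans h.
rewrite /L big_map /T3 big_allpairs mulr_sumr big_seq [leRHS]big_seq.
apply: ler_sum => s sJ; rewrite big_allpairs mulr_sumr big_seq [leRHS]big_seq.
apply: ler_sum => t tX; rewrite !mulr_sumr big_seq [leRHS]big_seq.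
apply: ler_sum => g gY.
rewrite -[leRHS]/(lambda (g + t) s * normc (fourier P (F predT) (g + t) s)).
rewrite fourier_F//; last exact: Yk.
rewrite normcM normc_real ger0_norm// mulrA mulrC; apply: ler_wpM2l => //.
rewrite mulrC; apply: ler_wpM2l => //.
apply: le_trans (YPhi g gY) _; exact: Re_le_normc.
Qed.

End TailTest.

(** * Test functions for the second supremum *)

Section HeadTest.
Variables (R : realType) (G : topologicalZmodType) (S : choiceType).
Local Notation XX := (power_space G).
Variables (mu : probability (borel G) R) (P : probability XX R).
Hypothesis haarmu : is_haar mu.
Hypothesis PP : is_power_measure mu P.
Variables (k : nat) (J : seq S) (u : XX -> R) (K : R) (v : S -> R).
Hypothesis uJ : uniq J.
Hypothesis v0 : forall s, 0 <= v s.
Hypothesis um : measurable_fun setT u.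
Hypothesis uK : forall x, `|u x| <= K.
Hypothesis ut : forall x, u (trunc k x) = u x.
Hypothesis u2 : \int[P]_x `|u x| <= 2.
Hypothesis ucond : forall j A, (j < k)%N -> filtration j A ->
  cint P (fun x => ((\1_A x : R)%:C)%C * ((u x)%:C)%C) = 0.

Let ui : rintegrable P u.
Proof. exact: rintegrable_le um (rintegrable_cst P K) uK. Qed.

(** A fixed vector times [u]. By [ut] and [ucond] it is almost everywhere its own martingale
    difference of index [k], so its square function is its norm. *)
Let f (x : XX) (s : S) : R[i] := if s \in J then ((v s)%:C)%C * ((u x)%:C)%C else 0.

Let f_cmeasurable s : cmeasurable (fun x => f x s).
Proof.
rewrite /f; case: (s \in J); last exact: cmeasurable_cst.
by apply: cmeasurableM; [exact: cmeasurable_cst|exact: cmeasurable_real].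
Qed.

Let f_vL1 : vL1 P measurable f.
Proof.
apply: (vL1_finite P uJ (K := \sum_(s <- J) v s * K)) => [x s sJ|//|x s sJ].
  by rewrite /f (negbTE sJ).
have K0 : 0 <= K by apply: le_trans (uK x); exact: normr_ge0.
rewrite /f sJ normcM !normc_real ger0_norm//.
apply: (@le_trans _ _ (v s * K)); first by rewrite ler_wpM2l.
rewrite (bigD1_seq s)//= lerDl; apply: sumr_ge0 => t _; exact: mulr_ge0.
Qed.

Let f_trunc x : f (trunc k x) = f x.
Proof. by apply/funext => s; rewrite /f ut. Qed.

Let cond0 j : vL1 P (filtration j) (fun (_ : XX) (_ : S) => 0 : R[i]).
Proof.
apply/vL1_filtration; split=> //.
by apply: (vL1_finite P (J := [::]) (K := 0)) => // s; exact: cmeasurable_cst.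
Qed.

Let f_condexp j :
  is_condexp P (filtration j) f (if (k <= j)%N then f else fun=> (fun=> 0)).
Proof.
have [kj|jk] := leqP k j.
  split=> //; apply/vL1_filtration; split=> // x.
  by rewrite -[LHS]f_trunc trunc_trunc// f_trunc.
split=> // A FA; apply/funext => s; rewrite !vintegralE.
have mA : measurable A by have /filtrationP[] := FA.
transitivity (0 : R[i]).
  by rewrite -[RHS](cint0 P); apply: eq_cint => x; rewrite /= mulr0.
rewrite /f; case: (s \in J); last first.
  by rewrite -[LHS](cint0 P); apply: eq_cint => x; rewrite mulr0.
transitivity (((v s)%:C)%C * cint P (fun x => ((\1_A x : R)%:C)%C * ((u x)%:C)%C)).
  by rewrite (ucond jk FA) mulr0.
rewrite -cintZ; first by apply: eq_cint => x; rewrite mulrCA.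
apply: (cintegrableMb (cmeasurable_indic R mA) _ (normc_indic_le1 R A)).
exact: cintegrable_real.
Qed.

Let D_f : {ae P, forall x, forall j,
  martingale_diff P (@filtration G) f j x = if j == k then f x else 0}.
Proof.
have ae1 j := is_condexp_ae (condexpP PP j f_vL1) (f_condexp j).
apply/ae_foralln => -[|j].
  (* For [k = 0] the function depends on no coordinate, so it is constant and equals its mean; for
     [k > 0] its mean vanishes, by the case of the whole space in [f_condexp]. *)
  apply: aeW => x; case: eqVneq => [k0|k0].
    apply/funext => s; rewrite -[LHS]/(cint P (fun x => f x s)).
    have fc y : f y s = f x s.
      have yx : trunc k y = trunc k x.
        by apply: (@funext nat (borel G)) => i; rewrite -k0 /trunc /splice.
      by rewrite -[f y]f_trunc yx f_trunc.
    by under eq_cint do rewrite fc; rewrite cint_cst.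
  have [_ h] := f_condexp 0.
  have F0 : @filtration G 0 setT.
    by apply/filtrationP; split=> //; apply/seteqP; split.
  have k_gt0 : (0 < k)%N by rewrite lt0n eq_sym.
  rewrite -[LHS]/(vintegral P setT f) -(h setT F0) leqNgt k_gt0/=.
  apply/funext => s; exact: cint0.
apply: filterS2 (ae1 j.+1) (ae1 j) => x /= -> ->.
have [kj|jk|kj] := ltngtP k j.+1.
- by rewrite -ltnS kj subrr.
- by rewrite leqNgt (ltnW jk)/= subrr.
- by rewrite kj ltnn; apply/funext => s; rewrite -[LHS]/(f x s - 0) subr0.
Qed.

Let l2norm_f x : l2norm (f x) = (`|u x| * Num.sqrt (\sum_(s <- J) v s ^+ 2))%:E.
Proof.
rewrite (l2norm_fin uJ); last by move=> s sJ; rewrite /f (negbTE sJ).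
congr EFin; rewrite -sqrtr_sqr -sqrtrM ?sqr_ge0//; congr Num.sqrt.
rewrite mulr_sumr big_seq [RHS]big_seq; apply: eq_bigr => s sJ.
by rewrite /f sJ normcM !normc_real exprMn mulrC !real_normK ?num_real.
Qed.

Let H1_le (sg : R) : 0 < sg -> \sum_(s <- J) v s ^+ 2 <= sg ^+ 2 ->
  (H1norm P (@filtration G) f <= (2 * sg)%:E)%E.
Proof.
move=> sg0 vsg.
have ri : rintegrable P (fun x => sg * `|u x|).
  by apply: rintegrableZ; have := integrable_norm ui.
apply: (@le_trans _ _ (\int[P]_x (sg * `|u x|)%:E)%E).
  apply: ae_le_integral => //.
  - by move=> x; exact: sqrte_ge0.
  - by move=> x; rewrite lee_fin mulr_ge0// ltW.
  - exact: measurable_int ri.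
  apply: filterS D_f => x Dx.
  have -> : (\sum_(0 <= j <oo) l2norm (martingale_diff P (@filtration G) f j x) ^+ 2 =
      l2norm (f x) ^+ 2)%E.
    under eq_eseriesr do rewrite Dx.
    rewrite (nneseries_split 0 k.+1); last first.
      by move=> j _; rewrite expe2 mule_ge0// l2norm_ge0.
    have l0 : l2norm (0 : S -> R[i]) = 0%E.
      by rewrite (@l2norm_fin _ _ _ [::])// big_nil sqrtr0.
    rewrite add0n [X in (_ + X)%E]eseries0 ?adde0; last first.
      by move=> j kj _; rewrite gtn_eqF// l0 expe2 mule0.
    rewrite big_nat_recr//= eqxx big_nat big1 ?add0e// => j /andP[_ jk].
    by rewrite ltn_eqF// l0 mule0.
  rewrite sqrte_sqr gee0_abs ?l2norm_ge0// l2norm_f lee_fin mulrC ler_wpM2r//.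
  by rewrite -[leRHS]ger0_norm ?(ltW sg0)// -sqrtr_sqr ler_sqrt ?sqr_ge0.
rewrite -(fineK (integrable_fin_num measurableT ri)) lee_fin -/(Rintegral P setT _).
rewrite RintegralZl//; last by have := integrable_norm ui.
by rewrite mulrC ler_wpM2r// ltW.
Qed.

Variable lambda : dualsum R G -> S -> R.
Hypothesis lambda0 : forall g s, 0 <= lambda g s.
Variable M : R.
Hypothesis M0 : 0 <= M.
Hypothesis multM : forall f : XX -> S -> R[i], vH1 P (@filtration G) f ->
  (\esum_(p in [set: dualsum R G * S])
    (lambda p.1 p.2 * normc (fourier P f p.1 p.2))%:E <= M%:E * H1norm P (@filtration G) f)%E.

Lemma head_test_bound (Y : seq (dualsum R G)) (sg : R) : uniq Y ->
  (forall g, g \in Y ->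
      2^-1 <= Re (cint P (fun x => ((u x)%:C)%C * (character_of g x)^*%C))) ->
  0 < sg -> \sum_(s <- J) v s ^+ 2 <= sg ^+ 2 ->
  \sum_(s <- J) v s * \sum_(g <- Y) lambda g s <= 4 * M * sg.
Proof.
move=> uY Yu sg0 vsg; have H1 := H1_le sg0 vsg.
have fH : vH1 P (@filtration G) f.
  by split; [exact: f_vL1|exact: le_lt_trans H1 (ltry _)].
have := multM fH; set E := (\esum_(p in _) _)%E => EM.
pose L := [seq (g, s) | s <- J, g <- Y].
have uL : uniq L by apply: allpairs_uniq => // -[? ?] [? ?] _ _ [-> ->].
have LE : ((\sum_(p <- L) lambda p.1 p.2 * normc (fourier P f p.1 p.2))%:E <= E)%E.
  by rewrite -sumEFin; exact: le_sum_esum.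
have := le_trans LE (le_trans EM (lee_wpmul2l _ H1)).
rewrite -EFinM !lee_fin => /(_ M0) h.
(* One factor 2 comes from the H^1 norm of [f], the other from the coefficients of [u]. *)
have -> : 4 * M * sg = 2 * (M * (2 * sg)) by ring.
rewrite -ler_pdivrMl//; apply: le_trans h.
rewrite /L big_allpairs_dep mulr_sumr big_seq [leRHS]big_seq.
apply: ler_sum => s sJ; rewrite !mulr_sumr big_seq [leRHS]big_seq.
apply: ler_sum => g gY.
rewrite -[leRHS]/(lambda g s * normc (fourier P f g s)).
have -> : fourier P f g s =
    ((v s)%:C)%C * cint P (fun x => ((u x)%:C)%C * (character_of g x)^*%C).
  rewrite -cintZ; last first.
    have := cintegrableM_character (- g) (cintegrable_real ui).
    by congr cintegrable; apply/funext => x; rewrite characterN.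
  by apply: eq_cint => x; rewrite /f sJ mulrA.
rewrite normcM normc_real ger0_norm// mulrA mulrC; apply: ler_wpM2l => //.
rewrite mulrC; apply: ler_wpM2l => //.
apply: le_trans (Yu g gY) _; exact: Re_le_normc.
Qed.

End HeadTest.

(** * Assembly of the lower bound *)

Section LowerBound.
Variables (R : realType) (G : topologicalZmodType) (S : choiceType).
Local Notation XX := (power_space G).
Variables (mu : probability (borel G) R) (P : probability XX R).
Hypothesis haarmu : is_haar mu.
Hypothesis PP : is_power_measure mu P.
Hypothesis cG : compact [set: G].
Variable lambda : dualsum R G -> S -> R.
Hypothesis lambda0 : forall g s, 0 <= lambda g s.
Variable M : R.
Hypothesis M0 : 0 <= M.
Hypothesis multM : forall f : XX -> S -> R[i], vH1 P (@filtration G) f ->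
  (\esum_(p in [set: dualsum R G * S])
    (lambda p.1 p.2 * normc (fourier P f p.1 p.2))%:E <= M%:E * H1norm P (@filtration G) f)%E.

Lemma QA_le k : (QA lambda k <= ((2 * M) ^+ 2)%:E)%E.
Proof.
apply: esum_le => X uX Xtail.
rewrite -esum_sum; last first.
  by move=> s t _ _; rewrite expe2 mule_ge0// esum_ge0// => g _; rewrite lee_fin.
apply: esum_le => J uJ _.
(* Duality is used over the pairs [(s, t)] jointly: the test function carries one coefficient for
   each pair. *)
have := @esum_duality R _ _ (@dual_head R G k) (fun g p => lambda (g + p.2) p.1)
  [seq (s, t) | s <- J, t <- X] (2 * M).
rewrite big_allpairs; apply => //.
- by apply: allpairs_uniq => // -[? ?] [? ?].
- by rewrite mulr_ge0.
move=> al sg Y al0 sg0; rewrite !big_allpairs => alsg uY Yk.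
have [Phi [K [Phim PhiK Phit Phi1 PhiY]]] := approx_unit haarmu PP cG Yk.
exact: (tail_test_bound haarmu PP uX uJ Xtail (fun t s => al0 (s, t)) Phim PhiK Phit Phi1
  lambda0 M0 multM uY Yk PhiY sg0 alsg).
Qed.

(* The witness is [Phi - E_{k-1} Phi], or [Phi] if [k = 0], with [Phi] from
   [approx_unit]: subtracting [E_{k-1} Phi] does not affect the coefficients at
   characters of top level [k]. *)
Lemma approx_unit_top k (Y : seq (dualsum R G)) :
  (forall g, g \in Y -> dual_head_top k g) ->
  exists (u : XX -> R) (K : R), [/\ measurable_fun setT u,
    forall x, `|u x| <= K, forall x, u (trunc k x) = u x
    & [/\ \int[P]_x `|u x| <= 2,
    forall j A, (j < k)%N -> filtration j A ->
      cint P (fun x => ((\1_A x : R)%:C)%C * ((u x)%:C)%C) = 0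
    & forall g, g \in Y ->
      2^-1 <= Re (cint P (fun x => ((u x)%:C)%C * (character_of g x)^*%C))]].
Proof.
move=> Ytop; have Yk g : g \in Y -> dual_head k g by move=> /Ytop[].
have [Phi [K [Phim PhiK Phit Phi1 PhiY]]] := approx_unit haarmu PP cG Yk.
have Phi0 x : 0 <= Phi x by case/andP: (PhiK x).
have Phii : rintegrable P Phi.
  apply: (rintegrable_le Phim (rintegrable_cst P K)) => x.
  by rewrite ger0_norm//; case/andP: (PhiK x).
have aPhi : \int[P]_x `|Phi x| = 1.
  by rewrite -Phi1; apply: eq_Rintegral => x _; rewrite ger0_norm.
case: k Ytop Yk Phit => [|k] Ytop Yk Phit.
  exists Phi, K; split=> //; first by move=> x; rewrite ger0_norm//; case/andP: (PhiK x).
  by split=> //; rewrite aPhi ler1n.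
(* The level is now [k.+1], so the expectation to subtract is the one given the first [k]
   coordinates. *)
pose E x := \int[P]_y Phi (splice k x y).
have EC x : cexp P k (fun x => ((Phi x)%:C)%C) x = ((E x)%:C)%C by exact: cint_real.
have PhiC := cintegrable_real Phii.
have ECi : cintegrable P (fun x => ((E x)%:C)%C).
  have := cexp_cintegrable PP k PhiC; congr cintegrable; apply/funext => x.
  exact: EC.
have Ei : rintegrable P E by case: ECi.
have E0 x : 0 <= E x by apply: Rintegral_ge0.
have sliceI x : rintegrable P (fun y => Phi (splice k x y)).
  apply: (rintegrable_le _ (rintegrable_cst P K)) => [|y].
    exact: (measurableT_comp Phim (measurable_splicer k x)).
  by rewrite ger0_norm//; case/andP: (PhiK (splice k x y)).
have EK x : E x <= K.
  have -> : K = \int[P]_y K.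
    by have := congr1 (@complex.Re R) (cint_cst P ((K%:C)%C)).
  apply: le_Rintegral; [exact: measurableT|exact: sliceI|exact: rintegrable_cst|].
  by move=> y _; case/andP: (PhiK (splice k x y)).
have Et x : E (trunc k x) = E x.
  by apply: eq_Rintegral => y _; rewrite splice_trunc.
have Et' x : E (trunc k.+1 x) = E x by rewrite -Et trunc_trunc// Et.
have E1 : \int[P]_x E x = 1.
  have := cint_cexp PP k PhiC; under eq_cint do rewrite EC.
  by rewrite !cint_real Phi1 => -[].
exists (fun x => Phi x - E x), (K + K); split.
- by apply: measurable_funB => //; exact: rintegrable_measurable Ei.
- move=> x; apply: le_trans (ler_normB _ _) _; apply: lerD; rewrite ger0_norm//.
  by case/andP: (PhiK x).
- by move=> x; rewrite Phit Et'.
split.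
(* [Phi] and its conditional expectation are both nonnegative of integral 1, whence the bound 2. *)
- apply: (@le_trans _ _ (\int[P]_x (Phi x + E x))).
    apply: le_Rintegral => //.
    + have := rintegrableD Phii (rintegrableZ (-1) Ei).
      move=> /integrable_norm; apply: eq_integrable => // x _.
      by rewrite /= mulN1r.
    + exact: rintegrableD.
    + move=> x _; apply: le_trans (ler_normB _ _) _.
      by rewrite !ger0_norm.
  by rewrite RintegralD// Phi1 E1.
- move=> j A jk FA; have mA : measurable A by have /filtrationP[] := FA.
  have wt x : ((\1_A (trunc k x) : R)%:C)%C = ((\1_A x : R)%:C)%C.
    by rewrite -(indic_trunc R (trunc k x) FA) trunc_trunc// (indic_trunc R x FA).
  have := cint_cexpM PP PhiC (cmeasurable_indic R mA) (normc_indic_le1 R A) wt.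
  under eq_cint do rewrite EC.
  move=> EE; have iA u : cintegrable P u -> cintegrable P (fun x => ((\1_A x : R)%:C)%C * u x).
    by move=> iu; exact: cintegrableMb (cmeasurable_indic R mA) iu (normc_indic_le1 R A).
  transitivity (cint P (fun x => ((\1_A x : R)%:C)%C * ((Phi x)%:C)%C +
      (-1) * (((\1_A x : R)%:C)%C * ((E x)%:C)%C))).
    by apply: eq_cint => x; rewrite rmorphB/=; ring.
  rewrite cintD; [|exact: iA|by apply: cintegrableZ; exact: iA].
  by rewrite cintZ ?EE ?mulN1r ?subrr//; exact: iA.
- move=> g gY; have [gk g0] := Ytop g gY.
  have ich u : cintegrable P u -> cintegrable P (fun x => u x * (character_of g x)^*%C).
    move=> iu; have := cintegrableM_character (- g) iu.
    by congr cintegrable; apply/funext => x; rewrite characterN.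
  have Eg : cint P (fun x => ((E x)%:C)%C * (character_of g x)^*%C) = 0.
    under eq_cint do rewrite -characterN.
    apply: (cint_character_orth haarmu PP (k := k)) => //.
      by move=> x; rewrite Et.
    move=> /(_ k (leqnn k)) /eqP; rewrite -[(- g) k]/(- (g k)) oppr_eq0.
    by apply/negP; exact: g0.
  have -> : cint P (fun x => ((Phi x - E x)%:C)%C * (character_of g x)^*%C) =
      cint P (fun x => ((Phi x)%:C)%C * (character_of g x)^*%C).
    transitivity (cint P (fun x => ((Phi x)%:C)%C * (character_of g x)^*%C +
        (-1) * (((E x)%:C)%C * (character_of g x)^*%C))).
      by apply: eq_cint => x; rewrite rmorphB/=; ring.
    rewrite cintD; [|exact: ich|by apply: cintegrableZ; exact: ich].
    by rewrite cintZ ?Eg ?mulr0 ?addr0//; exact: ich.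
  exact: PhiY.
Qed.

Lemma QB_le k : (QB lambda k <= ((4 * M) ^+ 2)%:E)%E.
Proof.
apply: esum_le => J uJ _.
apply: (@esum_duality R _ _ (@dual_head_top R G k) lambda J (4 * M)) => //.
  by rewrite mulr_ge0.
move=> al sg Y al0 sg0 alsg uY Yk.
have [u [K [um uK ut [u2 ucond uY2]]]] := approx_unit_top Yk.
exact: (head_test_bound PP uJ al0 um uK ut u2 ucond lambda0 M0 multM uY uY2 sg0 alsg).
Qed.

Lemma Qnorm_le : (Qnorm lambda <= (6 * M)%:E)%E.
Proof.
have sq (c : R) y : 0 <= c -> (y <= ((c * M) ^+ 2)%:E)%E -> (sqrte y <= (c * M)%:E)%E.
  move=> c0 h; have cM0 : 0 <= c * M by rewrite mulr_ge0.
  rewrite -[c * M]ger0_norm// -sqrtr_sqr.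
  rewrite -[((Num.sqrt _)%:E)%E]/(sqrte ((c * M) ^+ 2)%:E) lee_sqrt//.
  by rewrite lee_fin sqr_ge0.
have -> : (6 * M)%:E = ((2 * M)%:E + (4 * M)%:E)%E.
  by rewrite -EFinD; congr EFin; ring.
by apply: leeD; apply: ge_ereal_sup => _ [k _ <-]; apply: sq => //;
  [exact: QA_le|exact: QB_le].
Qed.

End LowerBound.

Unset Implicit Arguments.

Theorem corollary2p2 (R : realType) :
  exists c C : R, 0 < c /\ c <= C /\
    forall (G : topologicalZmodType) (mu : probability (borel G) R)
      (P : probability (power_space G) R) (S : choiceType)
      (lambda : dualsum R G -> S -> R),
      compact [set: G] -> hausdorff_space G ->
      is_haar mu -> is_power_measure mu P ->
      (forall g s, 0 <= lambda g s) ->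
      (c%:E * Qnorm lambda <= multiplier_norm P lambda)%E /\
      (multiplier_norm P lambda <= C%:E * Qnorm lambda)%E.
Proof.
exists 6^-1, 2; split; first by rewrite invr_gt0.
split; first by apply: (@le_trans _ _ 1); [rewrite invf_le1 ?ler1n|rewrite ler1n].
move=> G mu P S lambda cG _ haarmu PP lambda0; split; last first.
  exact (@multiplier_norm_le_Qnorm R G S mu P haarmu PP lambda lambda0).
(* The bound is proved for each admissible [M]; an infinite one satisfies it trivially, and [0 <= M]
   excludes minus infinity. *)
apply: le_ereal_inf_tmp => -[M| |] [M0 multM]; rewrite ?leey//.
have := Qnorm_le haarmu PP cG lambda0 M0 multM.
rewrite EFinM => QM; rewrite lee_pdivrMl//.
Qed.
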